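(* Let $\mathcal L$ be a language enriching the language of rings, $T$ an $\mathcal L$-theory of large fields, and $I$ a (possibly infinite) set of theories $T_i$, each eliminating quantifiers in a relational expansion $\mathcal L_i$ of the ring language, the expansions being pairwise disjoint, and such that for every $\mathcal L$-field $K\models T_I$ and every $i\in I$, any model of $T_{i,K}$ can be expanded to a model of $T_K$. Assume that, for all $i\in I$: (A) for every $F\models T_{i,\forall}$, $\mathrm{acl}_i(F)\subseteq F^{\mathrm a}$; (Z) for every $\mathcal L_i$-definable set $X\subseteq\mathbb A^{n+m}$, the set $\{s\in\mathbb A^n : \dim(X_s)=m\}$ is $\mathcal L_i$-definable, where $X_s$ is the fiber of $X$ in $s$. Then the class of $I$-pseudo $T$-closed fields is elementary --- in fact, inductive --- in the language $\mathcal L\cup\mathcal L_I$.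
   Context: A variety over $K$ is a separated integral scheme of finite type over $K$; $V_{\mathrm{sm}}(M)$ is the set of smooth $M$-points. A field $K$ is large if every irreducible variety $V$ over $K$ with $V_{\mathrm{sm}}(K)\neq\emptyset$ has $V(K)$ Zariski dense. An $\mathcal L$-field is an $\mathcal L$-structure that is a field. $T_K$ is the theory of models of $T$ containing $K$ as an $\mathcal L$-substructure. As a harmless convention, algebraically closed fields are assumed to be (expandable to) models of $T$. A field extension $K\le F$ is totally $T$ if for every $M\models T_K$, $F$ embeds over $K$ as a ring in some $M^\star\succcurlyeq M$. $F^{\mathrm a}$ is the field-theoretic algebraic closure of $F$; an extension $K\le F$ is regular if $F$ is linearly disjoint from $K^{\mathrm a}$ over $K$. $\mathcal L_I=\bigcup_i\mathcal L_i$; $T_{i,\forall}$ is the set of universal consequences of $T_i$; $T_I=\bigcup_iT_{i,\forall}$; all $\mathcal L_i$-formulas are taken quantifier-free. $T_{i,K}$ is the theory of models of $T_i$ containing $K$ as an $\mathcal L_i$-substructure. $\mathrm{acl}_i$ is the model-theoretic algebraic closure in models of $T_i$. For a set $X$ definable over $K$, $\dim(X)$ is the algebraic dimension: the maximum of $\mathrm{trdeg}(a/K)$ for $a\in X$ in an elementary extension. An $\mathcal L$-field $K\models T_I$ is $I$-pseudo $T$-closed if any regular totally $T$ extension $K\le F\models T_I$ (of $\mathcal L_I$-structures) is $\mathcal L_I$-existentially closed. A class is inductive if it is the class of models of a theory and is closed under unions of chains. *)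

(* Defs.v *)
From HB Require Import structures.
From mathcomp Require Import all_boot all_order all_algebra.
From mathcomp Require Import mpoly.

Set Implicit Arguments.
Unset Strict Implicit.
Unset Printing Implicit Defensive.

Import GRing.Theory.
Local Open Scope ring_scope.

(* The symbols of all the languages at hand, apart from 0, 1, +, -, *, which
   are built into terms and structures. *)
Record symbols := Symbols {
  funsym : Type; fun_arity : funsym -> nat;
  relsym : Type; rel_arity : relsym -> nat }.

(* A language enriching the ring language is a set of symbols, so that languages
   may overlap and unions of languages are genuine unions.  For a language A, an
   A-structure is represented by a structure interpreting all of the symbols;
   every notion below indexed by A ignores the symbols outside A. *)
Record language (S : symbols) := Language {
  has_fun : funsym S -> Prop;
  has_rel : relsym S -> Prop }.

Definition ring_language (S : symbols) : language S :=
  Language (fun=> False) (fun=> False).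

Definition lang_union (S : symbols) (A B : language S) : language S :=
  Language (fun f => has_fun A f \/ has_fun B f)
           (fun r => has_rel A r \/ has_rel B r).

Definition lang_bigunion (S : symbols) (I : Type) (A : I -> language S) :
    language S :=
  Language (fun f => exists i, has_fun (A i) f)
           (fun r => exists i, has_rel (A i) r).

Definition relational (S : symbols) (A : language S) : Prop :=
  forall f, ~ has_fun A f.

Definition pairwise_disjoint (S : symbols) (I : Type) (A : I -> language S) :
    Prop :=
  forall i j, i <> j ->
    (forall f, ~ (has_fun (A i) f /\ has_fun (A j) f)) /\
    (forall r, ~ (has_rel (A i) r /\ has_rel (A j) r)).

Inductive term (S : symbols) : Type :=
| TVar of nat
| TZero
| TOne
| TAdd of term S & term S
| TOpp of term S
| TMul of term S & term S
| TFun (f : funsym S) of ('I_(fun_arity f) -> term S).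

Inductive formula (S : symbols) : Type :=
| FEq of term S & term S
| FRel (r : relsym S) of ('I_(rel_arity r) -> term S)
| FNot of formula S
| FAnd of formula S & formula S
| FOr of formula S & formula S
| FAll of nat & formula S
| FEx of nat & formula S.

Fixpoint term_in (S : symbols) (A : language S) (t : term S) : Prop :=
  match t with
  | TVar _ | TZero | TOne => True
  | TAdd t1 t2 | TMul t1 t2 => term_in A t1 /\ term_in A t2
  | TOpp t1 => term_in A t1
  | TFun f ts => has_fun A f /\ forall i, term_in A (ts i)
  end.

Fixpoint formula_in (S : symbols) (A : language S) (phi : formula S) : Prop :=
  match phi with
  | FEq t1 t2 => term_in A t1 /\ term_in A t2
  | FRel r ts => has_rel A r /\ forall i, term_in A (ts i)
  | FNot p => formula_in A p
  | FAnd p q | FOr p q => formula_in A p /\ formula_in A q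
  | FAll _ p | FEx _ p => formula_in A p
  end.

Fixpoint term_var (S : symbols) (k : nat) (t : term S) : Prop :=
  match t with
  | TVar n => k = n
  | TZero | TOne => False
  | TAdd t1 t2 | TMul t1 t2 => term_var k t1 \/ term_var k t2
  | TOpp t1 => term_var k t1
  | TFun f ts => exists i, term_var k (ts i)
  end.

Fixpoint free_var (S : symbols) (k : nat) (phi : formula S) : Prop :=
  match phi with
  | FEq t1 t2 => term_var k t1 \/ term_var k t2
  | FRel r ts => exists i, term_var k (ts i)
  | FNot p => free_var k p
  | FAnd p q | FOr p q => free_var k p \/ free_var k q
  | FAll n p | FEx n p => k <> n /\ free_var k p
  end.

Definition sentence (S : symbols) (phi : formula S) : Prop :=
  forall k, ~ free_var k phi.

Fixpoint quantifier_free (S : symbols) (phi : formula S) : Prop :=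
  match phi with
  | FEq _ _ => True
  | FRel _ _ => True
  | FNot p => quantifier_free p
  | FAnd p q | FOr p q => quantifier_free p /\ quantifier_free q
  | FAll _ _ | FEx _ _ => False
  end.

Fixpoint universal (S : symbols) (phi : formula S) : Prop :=
  match phi with
  | FAll _ p => universal p
  | p => quantifier_free p
  end.

Fixpoint existential (S : symbols) (phi : formula S) : Prop :=
  match phi with
  | FEx _ p => existential p
  | p => quantifier_free p
  end.

Record structure (S : symbols) := Structure {
  dom :> Type;
  s_zero : dom;
  s_one : dom;
  s_add : dom -> dom -> dom;
  s_opp : dom -> dom;
  s_mul : dom -> dom -> dom;
  s_fun : forall f : funsym S, ('I_(fun_arity f) -> dom) -> dom;
  s_rel : forall r : relsym S, ('I_(rel_arity r) -> dom) -> Prop }.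

Fixpoint eval (S : symbols) (M : structure S) (v : nat -> M) (t : term S) : M :=
  match t with
  | TVar n => v n
  | TZero => s_zero M
  | TOne => s_one M
  | TAdd t1 t2 => s_add (eval v t1) (eval v t2)
  | TOpp t1 => s_opp (eval v t1)
  | TMul t1 t2 => s_mul (eval v t1) (eval v t2)
  | TFun f ts => s_fun (fun i => eval v (ts i))
  end.

Definition update (X : Type) (v : nat -> X) (n : nat) (x : X) : nat -> X :=
  fun k => if k == n then x else v k.

Fixpoint sat (S : symbols) (M : structure S) (v : nat -> M) (phi : formula S) :
    Prop :=
  match phi with
  | FEq t1 t2 => eval v t1 = eval v t2
  | FRel r ts => s_rel (fun i => eval v (ts i))
  | FNot p => ~ sat v p
  | FAnd p q => sat v p /\ sat v q
  | FOr p q => sat v p \/ sat v q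
  | FAll n p => forall x, sat (update v n x) p
  | FEx n p => exists x, sat (update v n x) p
  end.
Arguments sat {S} M v phi.

Definition theory (S : symbols) := formula S -> Prop.

Definition theory_in (S : symbols) (A : language S) (T : theory S) : Prop :=
  forall phi, T phi -> formula_in A phi /\ sentence phi.

Definition models (S : symbols) (M : structure S) (T : theory S) : Prop :=
  forall phi, T phi -> forall v : nat -> M, sat M v phi.

Definition embedding (S : symbols) (A : language S) (M N : structure S)
    (e : M -> N) : Prop :=
  [/\ injective e,
      e (s_zero M) = s_zero N /\ e (s_one M) = s_one N,
      [/\ forall x y, e (s_add x y) = s_add (e x) (e y),
          forall x, e (s_opp x) = s_opp (e x) &
          forall x y, e (s_mul x y) = s_mul (e x) (e y)],
      forall f, has_fun A f ->
        forall x, e (@s_fun S M f x) = s_fun (fun i => e (x i)) &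
      forall r, has_rel A r ->
        forall x, @s_rel S M r x <-> s_rel (fun i => e (x i))].
Arguments embedding {S} A M N e.

Definition isomorphism (S : symbols) (A : language S) (M N : structure S)
    (e : M -> N) : Prop :=
  bijective e /\ embedding A M N e.
Arguments isomorphism {S} A M N e.

Definition elementary_embedding (S : symbols) (A : language S)
    (M N : structure S) (e : M -> N) : Prop :=
  forall phi, formula_in A phi -> forall v : nat -> M,
    sat M v phi <-> sat N (fun k => e (v k)) phi.
Arguments elementary_embedding {S} A M N e.

Definition existentially_closed (S : symbols) (A : language S)
    (M N : structure S) (e : M -> N) : Prop :=
  forall phi, formula_in A phi -> existential phi -> forall v : nat -> M,
    sat N (fun k => e (v k)) phi -> sat M v phi.
Arguments existentially_closed {S} A M N e.

Definition eliminates_quantifiers (S : symbols) (A : language S)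
    (T : theory S) : Prop :=
  forall phi, formula_in A phi ->
    exists psi, [/\ formula_in A psi, quantifier_free psi,
      forall k, free_var k psi -> free_var k phi &
      forall M : structure S, models M T ->
        forall v : nat -> M, sat M v phi <-> sat M v psi].

Definition universal_consequences (S : symbols) (A : language S)
    (T : theory S) : theory S :=
  fun phi => [/\ formula_in A phi, sentence phi, universal phi &
    forall M : structure S, models M T -> forall v : nat -> M, sat M v phi].

Definition acl (S : symbols) (A : language S) (X : Type) (M : structure S)
    (e : X -> M) (b : M) : Prop :=
  exists (phi : formula S) (v : nat -> X), let w := fun k => e (v k) in
    [/\ formula_in A phi, sat M (update w 0%N b) phi &
        exists (n : nat) (s : 'I_n -> M),
          forall x, sat M (update w 0%N x) phi -> exists i, x = s i].
Arguments acl {S} A {X} M e b.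

Definition elementary_class (S : symbols) (A : language S)
    (C : structure S -> Prop) : Prop :=
  exists T : theory S, theory_in A T /\ forall M, C M <-> models M T.

(* The chain is given as a family of substructures of its union U, totally
   ordered by inclusion and covering U. *)
Definition closed_under_chain_unions (S : symbols) (A : language S)
    (C : structure S -> Prop) : Prop :=
  forall (J : Type) (U : structure S) (M : J -> structure S)
         (e : forall j, M j -> U),
    (forall j, embedding A (M j) U (@e j)) ->
    (forall j k, (forall x, exists y, e j x = e k y) \/
                 (forall y, exists x, e k y = e j x)) ->
    (forall u, exists j x, u = e j x) ->
    (forall j, C (M j)) -> C U.

Definition inductive_class (S : symbols) (A : language S)
    (C : structure S -> Prop) : Prop :=
  elementary_class A C /\ closed_under_chain_unions A C.

Record lfield (S : symbols) := LField {
  lf_field :> fieldType;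
  lf_fun : forall f : funsym S, ('I_(fun_arity f) -> lf_field) -> lf_field;
  lf_rel : forall r : relsym S, ('I_(rel_arity r) -> lf_field) -> Prop }.

Definition lf_structure (S : symbols) (K : lfield S) : structure S :=
  @Structure S (lf_field K) 0 1 +%R -%R *%R (@lf_fun S K) (@lf_rel S K).

Coercion lf_structure : lfield >-> structure.

Definition algebraically_independent (K E : fieldType) (c : K -> E) (d : nat)
    (b : 'I_d -> E) : Prop :=
  forall q : {mpoly K[d]}, mmap c b q = 0 -> q = 0.

(* C is an algebraic closure of F and K^a is computed in C: a family of elements
   of K^a that is linearly independent over K stays so over F. *)
Definition regular (K F : fieldType) (e : K -> F) : Prop :=
  exists (C : fieldType) (j : {rmorphism F -> C}),
    [/\ GRing.closed_field_axiom C, forall x, algebraicOver j x &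
        forall (n : nat) (c : 'I_n -> C),
          (forall i, algebraicOver (j \o e) (c i)) ->
          (forall a : 'I_n -> K, \sum_i j (e (a i)) * c i = 0 ->
             forall i, a i = 0) ->
          (forall a : 'I_n -> F, \sum_i j (a i) * c i = 0 ->
             forall i, a i = 0)].

(* An affine integral K-scheme of finite type is given by a prime ideal p of
   some K[X_1, ..., X_n]. *)
Definition rational_point (K : fieldType) (n : nat) (p : {pred {mpoly K[n]}})
    (a : 'I_n -> K) : Prop :=
  forall f, f \in p -> f.@[a] = 0.

(* The transcendence degree of the function field is at least d: d of the
   coordinate functions are algebraically independent modulo p. *)
Definition variety_dim_ge (K : fieldType) (n : nat) (p : {pred {mpoly K[n]}})
    (d : nat) : Prop :=
  exists t : 'I_d -> 'I_n, forall q : {mpoly K[d]},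
    mmap (@mpolyC n K) (fun i => 'X_(t i)) q \in p -> q = 0.

Definition variety_dim (K : fieldType) (n : nat) (p : {pred {mpoly K[n]}})
    (d : nat) : Prop :=
  variety_dim_ge p d /\ ~ variety_dim_ge p d.+1.

(* Jacobian criterion at a rational point.  The f i need not generate p: the
   Jacobian matrix of any family in p has rank at most n - d at a, and adding
   generators of p to the family does not lower the rank. *)
Definition smooth_point (K : fieldType) (n : nat) (p : {pred {mpoly K[n]}})
    (a : 'I_n -> K) : Prop :=
  rational_point p a /\
  exists d, variety_dim p d /\
    exists (r : nat) (f : 'I_r -> {mpoly K[n]}), (forall i, f i \in p) /\
      (\rank (\matrix_(i < r, j < n) ((f i)^`M(j)).@[a]) + d)%N = n.

(* Affine varieties suffice: a smooth point of a variety lies in an affine open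
   subvariety, which is dense. *)
Definition large (K : fieldType) : Prop :=
  forall (n : nat) (p : {pred {mpoly K[n]}}),
    idealr_closed p -> prime_idealr_closed p ->
    (exists a, smooth_point p a) ->
    forall g : {mpoly K[n]},
      (forall a, rational_point p a -> g.@[a] = 0) -> g \in p.

Definition theory_of_large_fields (S : symbols) (T : theory S) : Prop :=
  forall M : structure S, models M T ->
    exists (K : lfield S) (g : K -> M),
      isomorphism (ring_language S) K M g /\ large K.

(* X is the set of (x_n, ..., x_(n+m-1)) such that phi(v_0, ..., v_(n-1), x)
   holds in M; the bound is witnessed by a point of X in an elementary extension
   having d coordinates algebraically independent over M. *)
Definition fiber_dim_ge (S : symbols) (A : language S) (phi : formula S)
    (n m : nat) (M : lfield S) (v : nat -> M) (d : nat) : Prop :=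
  exists (N : lfield S) (h : M -> N) (w : nat -> N),
    [/\ elementary_embedding A M N h,
        forall k, (k < n)%N -> w k = h (v k),
        sat N w phi &
        exists t : 'I_d -> 'I_m,
          algebraically_independent h (fun i => w (n + t i)%N)].

Definition fiber_dim (S : symbols) (A : language S) (phi : formula S)
    (n m : nat) (M : lfield S) (v : nat -> M) (d : nat) : Prop :=
  fiber_dim_ge A phi n m v d /\ ~ fiber_dim_ge A phi n m v d.+1.

Definition models_TI (S : symbols) (I : Type) (LI : I -> language S)
    (TI : I -> theory S) (K : structure S) : Prop :=
  forall i, models K (universal_consequences (LI i) (TI i)).

Definition totally (S : symbols) (L : language S) (T : theory S)
    (K F : structure S) (e : K -> F) : Prop :=
  forall (M : structure S) (a : K -> M), models M T -> embedding L K M a ->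
    exists (M' : structure S) (h : M -> M') (g : F -> M'),
      [/\ elementary_embedding L M M' h,
          embedding (ring_language S) F M' g &
          forall x, g (e x) = h (a x)].
Arguments totally {S} L T K F e.

Definition pseudo_closed (S : symbols) (L : language S) (T : theory S)
    (I : Type) (LI : I -> language S) (TI : I -> theory S) (K : lfield S) :
    Prop :=
  models_TI LI TI K /\
  forall (F : lfield S) (e : K -> F),
    embedding (lang_bigunion LI) K F e -> models_TI LI TI F ->
    regular e -> totally L T K F e ->
    existentially_closed (lang_bigunion LI) K F e.

Definition pseudo_closed_class (S : symbols) (L : language S) (T : theory S)
    (I : Type) (LI : I -> language S) (TI : I -> theory S) (M : structure S) :
    Prop :=
  exists (K : lfield S) (g : K -> M),
    isomorphism (lang_union L (lang_bigunion LI)) K M g /\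
    pseudo_closed L T LI TI K.

(* The expansion to a model of T_K is taken up to an isomorphism g over L_i. *)
Definition expansion_property (S : symbols) (L : language S) (T : theory S)
    (I : Type) (LI : I -> language S) (TI : I -> theory S) (i : I) : Prop :=
  forall K : lfield S, models_TI LI TI K ->
    forall (M : structure S) (a : K -> M),
      models M (TI i) -> embedding (LI i) K M a ->
      exists (N : structure S) (g : M -> N),
        [/\ isomorphism (LI i) M N g, models N T &
            embedding L K N (fun x => g (a x))].

Definition algebraically_closed_expandable (S : symbols) (T : theory S) :
    Prop :=
  forall C : fieldType, GRing.closed_field_axiom C ->
    exists (fs : forall f : funsym S, ('I_(fun_arity f) -> C) -> C)
           (rs : forall r : relsym S, ('I_(rel_arity r) -> C) -> Prop),
      models (LField fs rs) T.

(* Only fields F and M are considered, as F^a requires; a root in M of a nonzero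
   polynomial over F is what an element of F^a in M is. *)
Definition condition_A (S : symbols) (A : language S) (T : theory S) : Prop :=
  forall F : lfield S, models F (universal_consequences A T) ->
    forall (M : lfield S) (a : F -> M), models M T -> embedding A F M a ->
      forall b : M, acl A M a b -> algebraicOver a b.

(* The formula theta is uniform in the models of T. *)
Definition condition_Z (S : symbols) (A : language S) (T : theory S) : Prop :=
  forall (n m : nat) (phi : formula S),
    formula_in A phi -> quantifier_free phi ->
    (forall k, free_var k phi -> (k < n + m)%N) ->
    exists theta : formula S,
      [/\ formula_in A theta, quantifier_free theta,
          forall k, free_var k theta -> (k < n)%N &
          forall M : lfield S, models M T -> forall s : nat -> M,
            sat M s theta <-> fiber_dim A phi n m s m].

(* Main.v *)
(* A field K |= T_I is pseudo T-closed iff every system of the following kind has a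
   solution in K: an absolutely irreducible hypersurface f(t, y) = 0 over K with
   df/dy <> 0 and a smooth point in every model of T_K, together with a ring formula
   and finitely many quantifier-free L_i-formulas in rational functions of (t, y), each
   of which has, separately, a solution generic over K in a field extension, resp. in a
   model of T_(i, K).

   If K is pseudo T-closed, then for every i the function field F of the hypersurface
   embeds in a model of T_(i, K): for the finitely many i at hand by hypothesis, for the
   others because the model can be taken large, so that the hypersurface is dense in it.
   The languages being disjoint, F becomes a model of T_I, regular and totally T over K,
   hence K is existentially closed in it.  Conversely a finitely generated regular
   extension is the function field of such a hypersurface (primitive element), and each
   of the formulas extracted from a quantifier-free formula realized in F is realized in
   a model of T_(i, F).

   By (A) and (Z), the existence of a generic solution in a model of T_(i, K) is a
   quantifier-free condition on the coefficients of the system.  It follows that the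
   criterion is preserved by ultraproducts, where absolute irreducibility descends to
   the factors by a bound on degrees, and by existentially closed substructures.  A model
   of the forall-exists consequences of the class is existentially closed in an
   ultraproduct of its members, so these consequences axiomatize the class. *)
From HB Require Import structures.
From mathcomp Require Import all_boot all_order all_algebra all_field.
From mathcomp Require Import boolp classical_sets.
From mathcomp Require filter.
From mathcomp Require Import mpoly.
From mathcomp Require Import fingroup perm ring zify generic_quotient.
Require Import Defs.

Set Implicit Arguments.
Unset Strict Implicit.
Unset Printing Implicit Defensive.

Import GRing.Theory.
Local Open Scope ring_scope.

(** * Semantics *)

(** No axioms are written down: forall-exists sentences pass to unions of chains, so both assertions
    follow once every model of the forall-exists consequences is shown to lie in the class. This
    sidesteps the clause asking for a smooth point in every model of [T] over [K], which is not
    visibly first-order. It is enough that this clause passes from an ultraproduct to almost all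
    factors, as models without a smooth point have an ultraproduct without one, and from an
    existentially closed [K] up to its extension [N], as a model of [T] over [N] is one over [K].

    (A) and (Z) are joined across a gap: (Z) measures dimension by points generic over a model, the
    criterion wants points generic over [K] only. By (A) a solution generic over [K] has infinitely
    many alternatives in each coordinate, so solutions avoid any hypersurface over the model;
    compactness then gives a point generic over the model.

    The [LI i] being relational, every subfield is a substructure and every term a ring term. So
    each atom lives in a single language, and the parts of a formula can be realized in separate
    models. *)

Section Semantics.

Variable S : symbols.
Implicit Types (A : language S) (t : term S) (phi : formula S) (M N : structure S).

Lemma eval_ext M (v w : nat -> M) t :
  (forall k, term_var k t -> v k = w k) -> eval v t = eval w t.
Proof.
elim: t => [n|||t1 IH1 t2 IH2|t1 IH1|t1 IH1 t2 IH2|f ts IH] /= H //.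
- exact: H.
- by rewrite IH1 ?IH2 // => k ?; apply: H; [right|left].
- by rewrite IH1.
- by rewrite IH1 ?IH2 // => k ?; apply: H; [right|left].
- congr (s_fun _); apply: funext => i; apply: IH => k ?; apply: H; by exists i.
Qed.

Lemma sat_ext M (v w : nat -> M) phi :
  (forall k, free_var k phi -> v k = w k) -> sat M v phi <-> sat M w phi.
Proof.
elim: phi v w => [t1 t2|r ts|p IH|p IHp q IHq|p IHp q IHq|n p IH|n p IH] v w /= H.
- by rewrite (@eval_ext _ v w t1) ?(@eval_ext _ v w t2) // => k ?; apply: H; [right|left].
- suff -> : (fun i => eval v (ts i)) = (fun i => eval w (ts i)) by [].
  by apply: funext => i; apply: eval_ext => k ?; apply: H; exists i.
- by rewrite (IH v w).
- by rewrite (IHp v w) ?(IHq v w) // => k ?; apply: H; [right|left].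
- by rewrite (IHp v w) ?(IHq v w) // => k ?; apply: H; [right|left].
- have E x : sat M (update v n x) p <-> sat M (update w n x) p.
    by apply: IH => k kp; rewrite /update; case: eqP => // ?; apply: H.
  by split=> Hx x; apply/E.
have E x : sat M (update v n x) p <-> sat M (update w n x) p.
  by apply: IH => k kp; rewrite /update; case: eqP => // ?; apply: H.
by split=> -[x /E ?]; exists x.
Qed.

Lemma sentence_sat M (v w : nat -> M) phi :
  sentence phi -> sat M v phi -> sat M w phi.
Proof. by move=> sphi; apply: (proj1 (sat_ext _)) => k /sphi. Qed.

Fixpoint term_ren (r : nat -> nat) t : term S :=
  match t with
  | TVar n => TVar S (r n)
  | TZero => TZero S
  | TOne => TOne S
  | TAdd t1 t2 => TAdd (term_ren r t1) (term_ren r t2)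
  | TOpp t1 => TOpp (term_ren r t1)
  | TMul t1 t2 => TMul (term_ren r t1) (term_ren r t2)
  | TFun f ts => TFun (fun i => term_ren r (ts i))
  end.

(* Meaningful on quantifier-free formulas only: bound variables are not renamed. *)
Fixpoint formula_ren (r : nat -> nat) phi : formula S :=
  match phi with
  | FEq t1 t2 => FEq (term_ren r t1) (term_ren r t2)
  | FRel R ts => FRel (fun i => term_ren r (ts i))
  | FNot p => FNot (formula_ren r p)
  | FAnd p q => FAnd (formula_ren r p) (formula_ren r q)
  | FOr p q => FOr (formula_ren r p) (formula_ren r q)
  | FAll n p => FAll n (formula_ren r p)
  | FEx n p => FEx n (formula_ren r p)
  end.

Lemma eval_ren M (v : nat -> M) r t : eval v (term_ren r t) = eval (v \o r) t.
Proof.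
elim: t => [n|||t1 IH1 t2 IH2|t1 IH1|t1 IH1 t2 IH2|f ts IH] //=;
  rewrite ?IH1 ?IH2 //.
by congr (s_fun _); apply: funext.
Qed.

Lemma sat_ren M (v : nat -> M) r phi : quantifier_free phi ->
  sat M v (formula_ren r phi) <-> sat M (v \o r) phi.
Proof.
elim: phi => [t1 t2|R ts|p IH|p IHp q IHq|p IHp q IHq|n p IH|n p IH] //=.
- by rewrite !eval_ren.
- move=> _; suff -> : (fun i => eval v (term_ren r (ts i))) =
    (fun i => eval (v \o r) (ts i)) by [].
  by apply: funext => i; rewrite eval_ren.
- by move=> qp; rewrite IH.
- by move=> [qp qq]; rewrite IHp // IHq.
- by move=> [qp qq]; rewrite IHp // IHq.
Qed.

Lemma term_in_ren A r t : term_in A t -> term_in A (term_ren r t).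
Proof.
elim: t => [n|||t1 IH1 t2 IH2|t1 IH1|t1 IH1 t2 IH2|f ts IH] //=.
- by move=> [/IH1 ? /IH2 ?].
- by move=> [/IH1 ? /IH2 ?].
- by move=> [? H]; split=> // i; apply: IH.
Qed.

Lemma formula_in_ren A r phi : formula_in A phi -> formula_in A (formula_ren r phi).
Proof.
elim: phi => [t1 t2|R ts|p IH|p IHp q IHq|p IHp q IHq|n p IH|n p IH] //=.
- by move=> [? ?]; split; apply: term_in_ren.
- by move=> [? H]; split=> // i; apply: term_in_ren.
- by move=> [/IHp ? /IHq ?].
- by move=> [/IHp ? /IHq ?].
Qed.

Lemma qf_ren r phi : quantifier_free phi -> quantifier_free (formula_ren r phi).
Proof.
by elim: phi => //= [p IHp q IHq|p IHp q IHq] [/IHp ? /IHq ?].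
Qed.

Lemma term_var_ren r t k : term_var k (term_ren r t) -> exists l, term_var l t /\ k = r l.
Proof.
elim: t => [n|||t1 IH1 t2 IH2|t1 IH1|t1 IH1 t2 IH2|f ts IH] //=.
- by move=> ->; exists n.
- by move=> [/IH1|/IH2] [l [? ->]]; exists l; split=> //; [left|right].
- by move=> [/IH1|/IH2] [l [? ->]]; exists l; split=> //; [left|right].
- by move=> [i /IH[l [? ->]]]; exists l; split=> //; exists i.
Qed.

Lemma free_var_ren r phi k : quantifier_free phi ->
  free_var k (formula_ren r phi) -> exists l, free_var l phi /\ k = r l.
Proof.
elim: phi => [t1 t2|R ts|p IH|p IHp q IHq|p IHp q IHq|n p IH|n p IH] //=.
- by move=> _ [|] /term_var_ren[l [? ->]]; exists l; split=> //; [left|right].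
- by move=> _ [i /term_var_ren[l [? ->]]]; exists l; split=> //; exists i.
- by move=> [qp qq] [/(IHp qp)|/(IHq qq)] [l [? ->]]; exists l; split=> //; [left|right].
- by move=> [qp qq] [/(IHp qp)|/(IHq qq)] [l [? ->]]; exists l; split=> //; [left|right].
Qed.

Lemma term_var_bound t : exists B, forall k, term_var k t -> (k < B)%N.
Proof.
elim: t => [n|||t1 [B1 H1] t2 [B2 H2]|t1 [B1 H1]|t1 [B1 H1] t2 [B2 H2]|f ts IH] /=.
- by exists n.+1 => k ->.
- by exists 0%N.
- by exists 0%N.
- by exists (maxn B1 B2) => k [/H1|/H2] lt; rewrite leq_max lt ?orbT.
- by exists B1.
- by exists (maxn B1 B2) => k [/H1|/H2] lt; rewrite leq_max lt ?orbT.
have [B HB] := choice IH; exists (\max_i B i) => k [i /HB lt].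
by apply: (leq_trans lt); apply: leq_bigmax.
Qed.

Lemma free_var_bound phi : exists B, forall k, free_var k phi -> (k < B)%N.
Proof.
elim: phi => [t1 t2|R ts|p IH|p [B1 H1] q [B2 H2]|p [B1 H1] q [B2 H2]|n p [B H]|n p [B H]] /=.
- have [[B1 H1] [B2 H2]] := (term_var_bound t1, term_var_bound t2).
  by exists (maxn B1 B2) => k [/H1|/H2] lt; rewrite leq_max lt ?orbT.
- have [B HB] := choice (fun i => term_var_bound (ts i)).
  exists (\max_i B i) => k [i /HB lt].
  by apply: (leq_trans lt); apply: leq_bigmax.
- exact: IH.
- by exists (maxn B1 B2) => k [/H1|/H2] lt; rewrite leq_max lt ?orbT.
- by exists (maxn B1 B2) => k [/H1|/H2] lt; rewrite leq_max lt ?orbT.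
- by exists B => k [_ /H].
- by exists B => k [_ /H].
Qed.

Lemma eval_embedding A M N (e : M -> N) (v : nat -> M) t :
  embedding A M N e -> term_in A t -> eval (fun k => e (v k)) t = e (eval v t).
Proof.
move=> [_ [e0 e1] [eD eN eM] ef _].
elim: t => [n|||t1 IH1 t2 IH2|t1 IH1|t1 IH1 t2 IH2|f ts IH] //=.
- by move=> [/IH1 -> /IH2 ->]; rewrite eD.
- by move=> /IH1 ->; rewrite eN.
- by move=> [/IH1 -> /IH2 ->]; rewrite eM.
- by move=> [Af H]; rewrite ef //; congr (s_fun _); apply: funext => i; apply: IH.
Qed.

Lemma sat_embedding A M N (e : M -> N) (v : nat -> M) phi :
    embedding A M N e -> formula_in A phi -> quantifier_free phi ->
  sat N (fun k => e (v k)) phi <-> sat M v phi.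
Proof.
move=> emb; have [einj _ _ _ er] := emb.
elim: phi => [t1 t2|R ts|p IH|p IHp q IHq|p IHp q IHq|n p IH|n p IH] //=.
- by move=> [? ?] _; rewrite !(eval_embedding v emb) //; split=> [/einj|->].
- move=> [AR H] _; rewrite er //.
  suff -> : (fun i => eval (fun k => e (v k)) (ts i)) = (fun i => e (eval v (ts i))) by [].
  by apply: funext => i; apply: (eval_embedding v emb).
- by move=> ? ?; rewrite IH.
- by move=> [? ?] [? ?]; rewrite IHp // IHq.
- by move=> [? ?] [? ?]; rewrite IHp // IHq.
Qed.

(** Preservation in one direction suffices, quantifier-free formulas being closed under negation;
    negated atoms give injectivity and the reflection of relations. *)
Lemma embedding_of_sat A M N (e : M -> N) :
    (forall phi, formula_in A phi -> quantifier_free phi -> forall v : nat -> M,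
      sat M v phi -> sat N (fun k => e (v k)) phi) ->
  embedding A M N e.
Proof.
move=> H; pose X n := TVar S n.
pose val (x y z : M) n := nth z [:: x; y] n.
have einj : injective e.
  move=> x y exy; apply: contrapT => xy.
  exact: (H (FNot (FEq (X 0%N) (X 1%N))) (conj I I) I (val x y y) xy exy).
split=> //.
- split; first exact: (H (FEq (X 0%N) (TZero S)) (conj I I) I (fun=> s_zero M) erefl).
  exact: (H (FEq (X 0%N) (TOne S)) (conj I I) I (fun=> s_one M) erefl).
- split=> [x y|x|x y].
  + exact: esym (H (FEq (TAdd (X 0%N) (X 1%N)) (X 2%N)) (conj (conj I I) I) I
      (val x y (s_add x y)) erefl).
  + exact: esym (H (FEq (TOpp (X 0%N)) (X 2%N)) (conj I I) I (val x x (s_opp x)) erefl).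
  + exact: esym (H (FEq (TMul (X 0%N) (X 1%N)) (X 2%N)) (conj (conj I I) I) I
      (val x y (s_mul x y)) erefl).
- move=> f Af x.
  (* The arguments sit at the variables below the arity and the value of [f] at the variable
     [fun_arity f], so that one equation expresses the claim. *)
  pose w n := if insub n is Some i then x i else s_fun x.
  have wi (i : 'I_(fun_arity f)) : w i = x i by rewrite /w valK.
  have wf : w (fun_arity f) = s_fun x by rewrite /w insubF // ltnn.
  have wE : (fun i : 'I_(fun_arity f) => eval w (X i)) = x by apply: funext => i /=.
  have := H (FEq (TFun (fun i : 'I_(fun_arity f) => X i)) (X (fun_arity f)))
    (conj (conj Af (fun=> I)) I) I w.
  rewrite /= (_ : (fun i : 'I_(fun_arity f) => w i) = x); last by apply: funext.
  rewrite wf (_ : (fun i : 'I_(fun_arity f) => e (w i)) = (fun i => e (x i))).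
    by move=> /(_ erefl).
  by apply: funext => i; rewrite wi.
move=> r Ar x.
pose w n := if insub n is Some i then x i else s_zero M.
have wi (i : 'I_(rel_arity r)) : w i = x i by rewrite /w valK.
have wE : (fun i : 'I_(rel_arity r) => w i) = x by apply: funext => i.
have ewE : (fun i : 'I_(rel_arity r) => e (w i)) = (fun i => e (x i)).
  by apply: funext => i; rewrite wi.
have := H (FRel (fun i : 'I_(rel_arity r) => X i)) (conj Ar (fun=> I)) I w.
have := H (FNot (FRel (fun i : 'I_(rel_arity r) => X i))) (conj Ar (fun=> I)) I w.
by rewrite /= wE ewE => H1 H2; split=> // Hex; apply: contrapT => /H1.
Qed.

Lemma embedding_comp A M N (P : structure S) (e : M -> N) (h : N -> P) :
  embedding A M N e -> embedding A N P h -> embedding A M P (fun x => h (e x)).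
Proof.
move=> emb1 emb2; apply: embedding_of_sat => phi Aphi qphi v H.
have := @sat_embedding A N P h (fun k => e (v k)) phi emb2 Aphi qphi => -[_]; apply.
by apply/(sat_embedding v emb1).
Qed.

Lemma embedding_mono A B M N (e : M -> N) :
    (forall f, has_fun B f -> has_fun A f) -> (forall r, has_rel B r -> has_rel A r) ->
  embedding A M N e -> embedding B M N e.
Proof. by move=> HF HR [? ? ? ef er]; split=> // [f /HF|r /HR]; [apply: ef|apply: er]. Qed.

Lemma elementary_embedding_embedding A M N (h : M -> N) :
  elementary_embedding A M N h -> embedding A M N h.
Proof. by move=> H; apply: embedding_of_sat => phi Aphi _ v /H; apply. Qed.

Lemma sat_isomorphism A M N (g : M -> N) (v : nat -> M) phi :
    isomorphism A M N g -> formula_in A phi ->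
  sat M v phi <-> sat N (fun k => g (v k)) phi.
Proof.
move=> [[g' gK g'K] emb]; have [ginj _ _ _ er] := emb.
have upd w n x : (fun k => g (update w n x k)) = update (fun k => g (w k)) n (g x).
  by apply: funext => k; rewrite /update; case: eqP.
elim: phi v => [t1 t2|R ts|p IH|p IHp q IHq|p IHp q IHq|n p IH|n p IH] v /=.
- by move=> [? ?]; rewrite !(eval_embedding v emb) //; split=> [->|/ginj].
- move=> [AR H]; rewrite er //.
  suff -> : (fun i => eval (fun k => g (v k)) (ts i)) = (fun i => g (eval v (ts i))) by [].
  by apply: funext => i; apply: (eval_embedding v emb).
- by move=> ?; rewrite IH.
- by move=> [? ?]; rewrite IHp // IHq.
- by move=> [? ?]; rewrite IHp // IHq.
- move=> Ap; split=> H x.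
    by rewrite -(g'K x) -upd; apply/IH.
  by apply/IH => //; rewrite upd.
move=> Ap; split=> -[x H].
  by exists (g x); rewrite -upd; apply/IH.
by exists (g' x); apply/IH => //; rewrite upd g'K.
Qed.

Lemma models_isomorphism A M N (g : M -> N) (T : theory S) :
  theory_in A T -> isomorphism A M N g -> models M T <-> models N T.
Proof.
move=> TA iso; have [[g' gK g'K] _] := iso; split=> H phi Tphi v.
  have [Aphi _] := TA _ Tphi.
  have -> : v = (fun k => g (g' (v k))) by apply: funext => k; rewrite g'K.
  by apply/(sat_isomorphism _ iso Aphi); apply: H.
by have [Aphi _] := TA _ Tphi; apply/(sat_isomorphism _ iso Aphi); apply: H.
Qed.

Lemma models_elementary A M N (h : M -> N) (T : theory S) :
  theory_in A T -> elementary_embedding A M N h -> models M T -> models N T.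
Proof.
move=> TA el H phi Tphi v; have [Aphi sphi] := TA _ Tphi.
apply: (@sentence_sat N (fun=> h (s_zero M))) => //.
by apply/(el phi Aphi (fun=> s_zero M)); apply: H.
Qed.

Lemma models_universal_consequences A M (T : theory S) :
  models M T -> models M (universal_consequences A T).
Proof. by move=> H phi [_ _ _ Hphi] v; apply: Hphi. Qed.

Lemma universal_embedding A M N (e : M -> N) (v : nat -> M) phi :
    embedding A M N e -> formula_in A phi -> universal phi ->
  sat N (fun k => e (v k)) phi -> sat M v phi.
Proof.
move=> emb.
elim: phi v => [t1 t2|R ts|p IH|p IHp q IHq|p IHp q IHq|n p IH|n p IH] v Aphi //= uphi;
  try by move/(sat_embedding v emb Aphi uphi).
move=> H x; apply: IH => //; have := H (e x).
by apply: (proj1 (sat_ext _)) => k _; rewrite /update; case: eqP.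
Qed.

Lemma models_universal_substructure A M N (e : M -> N) (T : theory S) :
    embedding A M N e -> models N (universal_consequences A T) ->
  models M (universal_consequences A T).
Proof.
move=> emb H phi Tphi v; have [Aphi _ uphi _] := Tphi.
by apply: (universal_embedding emb Aphi uphi); apply: H.
Qed.

End Semantics.

(** * Ultraproducts *)

Section Ultraproduct.

Variables (S : symbols) (J : Type) (U : (J -> Prop) -> Prop).
Hypothesis UU : @filter.UltraFilter J U.
Variable M : J -> structure S.

Local Notation prodM := (forall j, M j).

Lemma ultraT : U (fun=> True).
Proof. exact: filter.filterT. Qed.

Lemma ultraS (A B : J -> Prop) : (forall j, A j -> B j) -> U A -> U B.
Proof. by move=> AB; apply: filter.filterS. Qed.

Lemma ultraI (A B : J -> Prop) : U A -> U B -> U (fun j => A j /\ B j).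
Proof. exact: filter.filterI. Qed.

Lemma ultra_ex (A : J -> Prop) : U A -> exists j, A j.
Proof. exact: filter.filter_ex. Qed.

Lemma ultraN (A : J -> Prop) : U (fun j => ~ A j) <-> ~ U A.
Proof.
split=> [UnA UA|nUA]; first by have [j []] := ultra_ex (ultraI UA UnA).
by have [|//] := @filter.in_ultra_setVsetC J U A UU.
Qed.

Lemma ultraU (A B : J -> Prop) : U (fun j => A j \/ B j) <-> U A \/ U B.
Proof.
split=> [UAB|]; last by move=> []; apply: ultraS => j ?; [left|right].
apply: contrapT => /not_orP[/ultraN nA /ultraN nB].
by have [j [[? ?] []]] := ultra_ex (ultraI (ultraI nA nB) UAB).
Qed.

Lemma ultra_ord n (P : 'I_n -> J -> Prop) :
  (forall i, U (P i)) -> U (fun j => forall i, P i j).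
Proof.
elim: n P => [|n IH] P H; first by apply: ultraS ultraT => j _ [].
have := ultraI (IH (fun i => P (lift ord0 i)) (fun i => H _)) (H ord0).
by apply: ultraS => j [H1 H2] i; case: (unliftP ord0 i) => [k ->|->].
Qed.

Let eqv (f g : prodM) : Prop := U (fun j => f j = g j).

(** A point is an equivalence class taken as a predicate, so that extensionality turns equality
    almost everywhere into equality of points. *)
Definition uprod_carrier : Type := {P : prodM -> Prop | exists f, P = eqv f}.

Let cl (f : prodM) : uprod_carrier := exist _ (eqv f) (ex_intro _ f erefl).

Let cl_eq f g : cl f = cl g <-> U (fun j => f j = g j).
Proof.
split=> [E|Ufg].
  suff : eqv f g by [].
  have -> : eqv f = eqv g by exact: (congr1 (@proj1_sig _ _) E).
  by apply: ultraS ultraT => j.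
apply: eq_exist; apply: funext => h; apply: propext.
split=> H; first by apply: ultraS (ultraI Ufg H) => j [-> ->].
by apply: ultraS (ultraI Ufg H) => j [-> ->].
Qed.

Let cl_surj x : exists f, cl f = x.
Proof. by case: x => P [f Pf]; exists f; apply: eq_exist. Qed.

Let rep x : prodM := projT1 (cid (cl_surj x)).

Let repK x : cl (rep x) = x.
Proof. by rewrite /rep; case: cid. Qed.

Let rep_cl f : U (fun j => rep (cl f) j = f j).
Proof. by apply/cl_eq; rewrite repK. Qed.

Let uprod : structure S := @Structure S uprod_carrier
  (cl (fun j => s_zero (M j))) (cl (fun j => s_one (M j)))
  (fun x y => cl (fun j => s_add (rep x j) (rep y j)))
  (fun x => cl (fun j => s_opp (rep x j)))
  (fun x y => cl (fun j => s_mul (rep x j) (rep y j)))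
  (fun f x => cl (fun j => s_fun (fun i => rep (x i) j)))
  (fun r x => U (fun j => s_rel (fun i => rep (x i) j))).

Let uprod_eval (v : nat -> prodM) t :
  eval (M := uprod) (fun k => cl (v k)) t = cl (fun j => eval (fun k => v k j) t).
Proof.
elim: t => [n|||t1 IH1 t2 IH2|t1 IH1|t1 IH1 t2 IH2|f ts IH] //=.
- rewrite IH1 IH2; apply/cl_eq.
  by apply: ultraS (ultraI (rep_cl (fun j => eval (fun k => v k j) t1))
    (rep_cl (fun j => eval (fun k => v k j) t2))) => j [-> ->].
- by rewrite IH1; apply/cl_eq; apply: ultraS (rep_cl (fun j => eval (fun k => v k j) t1)) => j ->.
- rewrite IH1 IH2; apply/cl_eq.
  by apply: ultraS (ultraI (rep_cl (fun j => eval (fun k => v k j) t1))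
    (rep_cl (fun j => eval (fun k => v k j) t2))) => j [-> ->].
apply/cl_eq.
have := @ultra_ord _ (fun i j => rep (eval (M := uprod) (fun k => cl (v k)) (ts i)) j =
  eval (fun k => v k j) (ts i)).
move=> /(_ _) H; apply: ultraS (H _) => [j E|i].
  by congr (s_fun _); apply: funext.
by rewrite IH; apply: rep_cl.
Qed.

Let uprod_upd (v : nat -> prodM) n x :
  update (fun k => cl (v k)) n (cl x) = (fun k => cl (update v n x k)).
Proof. by apply: funext => k; rewrite /update; case: eqP. Qed.

Let upd_at (v : nat -> prodM) n x j :
  (fun k => update v n x k j) = update (fun k => v k j) n (x j).
Proof. by apply: funext => k; rewrite /update; case: eqP. Qed.

Let uprod_sat phi (v : nat -> prodM) :
  sat uprod (fun k => cl (v k)) phi <-> U (fun j => sat (M j) (fun k => v k j) phi).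
Proof.
elim: phi v => [t1 t2|r ts|p IH|p IHp q IHq|p IHp q IHq|n p IH|n p IH] v /=.
- by rewrite !uprod_eval cl_eq.
- have Uts : U (fun j => (fun i => rep (eval (M := uprod) (fun k => cl (v k)) (ts i)) j) =
      (fun i => eval (fun k => v k j) (ts i))).
    have H := @ultra_ord _ (fun i j => rep (eval (M := uprod) (fun k => cl (v k)) (ts i)) j =
      eval (fun k => v k j) (ts i)).
    apply: ultraS (H _) => [j E|i]; first exact: funext.
    by rewrite uprod_eval; apply: rep_cl.
  split=> H; first by apply: ultraS (ultraI Uts H) => j [<-].
  by apply: ultraS (ultraI Uts H) => j [->].
- by rewrite ultraN IH.
- rewrite IHp IHq; split=> [[H1 H2]|H]; first exact: ultraI.
  by split; apply: ultraS H => j [].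
- by rewrite IHp IHq ultraU.
- split=> [H|H x].
    apply: contrapT => /ultraN Un.
    (* Counterexamples are chosen factor by factor, with [s_zero] where there is none. *)
    have [f fP] : {f : prodM & forall j, ~ (forall x, sat (M j) (update (fun k => v k j) n x) p) ->
        ~ sat (M j) (update (fun k => v k j) n (f j)) p}.
      have D j : exists x, ~ (forall x, sat (M j) (update (fun k => v k j) n x) p) ->
          ~ sat (M j) (update (fun k => v k j) n x) p.
        have [[x Hx]|Hall] := pselect (exists x, ~ sat (M j) (update (fun k => v k j) n x) p).
          by exists x.
        exists (s_zero (M j)) => Hn _; apply: Hn => x; apply: contrapT => Hx.
        by apply: Hall; exists x.
      by exists (fun j => projT1 (cid (D j))) => j; case: cid.
    have := H (cl f); rewrite uprod_upd IH => H'.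
    have [j [/fP nf Hf]] := ultra_ex (ultraI Un H').
    by apply: nf; rewrite -upd_at.
  rewrite -(repK x) uprod_upd IH; apply: ultraS H => j /(_ (rep x j)).
  by rewrite upd_at.
split=> [[x]|H].
  rewrite -(repK x) uprod_upd IH => H; apply: ultraS H => j.
  by rewrite upd_at; exists (rep x j).
have D j : exists x, (exists x, sat (M j) (update (fun k => v k j) n x) p) ->
    sat (M j) (update (fun k => v k j) n x) p.
  have [[x Hx]|Hn] := pselect (exists x, sat (M j) (update (fun k => v k j) n x) p).
    by exists x.
  by exists (s_zero (M j)).
exists (cl (fun j => projT1 (cid (D j)))); rewrite uprod_upd IH; apply: ultraS H => j.
by rewrite upd_at; case: cid.
Qed.

Theorem ultraproduct : exists (N : structure S) (c : prodM -> N),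
  (forall x, exists f, c f = x) /\
  forall phi (v : nat -> prodM),
    sat N (fun k => c (v k)) phi <-> U (fun j => sat (M j) (fun k => v k j) phi).
Proof. by exists uprod, cl; split. Qed.

End Ultraproduct.

Lemma structure_eta (S : symbols) (M : structure S) :
  @Structure S M (s_zero M) (s_one M) (@s_add S M) (@s_opp S M) (@s_mul S M)
    (@s_fun S M) (@s_rel S M) = M.
Proof. by case: M. Qed.

(** * Structures satisfying the field axioms *)

Section FieldOfAxioms.

Variables (S : symbols) (M : structure S).
Hypotheses (addA : associative (@s_add S M)) (addC : commutative (@s_add S M))
  (add0 : left_id (s_zero M) (@s_add S M))
  (addN : left_inverse (s_zero M) (@s_opp S M) (@s_add S M))
  (mulA : associative (@s_mul S M)) (mulC : commutative (@s_mul S M))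
  (mul1 : left_id (s_one M) (@s_mul S M))
  (mulD : left_distributive (@s_mul S M) (@s_add S M))
  (one_neq0 : s_one M <> s_zero M)
  (mulV : forall x, x <> s_zero M -> exists y, s_mul y x = s_one M).

Definition fcarrier : Type := dom M.

HB.instance Definition _ := gen_eqMixin fcarrier.
HB.instance Definition _ := gen_choiceMixin fcarrier.
HB.instance Definition _ := GRing.isZmodule.Build fcarrier addA addC add0 addN.

Fact fcarrier_one_neq0 : (s_one M : fcarrier) != 0.
Proof. by apply/eqP. Qed.

HB.instance Definition _ := GRing.Zmodule_isComNzRing.Build fcarrier
  mulA mulC mul1 mulD fcarrier_one_neq0.

Definition fcarrier_inv (x : fcarrier) : fcarrier :=
  if pselect (x <> s_zero M) is left nx then projT1 (cid (mulV nx)) else s_zero M.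

Fact fcarrier_mulVf x : x != 0 :> fcarrier -> fcarrier_inv x * x = 1.
Proof.
by move=> /eqP nx; rewrite /fcarrier_inv; case: pselect => // nx'; case: cid.
Qed.

Fact fcarrier_inv0 : fcarrier_inv 0 = 0.
Proof. by rewrite /fcarrier_inv; case: pselect. Qed.

HB.instance Definition _ := GRing.ComNzRing_isField.Build fcarrier
  fcarrier_mulVf fcarrier_inv0.

(** An equality of structures and not an isomorphism: it can be substituted, and formulas need no
    transport. *)
Lemma structure_lfield : exists K : lfield S, lf_structure K = M.
Proof.
exists (@LField S fcarrier (@s_fun S M) (@s_rel S M)).
exact: structure_eta.
Qed.

End FieldOfAxioms.

Lemma ultraproduct_lfield (S : symbols) (J : Type) (U : (J -> Prop) -> Prop)
    (M : J -> lfield S) :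
    @filter.UltraFilter J U ->
  exists (N : lfield S) (c : (forall j, M j) -> N),
    (forall x, exists f, c f = x) /\
    forall phi (v : nat -> forall j, M j),
      sat N (fun k => c (v k)) phi <-> U (fun j => sat (M j) (fun k => v k j) phi).
Proof.
move=> UU; have [N [c [csurj los]]] := ultraproduct UU (fun j => lf_structure (M j)).
pose X n := TVar S n.
pose val (f g h : forall j, M j) n := nth h [:: f; g] n.
have all_true phi v : (forall j, sat (M j) (fun k => val v.1.1 v.1.2 v.2 k j) phi) ->
    sat N (fun k => c (val v.1.1 v.1.2 v.2 k)) phi.
  by move=> H; apply/los; apply: ultraS (ultraT UU) => j _.
have [K KN] : exists K : lfield S, lf_structure K = N.
  apply: structure_lfield.
  - move=> x y z; have [[f <-] [g <-] [h <-]] := And3 (csurj x) (csurj y) (csurj z).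
    apply: (all_true (FEq (TAdd (X 0%N) (TAdd (X 1%N) (X 2%N)))
      (TAdd (TAdd (X 0%N) (X 1%N)) (X 2%N))) (f, g, h)) => j; exact: addrA.
  - move=> x y; have [[f <-] [g <-]] := conj (csurj x) (csurj y).
    apply: (all_true (FEq (TAdd (X 0%N) (X 1%N)) (TAdd (X 1%N) (X 0%N))) (f, g, f)) => j.
    exact: addrC.
  - move=> x; have [f <-] := csurj x.
    apply: (all_true (FEq (TAdd (TZero S) (X 0%N)) (X 0%N)) (f, f, f)) => j; exact: add0r.
  - move=> x; have [f <-] := csurj x.
    apply: (all_true (FEq (TAdd (TOpp (X 0%N)) (X 0%N)) (TZero S)) (f, f, f)) => j.
    exact: addNr.
  - move=> x y z; have [[f <-] [g <-] [h <-]] := And3 (csurj x) (csurj y) (csurj z).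
    apply: (all_true (FEq (TMul (X 0%N) (TMul (X 1%N) (X 2%N)))
      (TMul (TMul (X 0%N) (X 1%N)) (X 2%N))) (f, g, h)) => j; exact: mulrA.
  - move=> x y; have [[f <-] [g <-]] := conj (csurj x) (csurj y).
    apply: (all_true (FEq (TMul (X 0%N) (X 1%N)) (TMul (X 1%N) (X 0%N))) (f, g, f)) => j.
    exact: mulrC.
  - move=> x; have [f <-] := csurj x.
    apply: (all_true (FEq (TMul (TOne S) (X 0%N)) (X 0%N)) (f, f, f)) => j; exact: mul1r.
  - move=> x y z; have [[f <-] [g <-] [h <-]] := And3 (csurj x) (csurj y) (csurj z).
    apply: (all_true (FEq (TMul (TAdd (X 0%N) (X 1%N)) (X 2%N))
      (TAdd (TMul (X 0%N) (X 2%N)) (TMul (X 1%N) (X 2%N)))) (f, g, h)) => j; exact: mulrDl.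
  - pose f : forall j, M j := fun=> 0.
    apply: (all_true (FNot (FEq (TOne S) (TZero S))) (f, f, f)) => j /=; apply/eqP.
    exact: oner_neq0.
  - move=> x nx; have [f fx] := csurj x; subst x.
    suff [//|[y yE]] : sat N (fun k => c (val f f f k)) (FOr (FEq (X 0%N) (TZero S))
      (FEx 1%N (FEq (TMul (X 1%N) (X 0%N)) (TOne S)))) by exists y.
    apply: (all_true _ (f, f, f)) => j; have [f0|nf] := eqVneq (f j) 0; first by left.
    by right; exists (f j)^-1; apply: mulVf.
by subst N; exists K, c.
Qed.

(** * Ultrafilters for compactness arguments *)

Lemma ultra_extend (J : Type) (B : (J -> Prop) -> Prop) :
    (exists X, B X) -> (forall X, B X -> exists j, X j) ->
    (forall X Y, B X -> B Y -> exists2 Z, B Z & forall j, Z j -> X j /\ Y j) ->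
  exists U, @filter.UltraFilter J U /\ forall X, B X -> U X.
Proof.
move=> [X0 BX0] Bne Bdir.
pose F (X : J -> Prop) := exists2 Y, B Y & forall j, Y j -> X j.
have FF : filter.ProperFilter F.
  apply: filter.Build_ProperFilter.
    by move=> [Y /Bne[j Yj] /(_ j Yj)].
  split.
  - by exists X0.
  - move=> X Y [X' BX' XX'] [Y' BY' YY']; have [Z BZ ZXY] := Bdir _ _ BX' BY'.
    by exists Z => // j /ZXY[? ?]; split; [apply: XX'|apply: YY'].
  - by move=> X Y XY [X' BX' XX']; exists X' => // j /XX'; apply: XY.
have [U [UU FU]] := filter.ultraFilterLemma FF.
by exists U; split=> // X BX; apply: FU; exists X.
Qed.

(** Compactness in the form used below: the structure indexed by a finite list meets the conditions
    in that list, so each single condition holds at almost all indices. *)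
Lemma list_ultrafilter (T : Type) :
  exists U, @filter.UltraFilter (seq T) U /\ forall c, U (List.In c).
Proof.
have [|||U [UU UB]] := @ultra_extend (seq T)
    (fun X => exists l, X = (fun j => forall c, List.In c l -> List.In c j)).
- by exists (fun j => forall c, List.In c [::] -> List.In c j), [::].
- by move=> X [l ->]; exists l.
- move=> X Y [l ->] [l' ->].
  exists (fun j => forall c, List.In c (l ++ l') -> List.In c j).
    by exists (l ++ l').
  by move=> j H; split=> c cl; apply: H; apply/List.in_or_app; [left|right].
exists U; split=> // c.
have := UB (fun j => forall c', List.In c' [:: c] -> List.In c' j) (ex_intro _ _ erefl).
by apply: ultraS => j; apply; left.
Qed.

(** * Blocks of quantifiers, finite conjunctions, common valuations *)

Section Blocks.

Variable S : symbols.
Implicit Types (A : language S) (phi psi : formula S) (M N : structure S).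

Definition alls (ks : seq nat) phi := foldr (@FAll S) phi ks.
Definition exs (ks : seq nat) phi := foldr (@FEx S) phi ks.

Lemma override_update M (v x : nat -> M) k (ks : seq nat) :
  (fun l => if l \in ks then x l else update v k (x k) l) =
  (fun l => if l \in k :: ks then x l else v l).
Proof.
apply: funext => l; rewrite in_cons /update; case: (l =P k) => [->|] //=.
by case: ifP.
Qed.

Lemma sat_exs M (v : nat -> M) ks phi :
  sat M v (exs ks phi) <-> exists x, sat M (fun k => if k \in ks then x k else v k) phi.
Proof.
elim: ks v => [|k ks IH] v /=; first by split=> [H|[x]//]; exists v.
split=> [[x /IH[y Hy]]|[x Hx]].
  exists (fun l => if l \in ks then y l else x).
  move: Hy; apply: (proj1 (sat_ext _)) => l _; rewrite in_cons /update.
  by case: (l \in ks); rewrite ?orbT // orbF.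
by exists (x k); apply/IH; exists x; rewrite override_update.
Qed.

Lemma sat_alls M (v : nat -> M) ks phi :
  sat M v (alls ks phi) <-> forall x, sat M (fun k => if k \in ks then x k else v k) phi.
Proof.
elim: ks v => [|k ks IH] v /=; first by split=> [H x|]; [|apply].
split=> [H x|H x].
  by have /IH/(_ x) := H (x k); rewrite override_update.
apply/IH => y; have := H (fun l => if l \in ks then y l else x).
apply: (proj1 (sat_ext _)) => l _; rewrite in_cons /update.
by case: (l \in ks); rewrite ?orbT // orbF.
Qed.

Lemma formula_in_alls A ks phi : formula_in A (alls ks phi) <-> formula_in A phi.
Proof. by elim: ks. Qed.

Lemma formula_in_exs A ks phi : formula_in A (exs ks phi) <-> formula_in A phi.
Proof. by elim: ks. Qed.

Lemma free_var_alls ks phi k : free_var k (alls ks phi) <-> k \notin ks /\ free_var k phi.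
Proof.
elim: ks => [|l ks IH] /=; first by split=> [|[]].
rewrite IH in_cons negb_or; split=> [[/eqP -> [-> ?]]|[/andP[/eqP ? ?] ?]] //.
Qed.

Lemma free_var_exs ks phi k : free_var k (exs ks phi) <-> k \notin ks /\ free_var k phi.
Proof.
elim: ks => [|l ks IH] /=; first by split=> [|[]].
rewrite IH in_cons negb_or; split=> [[/eqP -> [-> ?]]|[/andP[/eqP ? ?] ?]] //.
Qed.

Lemma universal_alls ks phi : quantifier_free phi -> universal (alls ks phi).
Proof. by move=> qphi; elim: ks => [|k ks IH] //=; case: phi qphi. Qed.

Lemma existential_exs ks phi : quantifier_free phi -> existential (exs ks phi).
Proof. by move=> qphi; elim: ks => [|k ks IH] //=; case: phi qphi. Qed.

Lemma existential_prefix phi : existential phi ->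
  exists ks psi, quantifier_free psi /\ phi = exs ks psi.
Proof.
have base p : quantifier_free p -> exists ks psi, quantifier_free psi /\ p = exs ks psi.
  by move=> qp; exists [::], p.
elim: phi => [t1 t2|R ts|p IH|p IHp q IHq|p IHp q IHq|n p IH|n p IH] H;
  try exact: (base _ H).
by have [ks [psi [qpsi ->]]] := IH H; exists (n :: ks), psi.
Qed.

Definition FTrue : formula S := FEq (TZero S) (TZero S).

Definition conj_list (l : seq (formula S)) : formula S := foldr (@FAnd S) FTrue l.

Lemma sat_conj_list M (v : nat -> M) l :
  sat M v (conj_list l) <-> forall phi, List.In phi l -> sat M v phi.
Proof.
elim: l => [|p l IH] //=; rewrite IH; split=> [[H1 H2] phi [<-|/H2]|H] //.
by split=> [|phi ?]; apply: H; [left|right].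
Qed.

Lemma formula_in_conj_list A l :
  (forall phi, List.In phi l -> formula_in A phi) -> formula_in A (conj_list l).
Proof.
by elim: l => [|p l IH] //= H; split=> [|]; [apply: H; left|apply: IH => phi ?; apply: H; right].
Qed.

Lemma qf_conj_list l :
  (forall phi, List.In phi l -> quantifier_free phi) -> quantifier_free (conj_list l).
Proof.
by elim: l => [|p l IH] //= H; split=> [|]; [apply: H; left|apply: IH => phi ?; apply: H; right].
Qed.

Lemma free_var_conj_list l k :
  free_var k (conj_list l) <-> exists phi, List.In phi l /\ free_var k phi.
Proof.
elim: l => [|p l IH] /=; first by split=> [[]|[? []]].
rewrite IH; split=> [[?|[phi [? ?]]]|[phi [[->|?] ?]]].
- by exists p; split=> //; left.
- by exists phi; split=> //; right.
- by left.
- by right; exists phi.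
Qed.

Lemma in_iota m B k : (m <= k < m + B)%N -> List.In k (iota m B).
Proof.
elim: B m => [|B IH] m /= lt; first by lia.
by have [->|ne] := eqVneq m k; [left|right; apply: IH; lia].
Qed.

(** Finitely many formulas, each with its own valuation, come under one valuation [w]: the element
    [v (r k)] is named by the variable [idx (v (r k))], so equal elements share a name. The map [r]
    will be [id], or [half] when parameters sit at even places. *)
Lemma common_valuation (X : Type) (x0 : X) (l : seq (formula S * (nat -> X))) (r : nat -> nat) :
  exists (w : nat -> X) (idx : X -> nat), forall phi v, List.In (phi, v) l ->
    forall k, free_var k phi -> w (idx (v (r k))) = v (r k).
Proof.
have [s sP] : exists s : seq X, forall phi v, List.In (phi, v) l ->
    forall k, free_var k phi -> List.In (v (r k)) s.
  elim: l => [|[phi v] l [s sP]]; first by exists [::].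
  have [B HB] := free_var_bound phi.
  exists ([seq v (r k) | k <- iota 0 B] ++ s) => phi' v' /= [[<- <-]|H] k kphi;
    apply/List.in_or_app; last by right; apply: sP H _ kphi.
  left; apply/List.in_map_iff; exists k; split=> //.
  apply: in_iota; rewrite add0n; exact: HB.
have idxP x : exists i, List.In x s -> nth x0 s i = x.
  have [xs|] := pselect (List.In x s); last by exists 0%N.
  suff [i] : exists i, nth x0 s i = x by exists i.
  elim: s xs {sP} => [|y s IH] //= [->|/IH[i <-]]; first by exists 0%N.
  by exists i.+1.
have [idx idxE] := choice idxP.
by exists (nth x0 s), idx => phi v H k kphi; apply/idxE/(sP phi v).
Qed.

End Blocks.

(** * Existential closedness and forall-exists axioms *)

Section Embedding.

Variable S : symbols.
Implicit Types (A : language S) (phi psi : formula S) (M N : structure S).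

Lemma free_var_universal_closure B phi :
  (forall k, free_var k phi -> (k < B)%N) -> sentence (alls (iota 0 B) phi).
Proof. by move=> H k /free_var_alls[+ /H lt]; rewrite mem_iota add0n lt. Qed.

(** If a finite part of the quantifier-free diagram of [M] failed in all models of [T], the
    universal closure of its negation would be a universal consequence of [T] that is false in [M].
    The finite parts are combined over [list_ultrafilter]. *)
Lemma embed_in_model A (T : theory S) M :
    models M (universal_consequences A T) ->
  exists N (a : M -> N), models N T /\ embedding A M N a.
Proof.
move=> MT; pose cond := (formula S * (nat -> M))%type.
pose good (c : cond) := [/\ formula_in A c.1, quantifier_free c.1 & sat M c.2 c.1].
have D (l : seq cond) : exists Ng : {N : structure S & M -> N},
    models (projT1 Ng) T /\
    forall phi v, List.In (phi, v) l -> good (phi, v) ->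
      sat (projT1 Ng) (fun k => projT2 Ng (v k)) phi.
  have [w [idx idxP]] := common_valuation (s_zero M) l id.
  pose tr (c : cond) : formula S :=
    if pselect (good c) is left _ then formula_ren (fun k => idx (c.2 k)) c.1 else FTrue S.
  pose Phi := conj_list [seq tr c | c <- l].
  have trP c : List.In c l -> [/\ formula_in A (tr c), quantifier_free (tr c) & sat M w (tr c)].
    case: c => phi v cl; rewrite /tr; case: pselect => [[/= gA gqf gsat]|_ //].
    split; [exact: formula_in_ren|exact: qf_ren|].
    apply/sat_ren => //; move: gsat; apply: (proj1 (sat_ext _)) => k kphi /=.
    by rewrite (idxP phi v).
  have PhiP : [/\ formula_in A Phi, quantifier_free Phi & sat M w Phi].
    split; [apply: formula_in_conj_list|apply: qf_conj_list|apply/sat_conj_list];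
      by move=> phi /List.in_map_iff[c [<- /trP[]]].
  have [PhiA Phiqf Phisat] := PhiP.
  have [N [u [NT Nu]]] : exists N (u : nat -> N), models N T /\ sat N u Phi.
    apply: contrapT => none; have [B HB] := free_var_bound Phi.
    have : universal_consequences A T (alls (iota 0 B) (FNot Phi)).
      split; [exact/formula_in_alls|exact: free_var_universal_closure|
              exact: universal_alls|].
      move=> N NT v; apply/sat_alls => x /=.
      by move=> H; apply: none; exists N, (fun k => if k \in iota 0 B then x k else v k).
    move=> /MT/(_ w)/sat_alls/(_ w) /=; apply.
    by move: Phisat; apply: (proj1 (sat_ext _)) => k _; case: ifP.
  exists (existT (fun N : structure S => M -> N) N (fun x => u (idx x))); split=> //= phi v phil gphi.
  have := (proj1 (sat_conj_list u _)) Nu (tr (phi, v)).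
  rewrite /tr; case: pselect => // _ H.
  have /sat_ren : sat N u (formula_ren (fun k => idx (v k)) phi).
    by apply: H; apply/List.in_map_iff; exists (phi, v); split=> //; case: pselect.
  by case: gphi => _ qphi _ /(_ qphi).
have [Ng NgP] := choice D.
have [U [UU UB]] := list_ultrafilter cond.
have [N [c [csurj los]]] := ultraproduct UU (fun l => projT1 (Ng l)).
exists N, (fun x => c (fun l => projT2 (Ng l) x)); split.
  move=> phi Tphi v; have [f fv] := choice (fun k => csurj (v k)).
  have -> : v = (fun k => c (f k)) by apply: funext => k; rewrite fv.
  by apply/los; apply: ultraS (ultraT UU) => l _; have [H _] := NgP l; apply: H.
apply: embedding_of_sat => phi Aphi qphi v vphi; apply/los.
by apply: ultraS (UB (phi, v)) => l lphi; have [_ H] := NgP l; apply: H.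
Qed.

(** Interleaving gives parameters and witnesses an unlimited supply of variables each, with no bound
    to carry along. *)
Definition mix (X : Type) (v u : nat -> X) (k : nat) : X :=
  if odd k then u k./2 else v k./2.

Lemma mix_even (X : Type) (v u : nat -> X) k : mix v u k.*2 = v k.
Proof. by rewrite /mix odd_double doubleK. Qed.

Lemma mix_odd (X : Type) (v u : nat -> X) k : mix v u k.*2.+1 = u k.
Proof. by rewrite /mix /= odd_double /= uphalf_double. Qed.

(* Existential closedness with the parameters at the even places and the witnesses
   at the odd ones. *)
Definition ec_normal A M N (g : M -> N) : Prop :=
  forall psi, formula_in A psi -> quantifier_free psi -> forall (v : nat -> M) (u : nat -> N),
    sat N (mix (fun k => g (v k)) u) psi -> exists u', sat M (mix v u') psi.

Lemma ec_normal_closed A M N (g : M -> N) :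
  ec_normal A g -> existentially_closed A M N g.
Proof.
move=> H phi Aphi /existential_prefix[ks [psi [qpsi phiE]]] v; subst phi.
move/formula_in_exs in Aphi; rewrite sat_exs => -[x Hx].
pose r k := if k \in ks then k.*2.+1 else k.*2.
have mixr P (v' u' : nat -> P) : mix v' u' \o r = fun k => if k \in ks then u' k else v' k.
  by apply: funext => k; rewrite /= /r; case: ifP => _; rewrite ?mix_odd ?mix_even.
have [|u' Hu'] := H (formula_ren r psi) (formula_in_ren _ Aphi) (qf_ren _ qpsi) v x.
  by apply/sat_ren => //; rewrite mixr.
by apply/sat_exs; exists u'; move/sat_ren: Hu' => /(_ qpsi); rewrite mixr.
Qed.

Definition odds B := [seq k <- iota 0 B | odd k].
Definition evens B := [seq k <- iota 0 B | ~~ odd k].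

Lemma mem_odds B k : (k \in odds B) = odd k && (k < B)%N.
Proof. by rewrite mem_filter mem_iota. Qed.

Lemma mem_evens B k : (k \in evens B) = ~~ odd k && (k < B)%N.
Proof. by rewrite mem_filter mem_iota. Qed.

Lemma sat_exs_odds B psi M (v : nat -> M) :
    (forall k, free_var k psi -> (k < B)%N) ->
  sat M (mix v v) (exs (odds B) psi) <-> exists u, sat M (mix v u) psi.
Proof.
move=> HB; rewrite sat_exs; split=> [[x Hx]|[u Hu]].
  exists (fun k => x k.*2.+1); move: Hx; apply: (proj1 (sat_ext _)) => k /HB lt.
  rewrite mem_odds lt andbT /mix; case ok: (odd k) => //.
  by rewrite -{1}(odd_double_half k) ok add1n.
exists (mix v u); move: Hu; apply: (proj1 (sat_ext _)) => k /HB lt.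
by rewrite mem_odds lt andbT /mix; case: (odd k).
Qed.

Lemma existentially_closed_normal A M N (g : M -> N) :
  existentially_closed A M N g -> ec_normal A g.
Proof.
move=> H psi Apsi qpsi v u Hu; have [B HB] := free_var_bound psi.
apply/(sat_exs_odds _ HB); apply: H; first exact/formula_in_exs.
  exact: existential_exs.
have -> : (fun k => g (mix v v k)) = mix (fun k => g (v k)) (fun k => g (v k)).
  by apply: funext => k; rewrite /mix; case: ifP.
by apply/(sat_exs_odds _ HB); exists u.
Qed.

Lemma ec_normal_pullback A M N (g : M -> N) p psi (v : nat -> M) (w : nat -> N) :
    ec_normal A g -> formula_in A psi -> quantifier_free psi ->
    (forall k, (k < p)%N -> w k = g (v k)) -> sat N w psi ->
  exists w', (forall k, (k < p)%N -> w' k = v k) /\ sat M w' psi.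
Proof.
move=> ecg Apsi qpsi wp wpsi; pose r k := if (k < p)%N then k.*2 else k.*2.+1.
have [|u' /(sat_ren _ _ qpsi) H] := ecg _ (formula_in_ren r Apsi) (qf_ren r qpsi) v w.
  apply/(sat_ren _ _ qpsi); apply: (proj1 (sat_ext _)) wpsi => k _; rewrite /= /r.
  by case: ltnP => [/wp->|_]; rewrite ?mix_even ?mix_odd.
by exists (mix v u' \o r); split=> // k kp; rewrite /= /r kp mix_even.
Qed.

Lemma ec_normal_embedding A M N (g : M -> N) : ec_normal A g -> embedding A M N g.
Proof.
move=> H; apply: embedding_of_sat => phi Aphi qphi v Hv.
apply: contrapT => nHv; pose psi := FNot (formula_ren (fun k => k.*2) phi).
have Apsi : formula_in A psi by apply: formula_in_ren.
have qpsi : quantifier_free psi by apply: qf_ren.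
have renE P (w u : nat -> P) : mix w u \o (fun k => k.*2) = w.
  by apply: funext => k; rewrite /= mix_even.
have [|u'] := H psi Apsi qpsi v (fun k => g (v k)).
  by move=> /(sat_ren _ _ qphi); rewrite renE.
by apply; apply/(sat_ren _ _ qphi); rewrite renE.
Qed.

Definition AE_sentence B psi : formula S := alls (evens B) (exs (odds B) psi).

Lemma sat_AE B psi M (v : nat -> M) : (forall k, free_var k psi -> (k < B)%N) ->
  sat M v (AE_sentence B psi) <-> forall w, exists u, sat M (mix w u) psi.
Proof.
move=> HB; rewrite sat_alls; split=> [H w|H x].
  apply/(sat_exs_odds _ HB); have := H (mix w w).
  apply: (proj1 (sat_ext _)) => k /free_var_exs[+ /HB lt].
  by rewrite mem_odds mem_evens lt !andbT => ->.
have /(sat_exs_odds _ HB) := H (fun k => x k.*2).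
apply: (proj1 (sat_ext _)) => k /free_var_exs[+ /HB lt].
rewrite mem_odds mem_evens lt !andbT => nok; rewrite nok /mix (negPf nok).
by rewrite -{2}(odd_double_half k) (negPf nok) add0n.
Qed.

Definition AE_theory A (C : structure S -> Prop) : theory S := fun phi =>
  exists B psi, [/\ phi = AE_sentence B psi, formula_in A psi, quantifier_free psi,
    forall k, free_var k psi -> (k < B)%N & forall M, C M -> forall v : nat -> M, sat M v phi].

Lemma AE_theory_in A C : theory_in A (AE_theory A C).
Proof.
move=> _ [B [psi [-> Apsi qpsi HB _]]]; split; first exact/formula_in_alls/formula_in_exs.
move=> k /free_var_alls[+ /free_var_exs[+ /HB lt]].
by rewrite mem_evens mem_odds lt !andbT => /negbNE ->.
Qed.

Lemma AE_theory_models A (C : structure S -> Prop) M : C M -> models M (AE_theory A C).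
Proof. by move=> CM _ [B [psi [-> _ _ _ H]]] v; apply: H. Qed.

(* Every finite part of the universal diagram of [M] is realized in a member of the
   class, hence all of it in an ultraproduct. *)
Lemma AE_theory_realization A (C : structure S -> Prop) M : models M (AE_theory A C) ->
  exists (J : Type) (U : (J -> Prop) -> Prop) (N : J -> structure S) (g : forall j, M -> N j),
    [/\ @filter.UltraFilter J U, forall j, C (N j) &
      forall psi (v : nat -> M), formula_in A psi -> quantifier_free psi ->
        (forall u, sat M (mix v u) psi) ->
        U (fun j => forall u, sat (N j) (mix (fun k => g j (v k)) u) psi)].
Proof.
move=> MT; pose cond := (formula S * (nat -> M))%type.
pose good (c : cond) :=
  [/\ formula_in A c.1, quantifier_free c.1 & forall u, sat M (mix c.2 u) c.1].
have D (l : seq cond) : exists Ng : {N : structure S & M -> N},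
    C (projT1 Ng) /\
    forall phi v, List.In (phi, v) l -> good (phi, v) -> forall u,
      sat (projT1 Ng) (mix (fun k => projT2 Ng (v k)) u) phi.
  have [w [idx idxP]] := common_valuation (s_zero M) l half.
  (* Parameters, at even places, receive their common names; the odd places, universally quantified,
     are left alone. *)
  pose r (c : cond) k := if odd k then k else (idx (c.2 k./2)).*2.
  have mixr N (c : cond) (w' u : nat -> N) k :
      (mix w' u \o r c) k = mix (fun i => w' (idx (c.2 i))) u k.
    rewrite /= /r /mix; case ok: (odd k); first by rewrite ok.
    by rewrite odd_double doubleK.
  pose tr (c : cond) : formula S :=
    if pselect (good c) is left _ then formula_ren (r c) c.1 else FTrue S.
  pose Phi := conj_list [seq tr c | c <- l].
  have trP c : List.In c l ->
      [/\ formula_in A (tr c), quantifier_free (tr c) & forall u, sat M (mix w u) (tr c)].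
    case: c => phi v cl; rewrite /tr; case: pselect => [[/= gA gqf gsat]|_ //].
    split; [exact: formula_in_ren|exact: qf_ren|] => u.
    apply/sat_ren => //; move: (gsat u); apply: (proj1 (sat_ext _)) => k kphi.
    by rewrite mixr /= /mix; case: ifP => // _; rewrite (idxP phi v).
  have PhiP : [/\ formula_in A Phi, quantifier_free Phi & forall u, sat M (mix w u) Phi].
    split; [apply: formula_in_conj_list|apply: qf_conj_list|move=> u; apply/sat_conj_list];
      by move=> phi /List.in_map_iff[c [<- /trP[]]].
  have [PhiA Phiqf Phisat] := PhiP.
  (* Otherwise the forall-exists sentence for [FNot Phi] holds throughout the class, hence in [M],
     where [w] refutes it. *)
  have [N [u [CN Nu]]] : exists N (u : nat -> N), C N /\ forall x, sat N (mix u x) Phi.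
    apply: contrapT => none; have [B HB] := free_var_bound Phi.
    have AEPhi : AE_theory A C (AE_sentence B (FNot Phi)).
      exists B, (FNot Phi); split=> // N CN v; apply/sat_AE => // u.
      apply: contrapT => H; apply: none; exists N, u; split=> // x.
      by apply: contrapT => Hx; apply: H; exists x.
    have /(sat_AE _ (psi := FNot Phi) HB)/(_ w)[u] := MT _ AEPhi w.
    by apply; apply: Phisat.
  exists (existT (fun N : structure S => M -> N) N (fun x => u (idx x))); split=> //= phi v phil gphi x.
  have := (proj1 (sat_conj_list _ _)) (Nu x) (tr (phi, v)).
  rewrite /tr; case: pselect => // _ H.
  have /sat_ren : sat N (mix u x) (formula_ren (r (phi, v)) phi).
    by apply: H; apply/List.in_map_iff; exists (phi, v); split=> //; case: pselect.
  case: gphi => _ qphi _ /(_ qphi); apply: (proj1 (sat_ext _)) => k _.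
  by rewrite mixr.
have [Ng NgP] := choice D.
have [U [UU UB]] := list_ultrafilter cond.
exists (seq cond), U, (fun l => projT1 (Ng l)), (fun l => projT2 (Ng l)); split=> //.
  by move=> l; case: (NgP l).
move=> psi v Apsi qpsi H; apply: ultraS (UB (psi, v)) => l lpsi.
by have [_ HN] := NgP l; apply: HN.
Qed.

Lemma AE_theory_chain A (C : structure S -> Prop) (J : Type) (N : structure S)
    (M : J -> structure S) (e : forall j, M j -> N) :
    (forall j, embedding A (M j) N (@e j)) ->
    (forall j k, (forall x, exists y, e j x = e k y) \/
                 (forall y, exists x, e k y = e j x)) ->
    (forall u, exists j x, u = e j x) ->
    (forall j, models (M j) (AE_theory A C)) -> models N (AE_theory A C).
Proof.
move=> emb tot cov MT _ [B [psi [-> Apsi qpsi HB H]]] v; apply/sat_AE => // w.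
(* Only the values of [w] below [B] matter, and finitely many elements lie in one member of the
   chain. *)
have [j wj] : exists j, forall k, (k < B)%N -> exists x, w k = e j x.
  elim: (B) => [|b [j IH]]; first by have [j _] := cov (w 0%N); exists j.
  have [j' [x wb]] := cov (w b).
  have [H1|H1] := tot j j'.
    exists j' => k; rewrite ltnS leq_eqVlt => /predU1P[->|/IH[y ->]]; first by exists x.
    by have [z ->] := H1 y; exists z.
  exists j => k; rewrite ltnS leq_eqVlt => /predU1P[->|/IH//].
  by have [z] := H1 x; rewrite -wb => ->; exists z.
have [w' w'E] : exists w' : nat -> M j, forall k, (k < B)%N -> w k = e j (w' k).
  have D k : exists x : M j, (k < B)%N -> w k = e j x.
    have [lt|ge] := ltnP k B; last by exists (s_zero (M j)).
    by have [x ->] := wj k lt; exists x.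
  by have [w' Hw'] := choice D; exists w'.
have AEpsi : AE_theory A C (AE_sentence B psi) by exists B, psi.
have /sat_AE/(_ w')[//|u Hu] := MT j _ AEpsi w'.
exists (fun k => e j (u k)).
have := (proj2 (sat_embedding (mix w' u) (emb j) Apsi qpsi)) Hu.
apply: (proj1 (sat_ext _)) => k /HB lt; rewrite /mix; case: ifP => // _.
by rewrite w'E // (leq_ltn_trans _ lt) // -divn2 leq_div.
Qed.

End Embedding.

(** * Factorization of polynomials in several variables *)

Definition rdvd (R : comNzRingType) (x y : R) : Prop := exists z, y = z * x.

Definition runit (R : comNzRingType) (x : R) : Prop := rdvd x 1.

Definition irreducible_elt (R : comNzRingType) (x : R) : Prop :=
  [/\ x != 0, ~ runit x & forall a b, x = a * b -> runit a \/ runit b].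

Definition prime_elt (R : comNzRingType) (x : R) : Prop :=
  forall a b, rdvd x (a * b) -> rdvd x a \/ rdvd x b.

Definition irreducibles_prime (R : comNzRingType) : Prop :=
  forall x : R, irreducible_elt x -> prime_elt x.

(** An additive measure whose zeros are units: it makes factorization into irreducibles
    terminate. *)
Definition has_degree (R : comNzRingType) : Prop :=
  exists delta : R -> nat,
    (forall x y, x != 0 -> y != 0 -> delta (x * y) = (delta x + delta y)%N) /\
    (forall x, x != 0 -> delta x = 0%N -> runit x).

Section Divisibility.

Variable R : comNzRingType.
Implicit Types x y z : R.

Lemma rdvd0 x : rdvd x 0.
Proof. by exists 0; rewrite mul0r. Qed.

Lemma rdvdD x y z : rdvd x y -> rdvd x z -> rdvd x (y + z).
Proof. by move=> [a ->] [b ->]; exists (a + b); rewrite mulrDl. Qed.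

Lemma rdvd_mull x y z : rdvd x z -> rdvd x (y * z).
Proof. by move=> [a ->]; exists (y * a); rewrite mulrA. Qed.

Lemma rdvd_mulr x y z : rdvd x y -> rdvd x (y * z).
Proof. by rewrite mulrC; apply: rdvd_mull. Qed.

Lemma rdvdN x y : rdvd x y -> rdvd x (- y).
Proof. by move=> [a ->]; exists (- a); rewrite mulNr. Qed.

End Divisibility.

Section GaussLemma.

Variable R : idomainType.
Hypotheses (Rdeg : has_degree R) (Rprime : irreducibles_prime R).
Implicit Types (b c x : R) (f g h m : {poly R}).

Lemma factor_induction (P : R -> Prop) :
  (forall b, runit b -> P b) ->
  (forall x b, irreducible_elt x -> b != 0 -> P b -> P (x * b)) ->
  forall b, b != 0 -> P b.
Proof.
have [dl [dM d0]] := Rdeg; move=> Pu PM b.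
have [n] := ubnP (dl b); elim: n b => // n IH b; rewrite ltnS => db nb.
have [/Pu //|nub] := pselect (runit b).
have d_pos x : x != 0 -> ~ runit x -> (0 < dl x)%N.
  by move=> nx nux; rewrite lt0n; apply/eqP => /(d0 _ nx).
(* In a product of two nonunits each factor has smaller degree, so descent ends at an irreducible
   factor. *)
have [x [c [irx bE]]] : exists x c, irreducible_elt x /\ b = x * c.
  have [k] := ubnP (dl b); elim: k b nb nub {db} => // k IHk b nb nub.
  rewrite ltnS => db.
  have [irb|] := pselect (irreducible_elt b).
    by exists b, 1; rewrite mulr1.
  move/asboolP; rewrite /irreducible_elt => /asboolP nirr.
  have [a [c [bE nua nuc]]] : exists a c, [/\ b = a * c, ~ runit a & ~ runit c].
    apply: contrapT => H; apply: nirr; split=> // a c bE.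
    apply: contrapT => /not_orP[? ?]; apply: H; by exists a, c.
  have /andP[na nc] : (a != 0) && (c != 0) by rewrite -negb_or -mulf_eq0 -bE.
  have [|x [e [irx aE]]] := IHk a na nua.
    by apply: leq_trans db; rewrite bE dM // -addn1 leq_add2l d_pos.
  by exists x, (e * c); rewrite mulrA -aE.
have [nx nux _] := irx.
have nc : c != 0 by apply: contraNneq nb => c0; rewrite bE c0 mulr0.
rewrite bE; apply: PM => //; apply: IH => //.
apply: leq_trans db; rewrite bE dM // -{1}[dl c]add0n ltn_add2r.
exact: d_pos.
Qed.

(** Gauss's lemma. If [x] divides the product of the leading coefficients, it divides one of them;
    that leading term is removed without affecting divisibility by [x], and the total size drops. *)
Lemma prime_elt_polyC x : x != 0 -> prime_elt x -> prime_elt x%:P.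
Proof.
move=> nx xprime; suff H n : forall g h, (size g + size h <= n)%N ->
    rdvd x%:P (g * h) -> rdvd x%:P g \/ rdvd x%:P h.
  by move=> g h; apply: (H (size g + size h)%N).
have lead_split g : rdvd x (lead_coef g) -> g != 0 ->
    exists2 g1, rdvd x%:P (g - g1) & (size g1 < size g)%N.
  move=> [c lcE] ng; exists (g - lead_coef g *: 'X^((size g).-1)).
    rewrite opprB addrCA subrr addr0 lcE; exists (c *: 'X^((size g).-1)).
    by rewrite -scalerAl [_ * x%:P]mulrC mul_polyC scalerA mulrC.
  rewrite -(prednK (n := size g)) ?size_poly_gt0 // ltnS; apply/leq_sizeP=> j.
  rewrite leq_eqVlt coefB coefZ coefXn => /predU1P[<-|lt].
    by rewrite eqxx mulr1 lead_coefE subrr.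
  rewrite (gtn_eqF lt) mulr0 subr0 nth_default //.
  by rewrite -(prednK (n := size g)) ?size_poly_gt0.
elim: n => [|n IH] g h szn dvd.
  move: szn; rewrite leqn0 addn_eq0 size_poly_eq0 => /andP[/eqP -> _].
  by left; apply: rdvd0.
have [->|ng] := eqVneq g 0; first by left; apply: rdvd0.
have [->|nh] := eqVneq h 0; first by right; apply: rdvd0.
have dvd_lead : rdvd x (lead_coef g * lead_coef h).
  have [k ghE] := dvd; exists (lead_coef k).
  by rewrite -lead_coefM ghE lead_coefM lead_coefC.
have [/lead_split/(_ ng)[g1 dg1 lt1]|/lead_split/(_ nh)[h1 dh1 lt1]] :=
    xprime _ _ dvd_lead.
  have [||H|] := IH g1 h; last by right.
  - by rewrite -ltnS; apply: leq_trans szn; rewrite ltn_add2r.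
  - have -> : g1 * h = g * h + - ((g - g1) * h) by ring.
    by apply: rdvdD => //; apply/rdvdN/rdvd_mulr.
  by left; rewrite -[g](subrK g1); apply: rdvdD.
have [|||H] := IH g h1; last first.
- by right; rewrite -[h](subrK h1); apply: rdvdD.
- by left.
- have -> : g * h1 = g * h + - (g * (h - h1)) by ring.
  by apply: rdvdD => //; apply/rdvdN/rdvd_mull.
by rewrite -ltnS; apply: leq_trans szn; rewrite ltn_add2l.
Qed.

Lemma runit_size1 f : runit f -> size f = 1%N.
Proof.
move=> [g gf]; have := congr1 (fun p : {poly R} => size p) gf.
have [->|nf] := eqVneq f 0; first by rewrite mulr0 size_poly0 size_poly1.
have [->|ng] := eqVneq g 0; first by rewrite mul0r size_poly0 size_poly1.
rewrite size_poly1 size_mul //.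
move: nf ng; rewrite -!size_poly_gt0; move: (size f) (size g) => a b; lia.
Qed.

(** The irreducible factors of [b] are cancelled one at a time. By Gauss each divides [h] or [f],
    and it cannot divide [f], which is irreducible of positive degree. *)
Lemma polyC_cancel b f g h : b != 0 -> irreducible_elt f -> (1 < size f)%N ->
  b%:P * g = h * f -> rdvd f g.
Proof.
move=> nb irf sf; have [nf _ irrf] := irf.
elim/factor_induction: b / nb g h => [b [c cb]|x b irx nb IH] g h bg.
  exists (c%:P * h); rewrite -mulrA -bg mulrA -polyCM -cb.
  by rewrite mul1r.
have [nx nux _] := irx.
have [] := prime_elt_polyC nx (Rprime irx) (a := h) (b := f).
- by exists (b%:P * g); rewrite -bg polyCM; ring.
- move=> [k hE]; apply: (IH _ k).
  apply: (@mulfI _ x%:P); first by rewrite polyC_eq0.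
  by rewrite mulrA -polyCM bg hE; ring.
move=> [k fE]; have [uk|ux] := irrf _ _ fE.
  move: sf; rewrite fE size_mul ?polyC_eq0 //.
    by rewrite (runit_size1 uk) size_polyC nx.
  by apply: contra_neq nf => k0; rewrite fE k0 mul0r.
case: nux; have [k' k'E] := ux; exists k'`_0.
by have := congr1 (fun p : {poly R} => p`_0) k'E; rewrite coefMC coef1.
Qed.

(** The same cancellation: constants are taken out of [h] or of [m], and neither changes the degree
    of the second factor. *)
Lemma content_factor b f m h : b != 0 -> f != 0 -> b%:P * f = h * m ->
  exists m' h', f = h' * m' /\ size m' = size m.
Proof.
move=> nb nf; elim/factor_induction: b / nb h m => [b [c cb]|x b irx nb IH] h m E.
  exists m, (c%:P * h); split=> //.
  by rewrite -mulrA -E mulrA -polyCM -cb mul1r.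
have [nx nux _] := irx.
have nxP : x%:P != 0 by rewrite polyC_eq0.
have [] := prime_elt_polyC nx (Rprime irx) (a := h) (b := m).
- by exists (b%:P * f); rewrite -E polyCM; ring.
- move=> [k hE]; apply: (IH k m); apply: (mulfI nxP).
  by rewrite mulrA -polyCM E hE; ring.
move=> [k mE]; have [|m' [h' [fE szm']]] := IH h k.
  by apply: (mulfI nxP); rewrite mulrA -polyCM E mE; ring.
by exists m', h'; split=> //; rewrite mE mulrC size_Cmul.
Qed.

(** Bezout over the fraction field, denominators cleared. A nonzero combination [m] of least size
    divides constant multiples of [f] and [g]. Either [m] is constant, or irreducibility gives [f]
    the size of [m] and [f] divides [g]. *)
Lemma irreducible_bezout f g : irreducible_elt f -> (1 < size f)%N ->
  rdvd f g \/ exists c u v, c != 0 /\ c%:P = u * f + v * g.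
Proof.
move=> irf sf; have [nf _ irrf] := irf.
pose Q n := `[< exists u v, u * f + v * g != 0 /\ size (u * f + v * g)%R = n >].
have exQ : exists n, Q n.
  exists (size f); apply/asboolP; exists 1, 0.
  by rewrite mul1r mul0r addr0.
have [n /asboolP[u [v [nm szm]]] minn] := ex_minnP exQ.
set m := u * f + v * g in nm szm.
have remP p : (exists u' v', p = u' * f + v' * g) ->
    exists2 c, c != 0 & exists q, c%:P * p = q * m.
  move=> [u' [v' pE]]; exists (lead_coef m ^+ scalp p m).
    by rewrite expf_neq0 // lead_coef_eq0.
  exists (p %/ m); rewrite mul_polyC Pdiv.Idomain.divp_eq.
  suff -> : (p %% m) = 0 by rewrite addr0.
  apply/eqP; apply: contraTT (ltn_modpN0 p nm) => nr; rewrite -leqNgt szm.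
  apply: minn; apply/asboolP.
  exists ((lead_coef m ^+ scalp p m)%:P * u' - (p %/ m) * u),
         ((lead_coef m ^+ scalp p m)%:P * v' - (p %/ m) * v).
  suff <- : (p %% m) = ((lead_coef m ^+ scalp p m)%:P * u' - (p %/ m) * u) * f
      + ((lead_coef m ^+ scalp p m)%:P * v' - (p %/ m) * v) * g by [].
  have : (p %% m) = lead_coef m ^+ scalp p m *: p - (p %/ m) * m.
    by rewrite Pdiv.Idomain.divp_eq addrC addKr.
  move=> ->; set L := lead_coef m ^+ _; set q := p %/ m.
  by rewrite pE -mul_polyC /m; ring.
have [a na [qf fE]] : exists2 c, c != 0 & exists q, c%:P * f = q * m.
  by apply: remP; exists 1, 0; ring.
have [a' na' [qg gE]] : exists2 c, c != 0 & exists q, c%:P * g = q * m.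
  by apply: remP; exists 0, 1; ring.
have [sm1|sm1] := leqP (size m) 1.
  right; have mE := size1_polyC sm1; exists m`_0, u, v; split=> //.
  by rewrite -polyC_eq0 -mE.
left; have [m' [h' [fE' szm']]] := content_factor na nf fE.
have nm' : m' != 0 by rewrite -size_poly_gt0 szm' ltnW.
have nh' : h' != 0 by apply: contra_neq nf => h0; rewrite fE' h0 mul0r.
have szf : size f = size m.
  have [/runit_size1 sh|/runit_size1 sm'] := irrf _ _ fE'.
    by rewrite fE' size_mul // sh szm'.
  by move: sm1; rewrite -szm' sm'.
have nqf : qf != 0.
  apply: contra_neq nf => q0; have /eqP := fE.
  by rewrite q0 mul0r mulf_eq0 polyC_eq0 (negPf na) => /eqP.
have sq : (size qf <= 1)%N.
  have := congr1 (fun p : {poly R} => size p) fE.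
  rewrite size_Cmul // size_mul // szf.
  by move: sm1; move: (size m) (size qf) => x y; lia.
have qfE := size1_polyC sq.
have nq0 : qf`_0 != 0 by rewrite -polyC_eq0 -qfE.
apply: (@polyC_cancel (a' * qf`_0) f g (a%:P * 0 + qg * a%:P)) => //.
  by rewrite mulf_neq0.
rewrite polyCM -qfE.
have -> : a'%:P * qf * g = qf * (a'%:P * g) by ring.
rewrite gE; have -> : qf * (qg * m) = qg * (qf * m) by ring.
by rewrite -fE; ring.
Qed.

Lemma poly_irreducibles_prime : irreducibles_prime {poly R}.
Proof.
move=> f irf; have [nf nuf irrf] := irf.
have [sf1|sf] := leqP (size f) 1.
  have fE := size1_polyC sf1; set c := f`_0 in fE.
  have nc : c != 0 by rewrite -polyC_eq0 -fE.
  rewrite fE; apply: prime_elt_polyC => //; apply: Rprime; split=> //.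
    by move=> [z zc]; apply: nuf; exists z%:P; rewrite fE -polyCM -zc.
  move=> a b cE; have down x : runit x%:P -> runit x.
    by case=> y /(congr1 (fun p : {poly R} => p`_0)); rewrite coefMC coef1 => yE; exists y`_0.
  have [|/down|/down] := irrf a%:P b%:P; rewrite ?fE ?cE ?polyCM; by [|left|right].
move=> g h dvd; have [|[c [u [v [nc cE]]]]] := irreducible_bezout g irf sf.
  by left.
right; have [k kE] := dvd; apply: (@polyC_cancel c f h (u * h + v * k)) => //.
rewrite cE [RHS]mulrDl -[v * k * f]mulrA -kE; ring.
Qed.

End GaussLemma.

Lemma size_dvd_polyC (R : idomainType) (p : {poly R}) (c : R) :
  (1 < size p)%N -> rdvd p c%:P -> c = 0.
Proof.
move=> sp [q E]; apply/eqP; apply: contraTT sp => nc; rewrite -leqNgt.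
have : size (q * p) = 1%N by rewrite -E size_polyC nc.
have nE : q * p != 0 by rewrite -E polyC_eq0.
have nq : q != 0 by apply: contra_neq nE => ->; rewrite mul0r.
have np : p != 0 by apply: contra_neq nE => ->; rewrite mulr0.
rewrite size_mul //; move: nq np; rewrite -!size_poly_gt0.
by move: (size p) (size q) => a b; lia.
Qed.

Section RingIso.

Variables (A B : comNzRingType) (f : {rmorphism A -> B}) (g : {rmorphism B -> A}).
Hypotheses (fK : cancel f g) (gK : cancel g f).

Lemma rdvd_iso a b : rdvd (f a) (f b) <-> rdvd a b.
Proof.
split=> [[c E]|[c ->]]; last by exists (f c); rewrite rmorphM.
by exists (g c); apply: (can_inj fK); rewrite E rmorphM gK.
Qed.

Lemma runit_iso a : runit (f a) <-> runit a.
Proof. by rewrite /runit -(rmorph1 f) rdvd_iso. Qed.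

Lemma irreducible_iso x : irreducible_elt x -> irreducible_elt (f x).
Proof.
move=> [nx nux irx]; split; first by rewrite -(rmorph0 f) (inj_eq (can_inj fK)).
  by rewrite runit_iso.
move=> a b E; have [|ua|ub] := irx (g a) (g b).
- by apply: (can_inj fK); rewrite E rmorphM !gK.
- by left; rewrite -(gK a) runit_iso.
- by right; rewrite -(gK b) runit_iso.
Qed.

Lemma irreducibles_prime_iso : irreducibles_prime B -> irreducibles_prime A.
Proof.
move=> HB x /irreducible_iso /HB px a b; rewrite -rdvd_iso rmorphM => /px.
by rewrite !rdvd_iso.
Qed.

End RingIso.

Lemma mpoly_rmorph_ext (K : comNzRingType) (n : nat) (S : comNzRingType)
    (f g : {rmorphism {mpoly K[n]} -> S}) :
  (forall c, f c%:MP = g c%:MP) -> (forall i, f 'X_i = g 'X_i) -> f =1 g.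
Proof.
move=> fgC fgX p; rewrite [p]mpolyE !rmorph_sum; apply: eq_bigr => m _.
rewrite -mul_mpolyC !rmorphM fgC mpolyXE_id !rmorph_prod; congr (_ * _).
by apply: eq_bigr => i _; rewrite !rmorphXn fgX.
Qed.

(** * Polynomials in several variables as polynomials in the last one *)

Section Mpoly.

Variable K : fieldType.

Lemma mpoly_has_degree n : has_degree {mpoly K[n]}.
Proof.
exists (fun p => (msize p).-1); split=> [x y nx ny|x nx].
  rewrite msizeM //; move: nx ny; rewrite -!msize_poly_eq0.
  by move: (msize x) (msize y) => a b; lia.
move=> s0; have /msize1_polyC xE : (msize x <= 1)%N.
  by move: s0; move: (msize x) => [|[]].
exists (x@_0%MM)^-1%:MP; rewrite {2}xE -mpolyCM mulVf //.
by rewrite -(mpolyC_eq0 n) -xE.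
Qed.

Definition poly_last n (p : {poly {mpoly K[n]}}) : {mpoly K[n.+1]} :=
  (map_poly (@mwiden n K) p).['X_ord_max].

Fact poly_last_is_additive n : additive (@poly_last n).
Proof. by move=> p q; rewrite /poly_last rmorphB hornerD hornerN. Qed.

Fact poly_last_is_multiplicative n : multiplicative (@poly_last n).
Proof.
split=> [p q|]; first by rewrite /poly_last rmorphM hornerM.
by rewrite /poly_last rmorph1 hornerC.
Qed.

HB.instance Definition _ n := GRing.isAdditive.Build
  {poly {mpoly K[n]}} {mpoly K[n.+1]} (@poly_last n) (@poly_last_is_additive n).
HB.instance Definition _ n := GRing.isMultiplicative.Build
  {poly {mpoly K[n]}} {mpoly K[n.+1]} (@poly_last n)
  (@poly_last_is_multiplicative n).

Definition wid n (i : 'I_n) : 'I_n.+1 := widen_ord (leqnSn n) i.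

Lemma ord_last_ind n (P : 'I_n.+1 -> Prop) :
  (forall i, P (wid i)) -> P ord_max -> forall i, P i.
Proof.
move=> Pw Pm i; have [lt|] := ltnP i n.
  by have -> : i = wid (Ordinal lt) by apply: val_inj.
move=> le; have -> // : i = ord_max.
by apply: val_inj; apply/eqP; rewrite eqn_leq le -ltnS ltn_ord.
Qed.

Lemma muniX_last n : @muni n K 'X_ord_max = 'X.
Proof.
rewrite muniE msuppX big_seq1 mcoeffX eqxx scale1r mnm1E eqxx expr1.
have -> : [multinom (U_(ord_max) (widen_ord (leqnSn n) i))%MM | i < n] = 0%MM.
  by apply/mnmP => i; rewrite mnmE mnm1E mnm0E eq_sym -val_eqE /= ltn_eqF.
by rewrite mpolyX0 scale1r.
Qed.

Lemma muniX_wid n (i : 'I_n) : @muni n K 'X_(wid i) = ('X_i)%:P.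
Proof.
rewrite muniE msuppX big_seq1 mcoeffX eqxx scale1r mnm1E.
rewrite -val_eqE /= ltn_eqF // expr0 -mul_polyC mulr1; congr ('X_[_])%:P.
by apply/mnmP => j; rewrite mnmE !mnm1E -!val_eqE.
Qed.

Lemma muniK n : cancel (@muni n K) (@poly_last n).
Proof.
apply: (mpoly_rmorph_ext (f := @poly_last n \o @muni n K) (g := idfun)) => /=.
  by move=> c; rewrite muniC /poly_last map_polyC hornerC /= mwidenC.
move=> i; elim/ord_last_ind: i => [i|].
  by rewrite muniX_wid /poly_last map_polyC hornerC /= mwidenX mnmwiden1.
by rewrite muniX_last /poly_last map_polyX hornerX.
Qed.

Lemma muni_mwiden n (p : {mpoly K[n]}) : muni (mwiden p) = p%:P.
Proof.
apply: (mpoly_rmorph_ext (f := @muni n K \o @mwiden n K)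
  (g := @polyC {mpoly K[n]})) => [c|i] /=; first by rewrite mwidenC muniC.
by rewrite mwidenX mnmwiden1 muniX_wid.
Qed.

Lemma poly_lastK n : cancel (@poly_last n) (@muni n K).
Proof.
elim/poly_ind => [|p c IH]; first by rewrite !rmorph0.
rewrite !rmorphD !rmorphM /= IH; congr (_ * _ + _).
  by rewrite /poly_last map_polyX hornerX muniX_last.
by rewrite /poly_last map_polyC hornerC muni_mwiden.
Qed.

Lemma mpoly_irreducibles_prime n : irreducibles_prime {mpoly K[n]}.
Proof.
elim: n => [|n IH]; last first.
  apply: (irreducibles_prime_iso (@muniK n) (@poly_lastK n)).
  exact: poly_irreducibles_prime (@mpoly_has_degree n) IH.
move=> x [nx nux _]; case: nux; have xE := nvar0_mpolyC x.
exists (x@_0%MM)^-1%:MP; rewrite [X in _ * X]xE -mpolyCM mulVf //.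
by rewrite -(mpolyC_eq0 0) -xE.
Qed.

Lemma irreducible_muni n (f : {mpoly K[n.+1]}) :
  irreducible_elt f -> irreducible_elt (muni f).
Proof. exact: irreducible_iso (@muniK n) (@poly_lastK n) f. Qed.

Lemma rdvd_muni n (f g : {mpoly K[n.+1]}) : rdvd (muni f) (muni g) <-> rdvd f g.
Proof. exact: rdvd_iso (@muniK n) (@poly_lastK n) f g. Qed.

(** Elimination of the last variable: unless [f] divides [g], their common zeros satisfy a
    nontrivial relation [c] between the other coordinates. *)
Lemma muni_bezout n (f g : {mpoly K[n.+1]}) :
  irreducible_elt f -> (1 < size (muni f))%N ->
  rdvd f g \/ exists c u v, c != 0 /\ mwiden c = u * f + v * g.
Proof.
move=> /irreducible_muni irf sf.
have [/rdvd_muni|[c [u [v [nc E]]]]] :=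
  irreducible_bezout (@mpoly_has_degree n) (@mpoly_irreducibles_prime n)
    (muni g) irf sf; first by left.
right; exists c, (poly_last u), (poly_last v); split=> //.
by apply: (can_inj (@muniK n)); rewrite muni_mwiden E rmorphD !rmorphM /= !poly_lastK.
Qed.

Section Evaluation.

Variables (E : fieldType) (e : {rmorphism K -> E}).

Lemma mmap_wid n (z : 'I_n.+1 -> E) (p : {mpoly K[n]}) :
  mmap e z (mwiden p) = mmap e (z \o @wid n) p.
Proof.
apply: (mpoly_rmorph_ext (f := mmap e z \o @mwiden n K)
  (g := mmap e (z \o @wid n))) => [c|i] /=; first by rewrite mwidenC !mmapC.
by rewrite mwidenX mnmwiden1 !mmapX !mmap1U.
Qed.

Lemma mmap_muni n (z : 'I_n.+1 -> E) (p : {mpoly K[n.+1]}) :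
  mmap e z p = (map_poly (mmap e (z \o @wid n)) (muni p)).[z ord_max].
Proof.
rewrite -horner_evalE.
apply: (mpoly_rmorph_ext (f := mmap e z) (g := horner_eval (z ord_max) \o
  map_poly (mmap e (z \o @wid n)) \o @muni n K)) => [c|i] /=.
  by rewrite muniC map_polyC horner_evalE hornerC /= !mmapC.
rewrite horner_evalE; elim/ord_last_ind: i => [i|].
  by rewrite muniX_wid map_polyC hornerC /= !mmapX !mmap1U.
by rewrite muniX_last map_polyX hornerX !mmapX !mmap1U.
Qed.

(** The ideal of a generic point is generated by [f]: anything else in it would, by elimination,
    relate the independent coordinates. *)
Lemma mmap_generic n (f g : {mpoly K[n.+1]}) (z : 'I_n.+1 -> E) :
    irreducible_elt f -> (1 < size (muni f))%N ->
    algebraically_independent e (z \o @wid n) -> mmap e z f = 0 ->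
  mmap e z g = 0 <-> rdvd f g.
Proof.
move=> irf sf indep fz; split; last by move=> [c ->]; rewrite rmorphM /= fz mulr0.
move=> gz; have [//|[c [u [v [nc cE]]]]] := muni_bezout g irf sf.
have := congr1 (mmap e z) cE; rewrite mmap_wid rmorphD !rmorphM /= fz gz !mulr0.
by rewrite addr0 => /indep c0; rewrite c0 eqxx in nc.
Qed.

End Evaluation.

Lemma muni_size_dvd n (f : {mpoly K[n.+1]}) (q : {mpoly K[n]}) :
  (1 < size (muni f))%N -> rdvd f (mwiden q) -> q = 0.
Proof. by move=> sf /rdvd_muni; rewrite muni_mwiden => /(size_dvd_polyC sf). Qed.

End Mpoly.

(** * Fraction fields and residue fields of prime ideals *)

Lemma fraction_surj (D : idomainType) (a : {fraction D}) :
  exists x y : D, y != 0 /\ a = tofrac x / tofrac y.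
Proof.
elim/quotW: a => r; exists (\n_r), (\d_r); split; first exact: denom_ratioP.
have nd : tofrac (\d_r) != 0 by rewrite tofrac_eq0 denom_ratioP.
apply: (canRL (mulfK nd)).
rewrite -[LHS]/(FracField.mul _ _) !piE; apply/eqmodP.
rewrite /= FracField.equivfE /FracField.mulf !numden_Ratio ?mulr1 ?oner_eq0 ?denom_ratioP //.
by rewrite mulrC.
Qed.

Section DomainFractions.

Variable D : comNzRingType.
Hypothesis Ddom : forall x y : D, x * y = 0 -> (x == 0) || (y == 0).

Let unitD : {pred D} := fun x => `[< runit x >].
Let invD (x : D) : D :=
  if pselect (runit x) is left u then projT1 (cid u) else x.

Fact invD_mulVx : {in unitD, left_inverse 1 invD *%R}.
Proof.
move=> x /asboolP ux; rewrite /invD; case: pselect => // ux'.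
by case: cid => y /= <-.
Qed.

Fact invD_unitPl (x y : D) : y * x = 1 -> unitD x.
Proof. by move=> yx; apply/asboolP; exists y. Qed.

Fact invD_out : {in [predC unitD], invD =1 id}.
Proof.
move=> x; rewrite inE => /asboolP nux; rewrite /invD.
by case: pselect => // ux; case: nux.
Qed.

(** Units and inverses are supplied classically, so that fractions can be formed over a ring that is
    only known to be a domain. *)
Definition classical_units : Type := D.
HB.instance Definition _ := GRing.ComNzRing.on classical_units.
HB.instance Definition _ := GRing.ComNzRing_hasMulInverse.Build classical_units
  invD_mulVx invD_unitPl invD_out.
HB.instance Definition _ := GRing.ComUnitRing_isIntegral.Build classical_units Ddom.

Lemma domain_fractions :
  exists (E : fieldType) (phi : {rmorphism D -> E}),
    (forall x, phi x = 0 <-> x = 0) /\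
    forall a, exists x y, phi y <> 0 /\ a = phi x / phi y.
Proof.
pose phi : {rmorphism classical_units -> {fraction classical_units}} := @tofrac _.
exists {fraction classical_units}, phi.
have t0 (x : classical_units) : tofrac x = 0 <-> x = 0.
  by split=> [/eqP|->]; rewrite ?tofrac0 // tofrac_eq0 => /eqP.
split=> // a; have [x [y [ny ->]]] := fraction_surj a.
by exists x, y; split=> //; apply/eqP; rewrite tofrac_eq0.
Qed.

End DomainFractions.

(** Serves for function fields of hypersurfaces and for ultraproducts of fields alike. *)
Lemma prime_ideal_field (R : comNzRingType) (I : {pred R}) :
    idealr_closed I -> prime_idealr_closed I ->
  exists (E : fieldType) (phi : {rmorphism R -> E}),
    (forall x, phi x = 0 <-> x \in I) /\
    forall a, exists x y, phi y <> 0 /\ a = phi x / phi y.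
Proof.
move=> Iid Ipr.
pose J : prime_idealr R := HB.pack I (isPrimeIdealrClosed.Build R I Ipr) (isIdealr.Build R I Iid).
have [E [phi [phi0 phis]]] := domain_fractions (@Quotient.rquot_IdomainAxiom R J).
exists E, (phi \o \pi_({ideal_quot J})%qT); split=> [x|a].
  rewrite /= phi0 -(rmorph0 (\pi_({ideal_quot J})%qT)).
  have -> : (x \in I) = (x == 0 %[mod {ideal_quot J}])%qT.
    by rewrite -Quotient.idealrBE subr0.
  by split=> [->|/eqP].
have [x [y [ny ->]]] := phis a.
by exists (repr x), (repr y); rewrite /= !reprK.
Qed.

(** The fraction [phi x / phi y] must go to [psi x / psi y]; equality of the kernels keeps
    denominators nonzero and makes the value independent of the representation. *)
Lemma field_lift (R : comNzRingType) (E E' : fieldType) (phi : {rmorphism R -> E})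
    (psi : {rmorphism R -> E'}) :
    (forall x, phi x = 0 <-> psi x = 0) ->
    (forall a, exists x y, phi y <> 0 /\ a = phi x / phi y) ->
  exists h : {rmorphism E -> E'}, forall x, h (phi x) = psi x.
Proof.
move=> ker surj.
have eqP' x y : phi x = phi y <-> psi x = psi y.
  have := ker (x - y); rewrite !rmorphB.
  by move=> [H1 H2]; split=> /eqP; rewrite -subr_eq0 => /eqP ?; apply/eqP;
    rewrite -subr_eq0; apply/eqP; [apply: H1|apply: H2].
have [num numP] := choice surj; have [den {}numP] := choice numP.
pose h a := psi (num a) / psi (den a).
have denP a : psi (den a) != 0 by apply/eqP => /ker; case: (numP a).
have hE a x y : phi y != 0 -> a = phi x / phi y -> h a = psi x / psi y.
  move=> ny; have [/eqP nd {1}->] := numP a => /eqP.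
  have ny' : psi y != 0 by apply: contra_neq ny => /ker.
  rewrite eqr_div // -!rmorphM => /eqP/eqP' E0.
  by apply/eqP; rewrite /h eqr_div // -!rmorphM E0.
have nden a : phi (den a) != 0 by apply/eqP; case: (numP a).
have hphi x : h (phi x) = psi x.
  by rewrite (hE _ x 1) ?rmorph1 ?oner_eq0 ?divr1.
have hB : additive h.
  move=> a b; rewrite (hE (a - b) (num a * den b - num b * den a) (den a * den b)).
  - by rewrite rmorphB !rmorphM /h; field; rewrite !denP.
  - by rewrite rmorphM mulf_neq0.
  have [_ {1}->] := numP a; have [_ {1}->] := numP b.
  by rewrite rmorphB !rmorphM; field; rewrite !nden.
have hM : multiplicative h.
  split=> [a b|]; last by rewrite -(rmorph1 phi) hphi rmorph1.
  rewrite (hE (a * b) (num a * num b) (den a * den b)).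
  - by rewrite !rmorphM /h; field; rewrite !denP.
  - by rewrite rmorphM mulf_neq0.
  have [_ {1}->] := numP a; have [_ {1}->] := numP b.
  by rewrite !rmorphM; field; rewrite !nden.
pose hm : {rmorphism E -> E'} := HB.pack h
  (GRing.isAdditive.Build E E' h hB) (GRing.isMultiplicative.Build E E' h hM).
by exists hm.
Qed.

(** * Generic points of hypersurfaces *)

Section MapMpolyRing.

Variables (K E : comNzRingType) (e : {rmorphism K -> E}).

Lemma mmap_map_mpoly (E' : comNzRingType) (h : {rmorphism E -> E'}) n
    (z : 'I_n -> E') (f : {mpoly K[n]}) :
  mmap h z (map_mpoly e f) = mmap (h \o e) z f.
Proof.
apply: (mpoly_rmorph_ext (f := mmap h z \o map_mpoly e)
  (g := mmap (h \o e) z)) => [c|i] /=; first by rewrite map_mpolyC !mmapC.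
by rewrite map_mpolyX !mmapX.
Qed.

Lemma meval_map_mpoly n (z : 'I_n -> E) (f : {mpoly K[n]}) :
  (map_mpoly e f).@[z] = mmap e z f.
Proof.
apply: (mpoly_rmorph_ext (f := meval z \o map_mpoly e)
  (g := mmap e z)) => [c|i] /=; first by rewrite map_mpolyC mevalC mmapC.
by rewrite map_mpolyX mevalXU mmapX mmap1U.
Qed.

Lemma rmorph_mmap (E' : comNzRingType) (h : {rmorphism E -> E'}) n
    (z : 'I_n -> E) (f : {mpoly K[n]}) :
  h (mmap e z f) = mmap (h \o e) (h \o z) f.
Proof.
apply: (mpoly_rmorph_ext (f := h \o mmap e z)
  (g := mmap (h \o e) (h \o z))) => [c|i] /=; first by rewrite !mmapC.
by rewrite !mmapX !mmap1U.
Qed.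

End MapMpolyRing.

Section MapMpoly.

Variables (K E : fieldType) (e : {rmorphism K -> E}).

Lemma msize_map_mpoly n (f : {mpoly K[n]}) : msize (map_mpoly e f) = msize f.
Proof. by rewrite !mmeasureE (perm_big _ (msupp_map_mpoly _ (fmorph_inj e))). Qed.

Lemma map_mpoly_eq0 n (f : {mpoly K[n]}) : (map_mpoly e f == 0) = (f == 0).
Proof. by rewrite -!msize_poly_eq0 msize_map_mpoly. Qed.

Lemma muni_map_mpoly n (f : {mpoly K[n.+1]}) :
  muni (map_mpoly e f) = map_poly (map_mpoly e) (muni f).
Proof.
apply: (mpoly_rmorph_ext (f := @muni n E \o map_mpoly e)
  (g := map_poly (map_mpoly e) \o @muni n K)) => [c|i] /=.
  by rewrite map_mpolyC !muniC map_polyC /= map_mpolyC.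
rewrite map_mpolyX; elim/ord_last_ind: i => [i|].
  by rewrite !muniX_wid map_polyC /= map_mpolyX.
by rewrite !muniX_last map_polyX.
Qed.

Lemma size_muni_map_mpoly n (f : {mpoly K[n.+1]}) :
  size (muni (map_mpoly e f)) = size (muni f).
Proof.
rewrite muni_map_mpoly size_map_inj_poly ?rmorph0 // => p q /eqP.
by rewrite -subr_eq0 -rmorphB map_mpoly_eq0 subr_eq0 => /eqP.
Qed.

End MapMpoly.

Lemma mmap_ext (K E : comNzRingType) (e e' : K -> E) n (z z' : 'I_n -> E)
    (f : {mpoly K[n]}) :
  e =1 e' -> z =1 z' -> mmap e z f = mmap e' z' f.
Proof.
move=> ee zz; apply: eq_bigr => m _; rewrite ee; congr (_ * _).
by apply: eq_bigr => i _; rewrite zz.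
Qed.

Lemma mderiv_mwiden (K : fieldType) n (p : {mpoly K[n]}) :
  (mwiden p)^`M(ord_max) = 0.
Proof.
elim/mpolyind: p => [|c m p _ _ IH]; first by rewrite mwiden0 mderiv0.
rewrite mwidenD mderivD IH addr0 mwidenZ mwidenX mderivZ mderivX.
by rewrite mnmwiden_ordmax scale0r scaler0.
Qed.

Lemma mderiv_poly_last (K : fieldType) n (p : {poly {mpoly K[n]}}) :
  (poly_last p)^`M(ord_max) = poly_last p^`().
Proof.
elim/poly_ind: p => [|p c IH]; first by rewrite deriv0 !raddf0.
rewrite derivD derivM derivX derivC addr0 mulr1 !rmorphD !rmorphM /=.
rewrite mderivD mderivM IH.
have -> : poly_last 'X = 'X_ord_max :> {mpoly K[n.+1]}.
  by rewrite /poly_last map_polyX hornerX.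
have -> : poly_last c%:P = mwiden c by rewrite /poly_last map_polyC hornerC.
rewrite mderiv_mwiden mderivX mnm1E eqxx scale1r.
have -> : (U_(ord_max) - U_(ord_max))%MM = 0%MM :> 'X_{1..n.+1}.
  by apply/mnmP => i; rewrite mnmBE subnn mnm0E.
by rewrite mpolyX0 mulr1 addr0.
Qed.

Lemma muni_mderiv (K : fieldType) n (f : {mpoly K[n.+1]}) :
  muni f^`M(ord_max) = (muni f)^`().
Proof. by rewrite -{1}[f]muniK mderiv_poly_last poly_lastK. Qed.

Lemma mderiv_size_muni (K : fieldType) n (f : {mpoly K[n.+1]}) :
  f^`M(ord_max) != 0 -> (1 < size (muni f))%N.
Proof.
apply: contraNT; rewrite -leqNgt => /size1_polyC E.
by rewrite -[f]muniK mderiv_poly_last E derivC raddf0.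
Qed.

Lemma map_mpoly_mderiv (K E : fieldType) (e : {rmorphism K -> E}) n i
    (f : {mpoly K[n]}) : (map_mpoly e f)^`M(i) = map_mpoly e f^`M(i).
Proof.
by apply/mpolyP => m; rewrite mcoeff_mderiv !mcoeff_map_mpoly mcoeff_mderiv raddfMn.
Qed.

Definition generic_point (K E : fieldType) (e : K -> E) d (f : {mpoly K[d.+1]})
    (z : 'I_d.+1 -> E) : Prop :=
  algebraically_independent e (z \o @wid d) /\ mmap e z f = 0.

Definition generated_by (K E : fieldType) (e : K -> E) n (z : 'I_n -> E) : Prop :=
  forall a, exists P Q, mmap e z Q <> 0 /\ a = mmap e z P / mmap e z Q.

(** Testing all extensions at once makes base change immediate; bounding both factors keeps the
    factorizations in bounded degree, where an ultraproduct can collect them. *)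
Definition abs_irreducible (K : fieldType) n (f : {mpoly K[n]}) : Prop :=
  (1 < msize f)%N /\
  forall (E : fieldType) (e : {rmorphism K -> E}) (g h : {mpoly E[n]}),
    (msize g < msize f)%N -> (msize h < msize f)%N -> g * h <> map_mpoly e f.

Lemma abs_irreducible_map (K E : fieldType) (e : {rmorphism K -> E}) n
    (f : {mpoly K[n]}) : abs_irreducible f -> abs_irreducible (map_mpoly e f).
Proof.
move=> [sf irf]; split; rewrite !msize_map_mpoly // => E' e' g h sg sh E0.
apply: (irf E' (e' \o e) g h sg sh); rewrite E0.
by apply/mpolyP => m; rewrite !mcoeff_map_mpoly.
Qed.

Lemma runit_msize (K : fieldType) n (g : {mpoly K[n]}) :
  (msize g <= 1)%N -> g != 0 -> runit g.
Proof.
move=> /msize1_polyC gE ng; exists (g@_0%MM)^-1%:MP.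
by rewrite [X in _ * X]gE -mpolyCM mulVf // -(mpolyC_eq0 n) -gE.
Qed.

Lemma runit_msize1 (K : fieldType) n (g : {mpoly K[n]}) : runit g -> msize g = 1%N.
Proof.
move=> [h E]; have nE : h * g != 0 by rewrite -E oner_neq0.
have nh : h != 0 by apply: contra_neq nE => ->; rewrite mul0r.
have ng : g != 0 by apply: contra_neq nE => ->; rewrite mulr0.
have := congr1 (fun p : {mpoly K[n]} => msize p) E.
rewrite msize1 msizeM //; move: nh ng; rewrite -!msize_poly_eq0.
by move: (msize g) (msize h) => a b; lia.
Qed.

Lemma abs_irreducible_elt (K : fieldType) n (f : {mpoly K[n]}) :
  abs_irreducible f -> irreducible_elt f.
Proof.
move=> [sf irf]; have nf : f != 0 by rewrite -msize_poly_eq0 -lt0n ltnW.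
split=> // [/runit_msize1 s1|a b E]; first by rewrite s1 in sf.
have na : a != 0 by apply: contra_neq nf => a0; rewrite E a0 mul0r.
have nb : b != 0 by apply: contra_neq nf => b0; rewrite E b0 mulr0.
have sE : msize f = (msize a + msize b).-1 by rewrite E msizeM.
have [sa|sa] := leqP (msize a) 1; first by left; apply: runit_msize.
have [sb|sb] := leqP (msize b) 1; first by right; apply: runit_msize.
have idf : map_mpoly idfun f = f.
  by apply/mpolyP => m; rewrite mcoeff_map_mpoly.
by have [||] := irf K idfun a b; rewrite ?sE ?idf //;
  move: (msize a) (msize b) sa sb => x y; lia.
Qed.

Lemma generic_field (K : fieldType) d (f : {mpoly K[d.+1]}) :
    irreducible_elt f -> (1 < size (muni f))%N ->
  exists (E : fieldType) (e : {rmorphism K -> E}) (z : 'I_d.+1 -> E),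
    generic_point e f z /\ generated_by e z.
Proof.
move=> irf sf; have [nf nuf _] := irf.
pose I : {pred {mpoly K[d.+1]}} := fun g => `[< rdvd f g >].
have IP g : reflect (rdvd f g) (g \in I) by apply: asboolP.
have Iid : idealr_closed I.
  split; [exact/IP/rdvd0|exact/IP|].
  by move=> a u v /IP fu /IP fv; apply/IP/rdvdD => //; apply: rdvd_mull.
have Ipr : prime_idealr_closed I.
  move=> u v /IP /(mpoly_irreducibles_prime irf) H; apply/orP.
  by case: H => ?; [left|right]; apply/IP.
have [E [phi [phi0 phis]]] := prime_ideal_field Iid Ipr.
pose e : {rmorphism K -> E} := phi \o @mpolyC d.+1 K.
pose z i := phi 'X_i.
have phiE g : phi g = mmap e z g.
  apply: (mpoly_rmorph_ext (f := phi) (g := mmap e z)) => [c|i].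
    by rewrite /= mmapC.
  by rewrite /= mmapX mmap1U.
exists E, e, z; split; first split.
- move=> q; rewrite -mmap_wid -phiE => /phi0 /IP; exact: muni_size_dvd.
- by rewrite -phiE; apply/phi0/IP; exists 1; rewrite mul1r.
by move=> a; have [P [Q]] := phis a; rewrite !phiE; exists P, Q.
Qed.

Lemma generic_lift (K E E' : fieldType) (e : {rmorphism K -> E})
    (e' : {rmorphism K -> E'}) d (f : {mpoly K[d.+1]}) (z : 'I_d.+1 -> E)
    (z' : 'I_d.+1 -> E') :
    irreducible_elt f -> (1 < size (muni f))%N ->
    generic_point e f z -> generated_by e z -> generic_point e' f z' ->
  exists h : {rmorphism E -> E'},
    (forall c, h (e c) = e' c) /\ (forall i, h (z i) = z' i).
Proof.
move=> irf sf [tz fz] gz [tz' fz'].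
have [g|h hE] := @field_lift _ E E' (mmap e z) (mmap e' z') _ gz.
  have H := mmap_generic g irf sf tz fz.
  have H' := mmap_generic g irf sf tz' fz'.
  by split=> [/H/H'|/H'/H].
exists h; split=> [c|i]; first by have := hE c%:MP; rewrite /= !mmapC.
by have := hE 'X_i; rewrite /= !mmapX !mmap1U.
Qed.

(** [large] is applied to the prime ideal generated by [f]. A polynomial [b] in the first [d]
    variables that vanished on all rational points would be a multiple of [f], which involves the
    last variable. *)
Lemma large_dense (M : fieldType) d (f : {mpoly M[d.+1]}) (a : 'I_d.+1 -> M)
    (b : {mpoly M[d]}) :
    large M -> irreducible_elt f -> f.@[a] = 0 -> (f^`M(ord_max)).@[a] != 0 ->
    b != 0 ->
  exists a', f.@[a'] = 0 /\ b.@[a' \o @wid d] != 0.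
Proof.
move=> Mlarge irf fa dfa nb; have [nf nuf _] := irf.
have sf : (1 < size (muni f))%N.
  by apply: mderiv_size_muni; apply: contra_neq dfa => ->; rewrite meval0.
pose I : {pred {mpoly M[d.+1]}} := fun g => `[< rdvd f g >].
have IP g : reflect (rdvd f g) (g \in I) by apply: asboolP.
have Iid : idealr_closed I.
  split; [exact/IP/rdvd0|exact/IP|].
  by move=> c u v /IP fu /IP fv; apply/IP/rdvdD => //; apply: rdvd_mull.
have Ipr : prime_idealr_closed I.
  move=> u v /IP /(mpoly_irreducibles_prime irf) H; apply/orP.
  by case: H => ?; [left|right]; apply/IP.
have ratI x : f.@[x] = 0 -> rational_point I x.
  by move=> fx g /IP[c ->]; rewrite mevalM fx mulr0.
have smooth : exists x, smooth_point I x.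
  exists a; split; first exact: ratI.
  exists d; split; first split.
  - exists (@wid d) => q; move/IP.
    suff -> : mmap (@mpolyC d.+1 M) (fun i => 'X_(wid i)) q = mwiden q.
      exact: muni_size_dvd.
    apply: (mpoly_rmorph_ext (f := mmap _ _) (g := @mwiden d M)) => [c|i] /=.
      by rewrite mmapC mwidenC.
    by rewrite mmapX mmap1U mwidenX mnmwiden1.
  (* The dimension is not [d.+1]: a repeated coordinate is a relation, and otherwise [t] permutes
     the variables and [f] itself gives a nonzero relation. *)
  - move=> [t tind]; have [inj_t|] := pselect (injective t); last first.
      move=> ninj; have [i [j [ij tij]]] : exists i j, i <> j /\ t i = t j.
        apply: contrapT => H; apply: ninj => i j tij; apply: contrapT => ij.
        by apply: H; exists i, j.
      have := tind ('X_i - 'X_j).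
      rewrite rmorphB /= !mmapX !mmap1U tij subrr => /(_ (introT (IP _) (rdvd0 _))).
      move=> /(congr1 (meval (fun k => (k == i)%:R))) /eqP.
      rewrite mevalB !mevalXU meval0 eqxx subr_eq0 eq_sym.
      by have /eqP/negPf -> : j <> i by [move=> ji; apply: ij]; rewrite eq_sym oner_eq0.
    have [t' tK t'K] := injF_bij inj_t.
    pose q := mmap (@mpolyC d.+1 M) (fun i => 'X_(t' i)) f.
    have qE : mmap (@mpolyC d.+1 M) (fun i => 'X_(t i)) q = f.
      apply: (mpoly_rmorph_ext (f := mmap (@mpolyC d.+1 M) (fun i => 'X_(t i)) \o
        mmap (@mpolyC d.+1 M) (fun i => 'X_(t' i))) (g := idfun)) => [c|i] /=.
        by rewrite !mmapC.
      by rewrite mmapX mmap1U mmapX mmap1U t'K.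
    have q0 : q = 0 by apply: tind; rewrite qE; apply/IP; exists 1; rewrite mul1r.
    by move: nf; rewrite -qE q0 mmap0 eqxx.
  (* The Jacobian of [f] alone is one nonzero row, so its rank is 1, and [1 + d = d.+1]. *)
  exists 1%N, (fun=> f); split; first by move=> _; apply/IP; exists 1; rewrite mul1r.
  rewrite rank_rV; suff -> : (\matrix_(i < 1, j < d.+1) (f^`M(j)).@[a]) != 0 by [].
  apply: contra_neq dfa => /matrixP /(_ 0 ord_max).
  by rewrite !mxE.
apply: contrapT => H; have : mwiden b \in I.
  apply: (Mlarge _ I Iid Ipr smooth) => x xI.
  have fx : f.@[x] = 0 by apply: xI; apply/IP; exists 1; rewrite mul1r.
  apply/eqP; apply: contraT => nbx; case: H; exists x; split=> //.
  suff <- : (mwiden b).@[x] = b.@[x \o @wid d] by [].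
  exact: (@mmap_wid M M idfun).
by move=> /IP /(muni_size_dvd sf) b0; rewrite b0 eqxx in nb.
Qed.

(** * Algebraic points and specialization *)

Lemma closed_field_root (C : fieldType) (p : {poly C}) :
  GRing.closed_field_axiom C -> (1 < size p)%N -> exists x, root p x.
Proof.
move=> Ccl sp; have lc : lead_coef p != 0 by rewrite lead_coef_eq0 -size_poly_gt0 ltnW.
have [|x xE] := Ccl (size p).-1 (fun i => - (p`_i / lead_coef p)).
  by rewrite -ltnS prednK // ltnW.
exists x; apply/rootP; rewrite horner_coef -(prednK (ltnW sp)) big_ord_recr /=.
rewrite xE -lead_coefE mulr_sumr -big_split big1 //= => i _.
by rewrite mulrA mulrN mulrCA divff // mulr1 mulNr addrN.
Qed.

Lemma algebraic_root (F E : fieldType) (i : {rmorphism F -> E}) (p : {poly E}) x :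
  p != 0 -> (forall k, algebraicOver i p`_k) -> root p x -> algebraicOver i x.
Proof.
move=> np algp rx; apply/integral_algebraic.
apply: (@integral_root_monic _ _ _ x ((lead_coef p)^-1 *: p)).
- by rewrite monicE lead_coefZ mulVf // lead_coef_eq0.
- by rewrite rootZ // invr_eq0 lead_coef_eq0.
move=> c /(nthP 0)[k _ <-]; rewrite coefZ; apply/integral_algebraic.
by apply: algebraic_mul => //; apply: algebraic_inv; rewrite lead_coefE.
Qed.

Lemma algebraic_mmap (K E : fieldType) (e : {rmorphism K -> E}) n (z : 'I_n -> E)
    (P : {mpoly K[n]}) :
  (forall i, algebraicOver e (z i)) -> algebraicOver e (mmap e z P).
Proof.
move=> algz; rewrite /mmap; apply: big_ind => [|x y|m _]; [exact: algebraic0|exact: algebraic_add|].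
apply: algebraic_mul; first exact: algebraic_id.
rewrite /mmap1; apply: big_ind => [|x y|i _]; [exact: algebraic1|exact: algebraic_mul|].
elim: (m i) => [|k IH]; first by rewrite expr0; apply: algebraic1.
by rewrite exprS; apply: algebraic_mul.
Qed.

(** For nonconstant [p], a root of [p - 1] is algebraic and is no root of [p]; nothing has to be
    counted. *)
Lemma algebraic_nonroot (F E : fieldType) (i : {rmorphism F -> E}) (p : {poly E}) :
    GRing.closed_field_axiom E -> p != 0 -> (forall k, algebraicOver i p`_k) ->
  exists x, algebraicOver i x /\ p.[x] != 0.
Proof.
move=> Ecl np algp; have [sp|sp] := leqP (size p) 1.
  have pE := size1_polyC sp; exists 0; split; first exact: algebraic0.
  by rewrite pE hornerC -polyC_eq0 -pE.
have s1 : size (p - 1) = size p by rewrite size_polyDl // size_polyN size_poly1.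
have [||x rx] := @closed_field_root E (p - 1); rewrite ?s1 //.
exists x; split; last first.
  by move: rx; rewrite rootE hornerD hornerN hornerC subr_eq0 => /eqP ->; apply: oner_neq0.
apply: (algebraic_root _ _ rx) => [|k]; first by rewrite -size_poly_gt0 s1 ltnW.
rewrite coefB coef1; apply: algebraic_sub => //.
by case: (k == 0)%N; [apply: algebraic1|apply: algebraic0].
Qed.

Fact bezout_combination (R : comNzRingType) (L q u v u' v' a b : R) :
  (L * u' - q * u) * a + (L * v' - q * v) * b =
  L * (u' * a + v' * b) - q * (u * a + v * b).
Proof. ring. Qed.

(* A weak Nullstellensatz: the points of an affine variety that are algebraic over
   the base field are dense in it. *)
Lemma algebraic_specialization (K E C : fieldType) (e : {rmorphism K -> E})
    (c : {rmorphism K -> C}) n (z : 'I_n -> E) (g : {mpoly K[n]}) :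
    GRing.closed_field_axiom C -> mmap e z g != 0 ->
  exists z0 : 'I_n -> C,
    [/\ forall i, algebraicOver c (z0 i),
        forall P, mmap e z P = 0 -> mmap c z0 P = 0 & mmap c z0 g != 0].
Proof.
move=> Ccl; elim: n z g => [|n IH] z g gz.
  have const (P : {mpoly K[0]}) : P = (P@_0%MM)%:MP := nvar0_mpolyC P.
  have [z0 _] : exists z0 : 'I_0 -> C, True by exists (fun=> 0).
  exists z0; split=> [[]//|P|].
    by rewrite (const P) !mmapC => /eqP; rewrite fmorph_eq0 => /eqP ->; apply: rmorph0.
  by move: gz; rewrite (const g) !mmapC !fmorph_eq0.
set t := z \o @wid n in IH *.
pose th : {poly {mpoly K[n]}} -> {poly E} := map_poly (mmap e t).
pose w := z ord_max.
have th_coef p k : (th p)`_k = mmap e t p`_k by rewrite coef_map.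
have th_0 : th 0 = 0 by rewrite /th map_poly0.
have thD p q : th (p + q) = th p + th q by rewrite /th rmorphD.
have thB p q : th (p - q) = th p - th q by rewrite /th rmorphB.
have thM p q : th (p * q) = th p * th q by rewrite /th rmorphM.
have thC b : th b%:P = (mmap e t b)%:P by rewrite /th map_polyC.
have zE P : mmap e z P = (th (muni P)).[w] by rewrite mmap_muni.
have lift t0 w0 : exists z0 : 'I_n.+1 -> C, z0 \o @wid n = t0 /\ z0 ord_max = w0.
  exists (fun i => if unlift ord_max i is Some k then t0 k else w0).
  split=> [|]; last by rewrite unlift_none.
  apply: funext => i /=; have -> : wid i = lift ord_max i.
    by apply: val_inj; rewrite /= /bump leqNgt ltn_ord.
  by rewrite liftK.
have th_ext t0 (H : forall P, mmap e t P = 0 -> mmap c t0 P = 0) p q :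
    th p = th q -> map_poly (mmap c t0) p = map_poly (mmap c t0) q.
  move=> pq; apply/polyP => k; apply/eqP; rewrite !coef_map -subr_eq0 -rmorphB.
  apply/eqP/H; rewrite rmorphB; apply/eqP; rewrite subr_eq0 -!coef_map.
  by apply/eqP; have := congr1 (fun x : {poly E} => x`_k) pq.
have th_ext0 t0 (H : forall P, mmap e t P = 0 -> mmap c t0 P = 0)
    (p : {poly {mpoly K[n]}}) : th p = 0 -> map_poly (mmap c t0) p = 0.
  by move=> p0; rewrite (th_ext t0 H p 0) ?map_poly0 // p0 /th map_poly0.
(* Top coefficients killed by the evaluation at [t] are truncated away, so that the leading
   coefficient survives it. *)
have th_take p : th (take_poly (size (th p)) p) = th p.
  apply/polyP => k; rewrite !th_coef coef_take_poly; case: ltnP => //= le.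
  have := nth_default 0 le; rewrite th_coef => ->; exact: mmap0.
have th_lead (p : {poly {mpoly K[n]}}) : size p = size (th p) -> mmap e t (lead_coef p) = lead_coef (th p).
  by move=> sE; rewrite !lead_coefE -sE th_coef.
have alg0 t0 P : (forall i, algebraicOver c (t0 i)) ->
    forall k, algebraicOver c (map_poly (mmap c t0) P)`_k.
  by move=> algt k; rewrite coef_map; apply: algebraic_mmap.
have alg_ext (z0 : 'I_n.+1 -> C) : (forall i, algebraicOver c ((z0 \o @wid n) i)) ->
    algebraicOver c (z0 ord_max) -> forall i, algebraicOver c (z0 i).
  by move=> H1 H2 i; elim/ord_last_ind: i => [i|//]; apply: H1.
(* If [w] is transcendental over the other coordinates, these are specialized so that [g] keeps a
   nonzero coefficient, and any algebraic nonroot serves as last coordinate. *)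
have [transc|] := pselect (forall p, (th p).[w] = 0 -> th p = 0).
  have thg : th (muni g) != 0 by apply: contra_neq gz => g0; rewrite zE g0 horner0.
  have [|t0 [algt t0P t0g]] := IH t (lead_coef (take_poly (size (th (muni g))) (muni g))).
    rewrite th_lead ?th_take ?lead_coef_eq0 //; apply/eqP; rewrite eqn_leq.
    by rewrite size_take_poly -{1}th_take size_poly.
  have [||w0 [algw w0g]] := @algebraic_nonroot K C c (map_poly (mmap c t0) (muni g)) Ccl.
  - rewrite -(th_ext _ t0P _ _ (th_take _)).
    apply: contra_neq t0g => /polyP/(_ (size (take_poly (size (th (muni g))) (muni g))).-1).
    by rewrite coef_map coef0 lead_coefE.
  - exact: alg0.
  have [z0 [z0t z0w]] := lift t0 w0; exists z0; split.
  - by apply: alg_ext; rewrite ?z0t ?z0w.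
  - move=> P; rewrite zE => /transc P0; rewrite mmap_muni z0t z0w.
    by rewrite (th_ext0 _ t0P) ?horner0.
  - by rewrite mmap_muni z0t z0w.
move=> /existsNP[p0 /not_implyP[p0w /eqP p0n]].
(* Otherwise a relation [m] of least degree plays the role of the minimal polynomial of [w], with
   coefficients polynomial in [t]. *)
pose Q n := `[< exists p, [/\ (th p).[w] = 0, th p != 0 & size (th p) = n] >].
have exQ : exists n, Q n by exists (size (th p0)); apply/asboolP; exists p0.
have [k /asboolP[p1 [p1w p1n p1s]] mink] := ex_minnP exQ.
have truncate (p : {poly {mpoly K[n]}}) : exists2 q, th q = th p & size q = size (th p).
  exists (take_poly (size (th p)) p); first exact: th_take.
  by apply/eqP; rewrite eqn_leq size_take_poly -{1}th_take size_poly.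
have [m mE sm] := truncate p1; rewrite -{}mE in p1w p1n p1s sm.
have k1 : (1 < k)%N.
  rewrite ltnNge -p1s; apply/negP => /size1_polyC mC; move: p1w p1n; rewrite mC.
  by rewrite hornerC polyC_eq0 => ->; rewrite eqxx.
have gw : (th (muni g)).[w] != 0 by rewrite -zE.
(* The least combination [s] of [m] and [g] is a gcd up to scalars. It does not vanish at [w], as
   [g] does not, and it divides [m]; minimality of [m] then makes it a constant [b]. *)
pose R n := `[< exists u v, th (u * m + v * muni g) != 0 /\
                  size (th (u * m + v * muni g)) = n >].
have exR : exists n, R n by exists k; apply/asboolP; exists 1, 0; rewrite mul1r mul0r addr0.
have [l /asboolP[u [v [uvn uvs]]] minl] := ex_minnP exR.
have [s sE ss] := truncate (u * m + v * muni g); rewrite -sE in uvn uvs ss.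
have ns : s != 0 by apply: contra_neq uvn => ->.
have div (p : {poly {mpoly K[n]}}) : (exists u' v', p = u' * m + v' * muni g) ->
    exists q, th q * th s = lead_coef (th s) ^+ scalp p s *: th p.
  move=> [u' [v' pE]]; exists (p %/ s).
  have rE : p %% s = lead_coef s ^+ scalp p s *: p - (p %/ s) * s.
    by rewrite Pdiv.Idomain.divp_eq addrC addKr.
  suff r0 : th (p %% s) = 0.
    have := congr1 th rE; rewrite r0 thB thM -mul_polyC thM thC rmorphXn /=.
    by rewrite th_lead // mul_polyC => /esym/eqP; rewrite subr_eq0 eq_sym => /eqP.
  apply/eqP; apply: contraTT (ltn_modpN0 p ns) => nr; rewrite -leqNgt ss uvs.
  apply: (@leq_trans (size (th (p %% s)))); last by rewrite size_poly.
  apply: minl; apply/asboolP.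
  set L := (lead_coef s ^+ scalp p s)%:P; set q := p %/ s.
  exists (L * u' - q * u), (L * v' - q * v).
  suff -> : th ((L * u' - q * u) * m + (L * v' - q * v) * muni g) = th (p %% s) by [].
  rewrite (bezout_combination L q u v u' v' m (muni g)) -pE.
  rewrite rE -mul_polyC -/L -/q thB [RHS]thB; congr (_ - _).
  by rewrite thM [RHS]thM sE.
have [qm qmE] : exists q, th q * th s = lead_coef (th s) ^+ scalp m s *: th m.
  by apply: div; exists 1, 0; rewrite mul1r mul0r addr0.
have [qg qgE] : exists q, th q * th s = lead_coef (th s) ^+ scalp (muni g) s *: th (muni g).
  by apply: div; exists 0, 1; rewrite mul1r mul0r add0r.
have lsn j : lead_coef (th s) ^+ j != 0 by rewrite expf_neq0 // lead_coef_eq0.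
have sw : (th s).[w] != 0.
  apply: contraNneq gw => s0; have := congr1 (fun x : {poly E} => x.[w]) qgE.
  rewrite hornerM s0 mulr0 hornerZ => /esym/eqP.
  by rewrite mulf_eq0 (negPf (lsn _)).
have s1 : size s = 1%N.
  apply/eqP; rewrite eqn_leq size_poly_gt0 ns andbT leqNgt; apply/negP => s1.
  have := congr1 (fun x : {poly E} => x.[w]) qmE.
  rewrite hornerM hornerZ p1w mulr0 => /eqP; rewrite mulf_eq0 (negPf sw) orbF => /eqP qw.
  have nq : th qm != 0.
    apply: contra_neq p1n => q0; apply: (scalerI (lsn (scalp m s))).
    by rewrite -qmE q0 mul0r scaler0.
  have /mink : Q (size (th qm)) by apply/asboolP; exists qm.
  have := congr1 (fun x : {poly E} => size x) qmE.
  rewrite size_scale // size_mul // p1s -ss.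
  by move: nq s1; rewrite -size_poly_gt0; move: (size (th qm)) (size s) => x y; lia.
have /size1_polyC sC : (size s <= 1)%N by rewrite s1.
set b := s`_0 in sC.
have bt : mmap e t b != 0.
  by apply: contra_neq uvn => b0; rewrite sC thC b0.
have at_ : mmap e t (lead_coef m) != 0 by rewrite th_lead ?sm // lead_coef_eq0.
(* With the leading coefficient of [m] nonzero, [m] keeps its degree and has a root [w0]; with [b]
   nonzero, the combination giving [b] prevents [g] from vanishing there. *)
have [|t0 [algt t0P]] := IH t (lead_coef m * b); first by rewrite rmorphM mulf_neq0.
rewrite rmorphM mulf_eq0 negb_or => /andP[a0 b0].
pose th0 : {poly {mpoly K[n]}} -> {poly C} := map_poly (mmap c t0).
have th0D p q : th0 (p + q) = th0 p + th0 q by rewrite /th0 rmorphD.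
have th0M p q : th0 (p * q) = th0 p * th0 q by rewrite /th0 rmorphM.
have th0C x : th0 x%:P = (mmap c t0 x)%:P by rewrite /th0 map_polyC.
have sm0 : size (th0 m) = size m.
  by rewrite size_poly_eq //.
have [|w0 rw0] := @closed_field_root C (th0 m) Ccl; first by rewrite sm0 sm p1s.
have nm0 : th0 m != 0 by rewrite -size_poly_gt0 sm0 sm p1s ltnW.
have algw : algebraicOver c w0 by apply: (algebraic_root nm0 _ rw0); apply: alg0.
have [z0 [z0t z0w]] := lift t0 w0; exists z0; split.
- by apply: alg_ext; rewrite ?z0t ?z0w.
- move=> P; rewrite zE mmap_muni z0t z0w => P0; set p := muni P in P0 *.
  have nm : m != 0 by rewrite -size_poly_gt0 sm p1s ltnW.
  have dE := Pdiv.Idomain.divp_eq p m.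
  have r0 : th (p %% m) = 0.
    apply/eqP; apply: contraTT (ltn_modpN0 p nm) => nr; rewrite -leqNgt sm p1s.
    apply: (@leq_trans (size (th (p %% m)))); last by rewrite size_poly.
    apply: mink; apply/asboolP; exists (p %% m); split=> //.
    have := congr1 (fun x => (th x).[w]) dE.
    rewrite -mul_polyC thD !thM !hornerE P0 p1w.
    by rewrite !mulr0 add0r => <-.
  have := congr1 (fun x => (th0 x).[w0]) dE.
  have r00 : th0 (p %% m) = 0 by apply: th_ext0.
  rewrite -mul_polyC th0D !th0M !hornerE r00 horner0.
  rewrite (rootP rw0) mulr0 addr0 th0C hornerC rmorphXn /= => /eqP.
  by rewrite mulf_eq0 expf_eq0 (negPf a0) andbF => /eqP.
- rewrite mmap_muni z0t z0w; apply: contra_neq b0 => g0.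
  have := th_ext _ t0P _ _ sE; rewrite sC -!/(th0 _) th0C th0D !th0M => E0.
  have := congr1 (fun x : {poly C} => x.[w0]) E0.
  rewrite !hornerE (rootP rw0) g0.
  by rewrite !mulr0 addr0.
Qed.

(** * Regular extensions as function fields of hypersurfaces *)

Section LinearDisjointness.

Variables (K F C : fieldType) (e : {rmorphism K -> F}) (j : {rmorphism F -> C}).
Hypothesis disj : forall (n : nat) (c : 'I_n -> C),
  (forall i, algebraicOver (j \o e) (c i)) ->
  (forall a : 'I_n -> K, \sum_i j (e (a i)) * c i = 0 -> forall i, a i = 0) ->
  forall a : 'I_n -> F, \sum_i j (a i) * c i = 0 -> forall i, a i = 0.

(** If the [b i] are independent over [K], disjointness makes every [u i] zero. Otherwise one [b i0]
    is expressed by the others and substituted: this leaves a shorter relation between the elements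
    [u k - r k * u i0], and a relation of these over [K] is one of the [u i]. *)
Lemma algebraic_relation_descent s (b : 'I_s -> C) (u : 'I_s -> F) :
    (forall i, algebraicOver (j \o e) (b i)) -> \sum_i j (u i) * b i = 0 ->
    (exists i, b i != 0) ->
  exists a : 'I_s -> K, (exists i, a i != 0) /\ \sum_i e (a i) * u i = 0.
Proof.
elim: s b u => [|s IH] b u algb ub0 [i1 nb]; first by case: i1 {nb}.
have [indep|] := pselect (forall a : 'I_s.+1 -> K,
    \sum_i j (e (a i)) * b i = 0 -> forall i, a i = 0).
  have u0 := disj algb indep ub0.
  exists (fun=> 1); split; first by exists i1; apply: oner_neq0.
  by rewrite big1 // => i _; rewrite u0 mulr0.
move=> /existsNP[a /not_implyP[ab0 /existsNP[i0 /eqP na]]].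
have nja : j (e (a i0)) != 0 by rewrite !fmorph_eq0.
move: ab0 ub0; rewrite !(bigD1_ord i0) //= => ab0 ub0.
pose r k := a (lift i0 k) / a i0.
have bi0 : b i0 = - \sum_k j (e (r k)) * b (lift i0 k).
  apply: (mulfI nja); rewrite mulrN mulr_sumr; apply/eqP; rewrite -addr_eq0 -{2}ab0.
  apply/eqP; congr (_ + _); apply: eq_bigr => k _.
  by rewrite mulrA -!rmorphM /r mulrCA divff // mulr1.
have [|||a' [[k nak] a'0]] := IH (fun k => b (lift i0 k))
    (fun k => u (lift i0 k) - e (r k) * u i0).
- by move=> k; apply: algb.
- rewrite -[RHS]ub0 bi0 mulrN mulr_sumr addrC -sumrB; apply: eq_bigr => k _.
  by rewrite rmorphB rmorphM mulrBl; congr (_ - _); ring.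
- apply: contrapT => H.
  have b0 k : b (lift i0 k) = 0.
    by apply/eqP; apply: contraT => nk; case: H; exists k.
  have bi00 : b i0 = 0 by rewrite bi0 big1 ?oppr0 // => k _; rewrite b0 mulr0.
  move: nb; case: (unliftP i0 i1) => [k ->|->]; by rewrite ?b0 ?bi00 eqxx.
exists (fun i => if unlift i0 i is Some k then a' k else - \sum_k a' k * r k).
split; first by exists (lift i0 k); rewrite liftK.
rewrite (bigD1_ord i0) //= unlift_none -[RHS]a'0.
rewrite rmorphN rmorph_sum mulNr mulr_suml addrC -sumrB; apply: eq_bigr => l _.
by rewrite liftK rmorphM mulrBr mulrA.
Qed.

(** The descent is applied to the coefficients of [g] and the values of its monomials, so [g'] has
    no new monomials and its degree does not grow. *)
Lemma mpoly_relation_descent n (z : 'I_n -> F) (g : {mpoly C[n]}) :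
    g != 0 -> (forall m, algebraicOver (j \o e) g@_m) -> g.@[j \o z] = 0 ->
  exists g' : {mpoly K[n]},
    [/\ g' != 0, (msize g' <= msize g)%N & mmap e z g' = 0].
Proof.
move=> ng algg gz; set s := msupp g.
pose M (i : 'I_(size s)) := nth 0%MM s i.
have Ms i : M i \in s by apply: mem_nth.
have Minj : injective M.
  move=> i k /eqP; rewrite /M nth_uniq ?msupp_uniq // => /eqP H; exact: val_inj.
have gE : g = \sum_i g@_(M i) *: 'X_[M i].
  by rewrite [LHS]mpolyE (big_nth 0%MM) big_mkord.
have [|||a [[i nai] a0]] := @algebraic_relation_descent (size s)
    (fun i => g@_(M i)) (fun i => mmap1 z (M i)).
- by move=> i; apply: algg.
- rewrite -[RHS]gz [in RHS]gE raddf_sum; apply: eq_bigr => i _.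
  rewrite /= mevalZ mevalX mulrC /mmap1 rmorph_prod; congr (_ * _).
  by apply: eq_bigr => k _; rewrite rmorphXn.
- have s0 : (0 < size s)%N by rewrite lt0n size_eq0 msupp_eq0.
  by exists (Ordinal s0); rewrite -mcoeff_msupp; apply: Ms.
pose g' : {mpoly K[n]} := \sum_i a i *: 'X_[M i].
exists g'; split.
- apply: contraNneq nai => /(congr1 (mcoeff (M i))).
  rewrite raddf_sum mcoeff0 (bigD1 i) //= big1 => [|k ki].
    by rewrite mcoeffZ mcoeffX eqxx mulr1 addr0 => ->.
  by rewrite mcoeffZ mcoeffX (inj_eq Minj) (negPf ki) mulr0.
- apply: (leq_trans (msize_sum _ _ _)); apply/bigmax_leqP => k _.
  apply: (leq_trans (mmeasureZ_le _ _ _)).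
  by rewrite mmeasureX; apply: msize_mdeg_lt; apply: Ms.
rewrite -[RHS]a0 /g' raddf_sum; apply: eq_bigr => k _.
by rewrite /= mmapZ mmapX.
Qed.

End LinearDisjointness.

Definition minimal_relation (K E : fieldType) (e : K -> E) n (z : 'I_n -> E)
    (f : {mpoly K[n]}) : Prop :=
  [/\ f != 0, mmap e z f = 0 &
      forall g, g != 0 -> mmap e z g = 0 -> (msize f <= msize g)%N].

Lemma exists_minimal_relation (K E : fieldType) (e : K -> E) n (z : 'I_n -> E)
    (g : {mpoly K[n]}) :
  g != 0 -> mmap e z g = 0 -> exists f, minimal_relation e z f.
Proof.
move=> ng gz; pose Q n := `[< exists g', [/\ g' != 0, mmap e z g' = 0 & msize g' = n] >].
have exQ : exists n, Q n by exists (msize g); apply/asboolP; exists g.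
have [k /asboolP[f [nf fz sf]] mink] := ex_minnP exQ.
exists f; split=> // g' ng' g'z; rewrite sf; apply: mink.
by apply/asboolP; exists g'.
Qed.

(** A factorization over [E] is a solution of polynomial equations over [K] in the coefficients of
    the factors; specialization yields one algebraic over [K]. One factor then vanishes at [z], and
    linear disjointness turns it into a relation over [K] of smaller degree than [f]. *)
Lemma regular_minimal_abs_irreducible (K F : fieldType) (e : {rmorphism K -> F}) n
    (z : 'I_n -> F) (f : {mpoly K[n]}) :
  regular e -> minimal_relation e z f -> abs_irreducible f.
Proof.
move=> [C [j [Ccl _ disj]]] [nf fz minf]; split.
  rewrite ltnNge; apply/negP => /msize1_polyC fE; move: nf fz; rewrite fE mmapC.
  by rewrite mpolyC_eq0 => nf /eqP; rewrite fmorph_eq0 (negPf nf).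
move=> E i g h sg sh ghf.
pose D := (msize f).-1.
have Df : (D < msize f)%N by rewrite /D prednK // lt0n msize_poly_eq0.
have gD : (msize g <= D)%N by rewrite -ltnS (leq_trans sg) // leqSpred.
have hD : (msize h <= D)%N by rewrite -ltnS (leq_trans sh) // leqSpred.
pose T := 'X_{1..n < D}%MM : finType.
pose N := (#|T| + #|T|)%N.
pose y (k : 'I_N) := match split k with
  | inl l => g@_(enum_val l : 'X_{1..n < D}) | inr l => h@_(enum_val l : 'X_{1..n < D}) end.
pose A := {mpoly K[N]}.
(* [G] and [H] have indeterminate coefficients, one variable for each monomial of each factor; at
   [y] they become [g] and [h]. *)
pose G : {mpoly A[n]} := \sum_(m : 'X_{1..n < D}) 'X_(lshift _ (enum_rank m)) *: 'X_[m].
pose H : {mpoly A[n]} := \sum_(m : 'X_{1..n < D}) 'X_(rshift _ (enum_rank m)) *: 'X_[m].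
pose Fp : {mpoly A[n]} := map_mpoly (@mpolyC N K) f.
have evE (B : fieldType) (c : {rmorphism K -> B}) (x : 'I_N -> B) :
    map_mpoly (mmap c x) Fp = map_mpoly c f.
  by apply/mpolyP => m; rewrite /Fp !mcoeff_map_mpoly /= mmapC.
have evG : map_mpoly (mmap i y) G = g.
  rewrite [RHS](mpolywE gD) /G rmorph_sum; apply: eq_bigr => m _.
  rewrite /= map_mpolyZ map_mpolyX /= mmapX mmap1U /y.
  by rewrite (unsplitK (inl _ (enum_rank m))) enum_rankK.
have evH : map_mpoly (mmap i y) H = h.
  rewrite [RHS](mpolywE hD) /H rmorph_sum; apply: eq_bigr => m _.
  rewrite /= map_mpolyZ map_mpolyX /= mmapX mmap1U /y.
  by rewrite (unsplitK (inr _ (enum_rank m))) enum_rankK.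
have y1 : mmap i y 1 != 0 by rewrite rmorph1 oner_neq0.
have [x [algx xP _]] := algebraic_specialization (j \o e) Ccl y1.
have ghx : map_mpoly (mmap (j \o e) x) G * map_mpoly (mmap (j \o e) x) H =
    map_mpoly (j \o e) f.
  rewrite -(evE _ (j \o e) x) -rmorphM; apply/mpolyP => m.
  rewrite 2!mcoeff_map_mpoly.
  have /xP : mmap i y ((G * H)@_m - Fp@_m) = 0.
    by rewrite raddfB /= -!(mcoeff_map_mpoly (mmap i y)) rmorphM /= evG evH evE ghf subrr.
  by rewrite raddfB => /eqP; rewrite subr_eq0 => /eqP.
set g0 := map_mpoly _ G in ghx; set h0 := map_mpoly _ H in ghx.
have alg_mono (I0 : 'X_{1..n < D} -> 'I_N) (P := \sum_(m : 'X_{1..n < D}) 'X_(I0 m) *: 'X_[m] : {mpoly A[n]}) :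
    map_mpoly (mmap (j \o e) x) P != 0 ->
    (map_mpoly (mmap (j \o e) x) P).@[j \o z] = 0 -> False.
  move=> nP Pz; have [|g' [ng' sg' g'z]] := mpoly_relation_descent disj nP _ Pz.
    by move=> m; rewrite mcoeff_map_mpoly /=; apply: algebraic_mmap.
  have := leq_trans (minf g' ng' g'z) sg'; rewrite leqNgt => /negP; apply.
  apply: leq_ltn_trans Df; rewrite /P rmorph_sum.
  apply: (leq_trans (msize_sum _ _ _)); apply/bigmax_leqP => m _.
  rewrite /= map_mpolyZ map_mpolyX; apply: (leq_trans (mmeasureZ_le _ _ _)).
  by rewrite mmeasureX bmdeg.
have nf0 : map_mpoly (j \o e) f != 0 by rewrite map_mpoly_eq0.
have : g0.@[j \o z] * h0.@[j \o z] = 0.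
  by rewrite -mevalM ghx meval_map_mpoly -(rmorph_mmap e j) fz rmorph0.
move/eqP; rewrite mulf_eq0 => /orP[/eqP gz|/eqP hz].
  apply: (alg_mono (fun m => lshift _ (enum_rank m))) gz.
  by apply: contra_neq nf0 => g00; rewrite -ghx /g0 g00 mul0r.
apply: (alg_mono (fun m => rshift _ (enum_rank m))) hz.
by apply: contra_neq nf0 => h00; rewrite -ghx /h0 h00 mulr0.
Qed.

Lemma closed_pth_root (C : fieldType) p (x : C) :
  GRing.closed_field_axiom C -> (0 < p)%N -> exists y, y ^+ p = x.
Proof.
move=> Ccl p0; have [y yE] := Ccl p (fun i => if i == 0%N then x else 0) p0.
exists y; rewrite yE; case: p p0 {yE} => // p _; rewrite big_ord_recl /= expr0 mulr1.
by rewrite big1 ?addr0 // => i _; rewrite mul0r.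
Qed.

(** If all derivatives vanish, the characteristic [p] is positive and divides every exponent that
    occurs; over an algebraically closed field [f] is then a [p]-th power. *)
Lemma abs_irreducible_mderiv (K C : fieldType) (c : {rmorphism K -> C}) n
    (f : {mpoly K[n]}) :
  GRing.closed_field_axiom C -> abs_irreducible f -> exists i, f^`M(i) != 0.
Proof.
move=> Ccl irf; have [sf _] := irf; apply: contrapT => H.
have D0 m i : m \in msupp f -> (m i)%:R = 0 :> K.
  move=> mf; have [->//|mi] := posnP (m i).
  have fi0 : f^`M(i) = 0 by apply/eqP; apply: contraT => nz; case: H; exists i.
  have := mcoeff_mderiv i f (m - U_(i)); rewrite fi0 mcoeff0.
  have Um : (U_(i) <= m)%MM.
    by apply/mnm_lepP => k; rewrite mnm1E; case: eqP => // <-.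
  rewrite submK // mnmBE mnm1E eqxx subn1 prednK // => /esym/eqP.
  by rewrite -[f@_m *+ _]mulr_natr mulf_eq0 => /orP[|/eqP//]; rewrite mcoeff_eq0 mf.
have [m0 [m0f m0d]] : exists m, m \in msupp f /\ (0 < mdeg m)%N.
  apply: contrapT => no; move: sf; rewrite ltnNge => /negP; apply.
  rewrite mmeasureE; apply/bigmax_leqP_seq => m mf _.
  by rewrite ltnS leqNgt; apply/negP => md; apply: no; exists m.
have [i mi0] : exists i, (0 < m0 i)%N.
  apply: contrapT => no; move: m0d; rewrite mdegE big1 // => i _.
  by apply/eqP; rewrite -leqn0 leqNgt; apply/negP => ?; apply: no; exists i.
have [|p pK] := @natf0_pchar K (m0 i) mi0; first by rewrite (D0 m0 i m0f).
have p_pr := pcharf_prime pK.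
have dvd m k : m \in msupp f -> (p %| m k)%N.
  by move=> mf; rewrite (dvdn_pcharf pK) (D0 m k mf).
have pC : p \in [pchar {mpoly C[n]}].
  exact: (rmorph_pchar (@mpolyC n C \o c)).
have [r rP] := choice (fun x => closed_pth_root x Ccl (prime_gt0 p_pr)).
pose g : {mpoly C[n]} := \sum_(m <- msupp f)
  r (c f@_m) *: 'X_[ [multinom (m i %/ p)%N | i < n] ].
have gp : g ^+ p = map_mpoly c f.
  rewrite -(pFrobenius_autE pC) /g [X in map_mpoly c X]mpolyE !rmorph_sum.
  apply: eq_big_seq => m mf; rewrite /= pFrobenius_autE map_mpolyZ map_mpolyX.
  rewrite exprZn rP mpolyXn; congr (_ *: 'X_[_]).
  by apply/mnmP => k; rewrite mulmnE mnmE divnK ?dvd.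
have [_ nu irr] := abs_irreducible_elt (abs_irreducible_map c irf).
have up k : runit g -> runit (g ^+ k).
  by move=> [h hg]; exists (h ^+ k); rewrite -exprMn -hg expr1n.
have down k : runit (g ^+ k.+1) -> runit g.
  by move=> [h hg]; exists (h * g ^+ k); rewrite -mulrA -exprSr.
have p2 := prime_gt1 p_pr.
have [||] := irr g (g ^+ p.-2.+1).
- by rewrite -gp -exprS; congr (_ ^+ _); move: p2; lia.
- by move=> /(up p); rewrite gp.
- by move=> /down /(up p); rewrite gp.
Qed.

(** * Subfields, finite generation, primitive elements *)

Section SubField.

Variables (F : fieldType) (S : divringClosed F).

Inductive subfield_type := SubfieldElt x & x \in S.
Definition subfield_val u := let: SubfieldElt x _ := u in x.

HB.instance Definition _ := [isSub for subfield_val].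
HB.instance Definition _ := [Choice of subfield_type by <:].
HB.instance Definition _ := [SubChoice_isSubUnitRing of subfield_type by <:].
HB.instance Definition _ := [SubNzRing_isSubComNzRing of subfield_type by <:].
HB.instance Definition _ := [SubComUnitRing_isSubIntegralDomain of subfield_type by <:].
HB.instance Definition _ := [SubIntegralDomain_isSubField of subfield_type by <:].

End SubField.

Lemma exists_subfield (F : fieldType) (S : {pred F}) :
    divring_closed S ->
  exists (G : fieldType) (v : {rmorphism G -> F}), forall a, a \in S <-> exists g, v g = a.
Proof.
move=> HS; pose S' : divringClosed F := HB.pack S (GRing.isDivringClosed.Build F S HS).
pose v : {rmorphism subfield_type S' -> F} := \val.
exists (subfield_type S'), v => a; split=> [Sa|[[x Sx] <-]] //.
by exists (@SubfieldElt F S' a Sa).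
Qed.

Lemma rmorph_factor (R G F : nzRingType) (v : {rmorphism G -> F})
    (phi : {rmorphism R -> F}) :
    injective v -> (forall x, exists g, v g = phi x) ->
  exists th : {rmorphism R -> G}, forall x, v (th x) = phi x.
Proof.
move=> vinj /choice[h hE].
have hB : additive h by move=> x y; apply: vinj; rewrite rmorphB !hE rmorphB.
have hM : multiplicative h.
  by split=> [x y|]; apply: vinj; rewrite ?rmorphM ?rmorph1 !hE ?rmorphM ?rmorph1.
pose hm : {rmorphism R -> G} := HB.pack h
  (GRing.isAdditive.Build R G h hB) (GRing.isMultiplicative.Build R G h hM).
by exists hm.
Qed.

Lemma common_denominator (R : comNzRingType) (E : fieldType)
    (phi : {rmorphism R -> E}) k (a : 'I_k -> E) :
    (forall i, exists x y, phi y <> 0 /\ a i = phi x / phi y) ->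
  exists b x, phi b != 0 /\ forall i, a i * phi b = phi (x i).
Proof.
move=> /choice[x /choice[y xy]]; exists (\prod_i y i).
exists (fun i => x i * \prod_(l | l != i) y l); split.
  by rewrite rmorph_prod; apply/prodf_neq0 => i _; apply/eqP; case: (xy i).
move=> i; have [ny aE] := xy i; rewrite (bigD1 i) //= !rmorphM mulrA.
by congr (_ * _); rewrite aE divfK //; apply/eqP.
Qed.

Definition snoc (T : Type) n (t : 'I_n -> T) (w : T) (i : 'I_n.+1) : T :=
  if unlift ord_max i is Some k then t k else w.

Lemma snoc_max (T : Type) n (t : 'I_n -> T) w : snoc t w ord_max = w.
Proof. by rewrite /snoc unlift_none. Qed.

Lemma snoc_wid (T : Type) n (t : 'I_n -> T) w i : snoc t w (wid i) = t i.
Proof.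
have -> : wid i = lift ord_max i.
  by apply: val_inj; rewrite /= /bump leqNgt ltn_ord.
by rewrite /snoc liftK.
Qed.

Lemma snoc_comp_wid (T : Type) n (t : 'I_n -> T) w : snoc t w \o @wid n = t.
Proof. by apply: funext => i; apply: snoc_wid. Qed.

Definition in_gen (K E : fieldType) (e : K -> E) n (z : 'I_n -> E) (a : E) : Prop :=
  exists P Q, mmap e z Q <> 0 /\ a = mmap e z P / mmap e z Q.

Section Generated.

Variables (K E : fieldType) (e : {rmorphism K -> E}) (n : nat) (z : 'I_n -> E).

Lemma in_gen_mmap P : in_gen e z (mmap e z P).
Proof.
by exists P, 1; rewrite rmorph1 divr1; split=> //; apply/eqP; apply: oner_neq0.
Qed.

Lemma in_gen_var i : in_gen e z (z i).
Proof. by have := in_gen_mmap 'X_i; rewrite mmapX mmap1U. Qed.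

Lemma in_gen_const c : in_gen e z (e c).
Proof. by have := in_gen_mmap c%:MP; rewrite mmapC. Qed.

Lemma in_gen_closed : divring_closed [pred a | `[< in_gen e z a >]].
Proof.
split; first by apply/asboolP; have := in_gen_const 1; rewrite rmorph1.
- move=> a b /asboolP[P [Q [/eqP nQ ->]]] /asboolP[P' [Q' [/eqP nQ' ->]]].
  apply/asboolP; exists (P * Q' - P' * Q), (Q * Q'); split.
    by rewrite rmorphM; apply/eqP; rewrite mulf_neq0.
  by rewrite rmorphB !rmorphM /=; field; rewrite nQ nQ'.
move=> a b /asboolP[P [Q [/eqP nQ ->]]] /asboolP[P' [Q' [/eqP nQ' ->]]].
apply/asboolP; have [P0|nP'] := eqVneq (mmap e z P') 0.
  by rewrite P0 mul0r invr0 mulr0; have := in_gen_const 0; rewrite rmorph0.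
exists (P * Q'), (Q * P'); split.
  by rewrite rmorphM; apply/eqP; rewrite mulf_neq0.
by rewrite !rmorphM /=; field; rewrite nQ nQ' nP'.
Qed.

Lemma exists_gen_field :
  exists (G : fieldType) (v : {rmorphism G -> E}) (th : {rmorphism {mpoly K[n]} -> G}),
    (forall a, in_gen e z a <-> exists g, v g = a) /\
    (forall P, v (th P) = mmap e z P).
Proof.
have [G [v vE]] := exists_subfield in_gen_closed.
have vE' a : in_gen e z a <-> exists g, v g = a.
  by rewrite -vE; split=> [?|/asboolP //]; apply/asboolP.
have [P|th thE] := @rmorph_factor _ _ _ v (mmap e z) (fmorph_inj v).
  by apply/vE'/in_gen_mmap.
by exists G, v, th.
Qed.

End Generated.

Lemma in_gen_trans (K E : fieldType) (e : {rmorphism K -> E}) n n' (z : 'I_n -> E)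
    (z' : 'I_n' -> E) a :
  (forall i, in_gen e z' (z i)) -> in_gen e z a -> in_gen e z' a.
Proof.
have [G [v [th [vE _]]]] := exists_gen_field e z'.
move=> H [P [Q [_ ->]]]; have [y yE] := choice (fun i => (vE _).1 (H i)).
have [c cE] := choice (fun x => (vE _).1 (in_gen_const e z' x)).
have gP R : exists g, v g = mmap e z R.
  exists (\sum_(m <- msupp R) c R@_m * \prod_i y i ^+ m i).
  rewrite rmorph_sum; apply: eq_bigr => m _; rewrite rmorphM cE; congr (_ * _).
  by rewrite rmorph_prod; apply: eq_bigr => i _; rewrite rmorphXn yE.
have [[p pE] [q qE]] := (gP P, gP Q).
by apply/vE; exists (p / q); rewrite fmorph_div pE qE.
Qed.

(** The annihilator [q] of least degree divides [p], so [y] is a simple root of [q]. The gcd of [q]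
    and its derivative does not vanish at [y], its cofactor does, and minimality makes the gcd
    constant. *)
Lemma separable_annihilator (G F : fieldType) (v : {rmorphism G -> F}) (p : {poly G}) y :
    root (map_poly v p) y -> ~~ root (map_poly v p^`()) y ->
  exists2 q, root (map_poly v q) y & separable_poly q.
Proof.
move=> py dpy; have np : p != 0 by apply: contraNneq dpy => ->; rewrite deriv0 rmorph0 root0.
pose Q n := `[< exists q, [/\ q != 0, root (map_poly v q) y & size q = n] >].
have exQ : exists n, Q n by exists (size p); apply/asboolP; exists p.
have [k /asboolP[q [nq qy sq]] mink] := ex_minnP exQ.
have minq r : r != 0 -> root (map_poly v r) y -> (size q <= size r)%N.
  by move=> nr ry; rewrite sq; apply: mink; apply/asboolP; exists r.
exists q => //.
have qp : q %| p.
  apply: contraT => nqp; have := minq (p %% q).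
  rewrite leqNgt ltn_modp nq => H; apply: H; first by apply: contra nqp => /eqP/modp_eq0P.
  move: py; rewrite {1}(divp_eq p q) rmorphD rmorphM /= !rootE hornerD hornerM.
  by rewrite (rootP qy) mulr0 add0r.
have dqy : ~~ root (map_poly v q^`()) y.
  apply: contra dpy => dqy; have [r rE] := dvdpP _ _ qp.
  rewrite rE derivM !rmorphD !rmorphM /= !rootE hornerD !hornerM.
  by rewrite (rootP qy) (rootP dqy) !mulr0 addr0.
rewrite unlock /coprimep; set d := gcdp _ _.
have /dvdpP[r rE] : d %| q := dvdp_gcdl _ _.
have [r' r'E] := dvdpP _ _ (dvdp_gcdr q q^`()).
have ndy : ~~ root (map_poly v d) y.
  apply: contra dqy => dy; rewrite r'E rmorphM /= rootE hornerM.
  by rewrite -/d (rootP dy) mulr0.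
have nr : r != 0 by apply: contra_neq nq => r0; rewrite rE r0 mul0r.
have nd : d != 0 by apply: contra_neq nq => d0; rewrite rE d0 mulr0.
have ry : root (map_poly v r) y.
  move: qy; rewrite {1}rE rmorphM /= rootE hornerM mulf_eq0 => /orP[//|dy].
  by rewrite /root dy in ndy.
have := minq r nr ry; rewrite {1}rE size_mul //.
by move: nr nd; rewrite -!size_poly_gt0; move: (size r) (size d) => a b; lia.
Qed.

Lemma minimal_relation_mwiden (K E : fieldType) (e : {rmorphism K -> E}) d
    (z : 'I_d.+1 -> E) (f : {mpoly K[d.+1]}) :
    algebraically_independent e (z \o @wid d) -> minimal_relation e z f ->
  (1 < size (muni f))%N.
Proof.
move=> indep [nf fz _]; rewrite ltnNge; apply/negP => /size1_polyC fE.
move: nf fz; rewrite -[f]muniK fE /poly_last map_polyC hornerC /= mmap_wid.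
by move=> nc /indep c0; rewrite c0 rmorph0 eqxx in nc.
Qed.

Lemma mmap_msym (K E : fieldType) (e : {rmorphism K -> E}) n (s : 'S_n)
    (z : 'I_n -> E) (f : {mpoly K[n]}) :
  mmap e z (msym s f) = mmap e (z \o s) f.
Proof.
apply: (mpoly_rmorph_ext (f := mmap e z \o msym s) (g := mmap e (z \o s))) => [c|i] /=.
  by rewrite /msym mmapC !mmapC.
by rewrite /msym mmapX mmap1U !mmapX !mmap1U.
Qed.

Lemma msize_msym (K : fieldType) n (s : 'S_n) (f : {mpoly K[n]}) :
  msize (msym s f) = msize f.
Proof.
suff le (t : 'S_n) (g : {mpoly K[n]}) : (msize (msym t g) <= msize g)%N.
  apply/eqP; rewrite eqn_leq le /=.
  by rewrite -{1}[f]msym1m -(mulgV s) msymMm le.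
rewrite [X in (X <= _)%N]mmeasureE; apply/bigmax_leqP_seq => m.
rewrite mcoeff_msupp mcoeff_sym -mcoeff_msupp => /msize_mdeg_lt mg _.
suff mE : mdeg m = mdeg [multinom m (t i) | i < n] by rewrite -mE in mg.
rewrite !mdegE (reindex_inj (@perm_inj _ t)) /=; apply: eq_bigr => i _.
by rewrite mnmE.
Qed.

Lemma mderiv_msym (K : fieldType) n (s : 'S_n) i (f : {mpoly K[n]}) :
  (msym s f)^`M(s i) = msym s f^`M(i).
Proof.
apply/mpolyP => m; rewrite mcoeff_sym !mcoeff_mderiv mcoeff_sym mnmE.
congr (f@_ _ *+ _); apply/mnmP => k.
by rewrite !(mnmDE, mnmE, mnm1E) (inj_eq perm_inj).
Qed.

(* The dependent tuple [z] is reordered so that the minimal relation is separable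
   in the last coordinate. *)
Lemma separable_reordering (K F : fieldType) (e : {rmorphism K -> F}) d
    (z : 'I_d.+1 -> F) (g : {mpoly K[d.+1]}) :
    regular e -> algebraically_independent e (z \o @wid d) -> g != 0 ->
    mmap e z g = 0 ->
  exists (s : 'S_d.+1) f, [/\ algebraically_independent e ((z \o s) \o @wid d),
    minimal_relation e (z \o s) f & f^`M(ord_max) != 0].
Proof.
move=> reg indep ng gz; have [f minf] := exists_minimal_relation ng gz.
have irf := regular_minimal_abs_irreducible reg minf.
have [C [j [Ccl _ _]]] := reg.
have [i di] := abs_irreducible_mderiv (j \o e) Ccl irf.
have [nf fz minz] := minf; have sf := minimal_relation_mwiden indep minf.
pose s : 'S_d.+1 := tperm i ord_max.
have ss x : s (s x) = x by rewrite tpermK.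
have zss : (z \o s) \o s = z by apply: funext => x /=; rewrite ss.
have df : (msym s f)^`M(ord_max) != 0.
  rewrite -(tpermL i ord_max) -/s mderiv_msym.
  by apply: contra_neq di => /(congr1 (msym s)); rewrite -msymMm tperm2 msym1m msym0.
exists s, (msym s f); split=> //.
- move=> q; rewrite -mmap_wid -mmap_msym => q0.
  have [c cE] := (mmap_generic _ (abs_irreducible_elt irf) sf indep fz).1 q0.
  apply: (@muni_size_dvd _ _ (msym s f)); first exact: mderiv_size_muni.
  by exists (msym s c); rewrite -msymM -cE -msymMm tperm2 msym1m.
- split.
  + by rewrite -msize_poly_eq0 msize_msym msize_poly_eq0.
  + by rewrite mmap_msym zss.
  + move=> h nh hz; rewrite msize_msym -(msize_msym s h); apply: minz.
      by rewrite -msize_poly_eq0 msize_msym msize_poly_eq0.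
    by rewrite mmap_msym.
Qed.

(** Disjointness applied to the pair [1, u]: over [F] it satisfies the relation with coefficients
    [- u, 1], so it is already dependent over [K]. *)
Lemma regular_algebraic (K F : fieldType) (e : {rmorphism K -> F}) u :
  regular e -> algebraicOver e u -> exists c, u = e c.
Proof.
move=> [C [j [_ _ disj]]] [p np pu].
pose c (i : 'I_2) : C := if i == 0 then 1 else j u.
have algc i : algebraicOver (j \o e) (c i).
  rewrite /c; case: eqP => _; first exact: algebraic1.
  exists p => //; rewrite map_poly_comp; move: pu; rewrite !rootE horner_map.
  by move=> /eqP ->; rewrite rmorph0.
have sum2 (R : nzRingType) (a : 'I_2 -> R) : \sum_i a i = a 0 + a 1.
  by rewrite big_ord_recl big_ord1; congr (_ + a _); apply: val_inj.
have [indep|] := pselect (forall a : 'I_2 -> K,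
    \sum_i j (e (a i)) * c i = 0 -> forall i, a i = 0).
  have := disj _ c algc indep (fun i => if i == 0 then - u else 1).
  rewrite sum2 /c /= rmorphN rmorph1 mulr1 mul1r addNr => /(_ erefl 1) /=.
  by move=> /eqP; rewrite oner_eq0.
move=> /existsNP[a /not_implyP[+ nall]]; rewrite sum2 /c /= mulr1 -rmorphM -rmorphD.
move=> /eqP; rewrite fmorph_eq0 => /eqP a0; have [a10|na1] := eqVneq (a 1) 0.
  case: nall => i; move: a0; rewrite a10 rmorph0 mul0r addr0 => /eqP.
  rewrite fmorph_eq0 => /eqP a00; have [->//|] := eqVneq i 0.
  by case: i => [[|[|]]] //= H _; rewrite -[RHS]a10; congr a; apply: val_inj.
exists (- a 0 / a 1); rewrite fmorph_div rmorphN.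
have ne : e (a 1) != 0 by rewrite fmorph_eq0.
apply: (canRL (mulfK ne)); apply/eqP; rewrite eq_sym -subr_eq0 -opprD oppr_eq0 mulrC.
by rewrite a0.
Qed.

Lemma relation_of_algebraic (K G F : fieldType) (e : {rmorphism K -> F}) d
    (t : 'I_d -> F) (v : {rmorphism G -> F}) u :
    (forall g, in_gen e t (v g)) -> algebraicOver v u ->
  exists2 g, g != 0 & mmap e (snoc t u) g = 0.
Proof.
move=> vgen [p np pu].
have [b [x [nb xb]]] := @common_denominator _ _ (mmap e t) (size p)
  (fun i => v p`_i) (fun i => vgen p`_i).
pose q := \poly_(i < size p) (if insub i is Some k then x k else 0).
have qE : map_poly (mmap e t) q = mmap e t b *: map_poly v p.
  apply/polyP => k; rewrite coefZ !coef_map coef_poly; case: ltnP => [lt|le].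
    by rewrite insubT /= -xb mulrC.
  have -> : p`_k = 0 by apply: nth_default.
  by rewrite !raddf0 mulr0.
exists (poly_last q).
  apply: contra_neq np => q0.
  have q00 : q = 0 by rewrite -[q]poly_lastK q0 muni0.
  move: qE; rewrite q00 map_poly0 => /esym/eqP; rewrite scaler_eq0 (negPf nb) /=.
  by rewrite map_poly_eq0 => /eqP.
rewrite mmap_muni snoc_comp_wid snoc_max poly_lastK qE hornerZ.
by rewrite (rootP pu) mulr0.
Qed.

Lemma in_gen_horner (K G F : fieldType) (e : {rmorphism K -> F}) n (z : 'I_n -> F)
    (v : {rmorphism G -> F}) (q : {poly G}) w :
  (forall g, in_gen e z (v g)) -> in_gen e z w -> in_gen e z (map_poly v q).[w].
Proof.
have [G' [v' [th [vE _]]]] := exists_gen_field e z.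
move=> vgen /vE[w' <-]; have [c cE] := choice (fun g => (vE _).1 (vgen g)).
apply/vE; exists (\sum_(i < size (map_poly v q)) c q`_i * w' ^+ i).
rewrite rmorph_sum horner_coef; apply: eq_bigr => i _.
by rewrite rmorphM rmorphXn cE coef_map.
Qed.

(** Hence a nonzero derivative of a minimal relation does not vanish at the point: it would be a
    smaller relation. *)
Lemma msize_mderiv_lt (K : fieldType) n i (f : {mpoly K[n]}) :
  f != 0 -> (msize f^`M(i) < msize f)%N.
Proof.
rewrite -msize_poly_eq0 -lt0n => sf; rewrite -(prednK sf) ltnS mmeasureE.
apply/bigmax_leqP_seq => m + _; rewrite mcoeff_msupp mcoeff_mderiv => nfm.
have : (m + U_(i))%MM \in msupp f.
  by rewrite mcoeff_msupp; apply: contraNneq nfm => ->; rewrite mul0rn.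
move=> /msize_mdeg_lt; rewrite mdegD mdeg1 addn1.
by rewrite -{1}(prednK sf) ltnS.
Qed.

(* A finitely generated regular extension is the function field of a hypersurface:
   the generators are merged one at a time with the primitive element theorem, each
   step being followed by a reordering that restores separability. *)
Lemma hypersurface_model (K F : fieldType) (e : {rmorphism K -> F}) m (x : 'I_m -> F) :
  regular e -> exists d (z : 'I_d.+1 -> F) f,
    [/\ algebraically_independent e (z \o @wid d), minimal_relation e z f,
        f^`M(ord_max) != 0 & forall i, in_gen e z (x i)].
Proof.
move=> reg; elim: m x => [|m IH] x.
  have indep0 : algebraically_independent e ((fun=> 0 : F) : 'I_0 -> F).
    move=> q; have -> : q = (q@_0%MM)%:MP := nvar0_mpolyC q.
    by rewrite mmapC => /eqP; rewrite fmorph_eq0 => /eqP ->; rewrite mpolyC0.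
  have [||s [f [indep minf df]]] := @separable_reordering K F e 0 (fun=> 0) 'X_0 reg indep0.
  - by rewrite -msize_poly_eq0 mmeasureX.
  - by rewrite mmapX mmap1U.
  by exists 0%N, ((fun=> 0) \o s), f; split=> // [[]].
have [d [z [f [indep minf df genx]]]] := IH (x \o @wid m).
set t := z \o @wid d in indep; pose y := z ord_max; pose u := x ord_max.
have zE : z = snoc t y.
  by apply: funext; apply: ord_last_ind => [i|]; rewrite ?snoc_wid ?snoc_max.
(* Only the new element [u] has to be merged with [z]; the earlier generators follow by
   transitivity. *)
suff [d' [z' [f' [indep' minf' df' [genz genu]]]]] : exists d' (z' : 'I_d'.+1 -> F) f',
    [/\ algebraically_independent e (z' \o @wid d'), minimal_relation e z' f',
      f'^`M(ord_max) != 0 & (forall i, in_gen e z' (z i)) /\ in_gen e z' u].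
  exists d', z', f'; split=> //; apply: ord_last_ind => [i|//].
  exact: in_gen_trans genz (genx i).
have reorder d' (z' : 'I_d'.+1 -> F) g : algebraically_independent e (z' \o @wid d') ->
    g != 0 -> mmap e z' g = 0 -> (forall i, in_gen e z' (z i)) -> in_gen e z' u ->
    exists d' (z' : 'I_d'.+1 -> F) f',
    [/\ algebraically_independent e (z' \o @wid d'), minimal_relation e z' f',
      f'^`M(ord_max) != 0 & (forall i, in_gen e z' (z i)) /\ in_gen e z' u].
  move=> indep' ng gz genz genu.
  have [s [f' [H1 H2 H3]]] := separable_reordering reg indep' ng gz.
  have gens a : in_gen e z' a -> in_gen e (z' \o s) a.
    apply: in_gen_trans => i; have := in_gen_var e (z' \o s) (s^-1%g i).
    by rewrite /= permKV.
  by exists d', (z' \o s), f'; split=> //; split=> [i|]; apply: gens.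
have [G [v [th [vE thE]]]] := exists_gen_field e t.
have vgen g : in_gen e t (v g) by apply/vE; exists g.
have evth g : map_poly v (map_poly th g) = map_poly (mmap e t) g.
  by apply/polyP => k; rewrite !coef_map /= thE.
have nevt g : g != 0 -> map_poly th g != 0.
  apply: contra_neq => g0; apply/polyP => k; rewrite coef0; apply: indep.
  by rewrite -thE -coef_map g0 coef0 rmorph0.
have [[g ng gu]|transc] := pselect (exists2 g, g != 0 & mmap e (snoc t u) g = 0).
  have algu : algebraicOver v u.
    exists (map_poly th (muni g)).
      by apply: nevt; apply: contra_neq ng => g0; rewrite -[g]muniK g0 raddf0.
    rewrite evth rootE; apply/eqP; rewrite -[RHS]gu mmap_muni.
    by rewrite snoc_comp_wid snoc_max.
  (* The primitive element theorem needs infinitely many scalars. For [d = 0] the base field may be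
     finite, but then [u] is algebraic over [K], hence in [K] by regularity. *)
  have [d0|d_pos] := posnP d.
    have algt P : algebraicOver e (mmap e t P).
      by apply: algebraic_mmap => i; case: i => i lti; exfalso; rewrite d0 in lti.
    have [|c uc] := @regular_algebraic _ _ e u reg.
      have [p np pu] := algu; apply: (algebraic_root _ _ pu) => [|k].
        by rewrite map_poly_eq0.
      rewrite coef_map /=; have [P [Q [_ ->]]] := vgen p`_k.
      exact: algebraic_div.
    exists d, z, f; split=> //; split=> [i|]; first exact: in_gen_var.
    by rewrite uc; apply: in_gen_const.
  have [nf fz minz] := minf.
  have [||q qy sepq] := @separable_annihilator G F v (map_poly th (muni f)) y.
  - rewrite evth rootE; apply/eqP; rewrite -[RHS]fz [RHS]mmap_muni //.
  - rewrite -deriv_map evth deriv_map -muni_mderiv rootE.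
    have -> : (map_poly (mmap e t) (muni f^`M(ord_max))).[y] = mmap e z f^`M(ord_max).
      by rewrite [RHS]mmap_muni.
    by apply/eqP => /(minz _ df); rewrite leqNgt msize_mderiv_lt.
  have [p np pu] := algu.
  have [r nr rP] := large_field_PET np pu qy sepq.
  (* The powers of an independent variable are pairwise distinct, so one of them avoids the finitely
     many bad scalars, the roots of [r]. *)
  have [s nrs] : exists s, ~~ root r (v s).
    pose pw k : {mpoly K[d]} := 'X_(Ordinal d_pos) ^+ k.
    apply: contrapT => no; pose rs := mkseq (fun k => v (th (pw k))) (size r).
    have := @max_poly_roots _ r rs nr; rewrite size_mkseq ltnn => H.
    have /H{}H : all (root r) rs.
      apply/allP => _ /mapP[k _ ->]; apply: contraT => nk; case: no.
      by exists (th (pw k)).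
    have /H // : uniq rs.
    rewrite mkseq_uniq // => k l; rewrite !thE => /eqP.
    rewrite -subr_eq0 -rmorphB => /eqP/indep/eqP; rewrite subr_eq0 /pw !mpolyXn.
    move=> /eqP/(congr1 (fun p : {mpoly K[d]} => msize p)).
    by rewrite !mmeasureX => -[] /=; rewrite !mdegMn !mdeg1 !mul1n.
  have [[qu quE] [qy' qyE]] := rP s nrs; set w := v s * y - u in quE qyE.
  have algw : algebraicOver v w.
    apply: algebraic_sub => //; apply: algebraic_mul; first exact: algebraic_id.
    by exists q => //; apply: separable_poly_neq0.
  have [g' ng' g'w] := relation_of_algebraic vgen algw.
  have gent a : in_gen e t a -> in_gen e (snoc t w) a.
    by apply: in_gen_trans => i; rewrite -(snoc_wid t w i); apply: in_gen_var.
  have genw : in_gen e (snoc t w) w.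
    by rewrite -{2}(snoc_max t w); apply: in_gen_var.
  have genv g0 : in_gen e (snoc t w) (v g0) by apply: gent.
  apply: (reorder d (snoc t w) g') => //; first by rewrite snoc_comp_wid.
  - apply: ord_last_ind => [i|].
      by apply: gent; have := in_gen_var e t i.
    by rewrite -/y -qyE; apply: in_gen_horner.
  - by rewrite -quE; apply: in_gen_horner.
(* When [u] is transcendental over the field generated by [t], it joins the independent coordinates,
   and [f], rewritten with one more variable, still relates [y] to them. *)
have [nf fz minz] := minf.
pose tu := snoc t u; pose z' := snoc tu y.
have gen_tu i : in_gen e z' (tu i).
  by rewrite -(snoc_wid tu y i); apply: in_gen_var.
pose h : 'I_d.+1 -> {mpoly K[d.+2]} := snoc (fun i => 'X_(wid (wid i))) 'X_ord_max.
pose h' : 'I_d.+2 -> {mpoly K[d.+1]} :=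
  snoc (snoc (fun i => 'X_(wid i)) 0) 'X_ord_max.
apply: (reorder d.+1 z' (mmap (@mpolyC d.+2 K) h f)).
- rewrite snoc_comp_wid => g gu; apply/eqP; apply: contraT => ng.
  by case: transc; exists g.
- apply: contra_neq nf => /(congr1 (mmap (@mpolyC d.+1 K) h')); rewrite mmap0 => <-.
  apply: (mpoly_rmorph_ext (f := idfun) (g := mmap (@mpolyC d.+1 K) h' \o
    mmap (@mpolyC d.+2 K) h)) => [c|] /=; first by rewrite !mmapC.
  apply: ord_last_ind => [i|]; rewrite mmapX mmap1U /h ?snoc_wid ?snoc_max.
    by rewrite mmapX mmap1U /h' !snoc_wid.
  by rewrite mmapX mmap1U /h' snoc_max.
- rewrite -[RHS]fz.
  apply: (mpoly_rmorph_ext (f := mmap e z' \o mmap (@mpolyC d.+2 K) h)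
    (g := mmap e z)) => [c|] /=; first by rewrite !mmapC.
  apply: ord_last_ind => [i|]; rewrite mmapX mmap1U /h ?snoc_wid ?snoc_max.
    by rewrite !mmapX !mmap1U /z' snoc_wid /tu snoc_wid.
  by rewrite !mmapX !mmap1U /z' snoc_max.
- apply: ord_last_ind => [i|].
    by have := gen_tu (wid i); rewrite /tu snoc_wid.
  by rewrite -/y -(snoc_max tu y); apply: in_gen_var.
- by have := gen_tu ord_max; rewrite /tu snoc_max.
Qed.

(** * Regularity of function fields *)

Lemma algebraic_mmap_coef (K L E : fieldType) (l : {rmorphism L -> E})
    (e : {rmorphism K -> E}) n (z : 'I_n -> E) (P : {mpoly K[n]}) :
    (forall c, algebraicOver l (e c)) -> (forall i, algebraicOver l (z i)) ->
  algebraicOver l (mmap e z P).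
Proof.
move=> alge algz; rewrite /mmap; apply: big_ind => [|x y|m _];
  [exact: algebraic0|exact: algebraic_add|].
apply: algebraic_mul => //.
rewrite /mmap1; apply: big_ind => [|x y|i _]; [exact: algebraic1|exact: algebraic_mul|].
elim: (m i) => [|k IH]; first by rewrite expr0; apply: algebraic1.
by rewrite exprS; apply: algebraic_mul.
Qed.

(** Induction on [d]: a relation over the algebraic extension makes the last coordinate algebraic
    over the field generated over [K] by the others. *)
Lemma independent_algebraic_base (K k C : fieldType) (e : {rmorphism K -> C})
    (v : {rmorphism k -> C}) d (t : 'I_d -> C) :
    (forall c, algebraicOver e (v c)) -> algebraically_independent e t ->
  algebraically_independent v t.
Proof.
move=> algv; elim: d t => [|d IH] t indep q.
  have -> : q = (q@_0%MM)%:MP := nvar0_mpolyC q.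
  by rewrite mmapC => /eqP; rewrite fmorph_eq0 => /eqP ->; rewrite mpolyC0.
have indep' : algebraically_independent e (t \o @wid d).
  by move=> g; rewrite -mmap_wid => /indep/(congr1 (@muni d K)); rewrite muni_mwiden muni0 => /eqP;
    rewrite polyC_eq0 => /eqP.
have {}IH := IH _ indep'; rewrite mmap_muni => qt.
apply/eqP; apply: contraT => nq.
have np : map_poly (mmap v (t \o @wid d)) (muni q) != 0.
  apply: contra_neq nq => p0; rewrite -[q]muniK.
  suff -> : muni q = 0 by rewrite raddf0.
  apply/polyP => i; rewrite coef0; apply: IH.
  by have := congr1 (fun p : {poly C} => p`_i) p0; rewrite coef_map coef0.
have [G [vG [th [vE _]]]] := exists_gen_field e (t \o @wid d).
have [||g ng] := @relation_of_algebraic K G C e d (t \o @wid d) vG (t ord_max).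
- by move=> g; apply/vE; exists g.
- apply: (algebraic_root np); last by apply/eqP.
  move=> i; rewrite coef_map; apply: algebraic_mmap_coef => [c|l].
    have [p np' pc] := algv c; apply: (algebraic_root _ _ pc); first by rewrite map_poly_eq0.
    move=> l; rewrite coef_map /=; have [g <-] := (vE _).1 (in_gen_const e (t \o @wid d) p`_l).
    exact: algebraic_id.
  have [g <-] := (vE _).1 (in_gen_var e (t \o @wid d) l); exact: algebraic_id.
have -> : snoc (t \o @wid d) (t ord_max) = t.
  by apply: funext; apply: ord_last_ind => [i|]; rewrite ?snoc_wid ?snoc_max.
by move=> /indep g0; rewrite g0 eqxx in ng.
Qed.

Lemma size_dvd_eq0 (R : idomainType) (p r : {poly R}) :
  (size r < size p)%N -> rdvd p r -> r = 0.
Proof.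
move=> lt [q E]; apply/eqP; apply: contraTT lt => nr; rewrite -leqNgt E.
have nq : q != 0 by apply: contra_neq nr => q0; rewrite E q0 mul0r.
have np : p != 0 by apply: contra_neq nr => p0; rewrite E p0 mulr0.
by rewrite size_mul //; move: nq; rewrite -size_poly_gt0;
  move: (size p) (size q) => a b; lia.
Qed.

(** A single multiplier [L] serves all the [x i], so that a linear combination of them can be
    divided term by term. *)
Lemma common_pseudo_division (R : idomainType) (p : {poly R}) n (x : 'I_n -> {poly R}) :
    p != 0 ->
  exists L q r, L != 0 /\
    forall i, L%:P * x i = q i * p + r i /\ (size (r i) < size p)%N.
Proof.
move=> np; pose L := \prod_i lead_coef p ^+ scalp (x i) p.
pose L' i := \prod_(l | l != i) lead_coef p ^+ scalp (x l) p.
have lp : lead_coef p != 0 by rewrite lead_coef_eq0.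
exists L, (fun i => (L' i)%:P * (x i %/ p)), (fun i => (L' i)%:P * (x i %% p)); split.
  by apply/prodf_neq0 => i _; apply: expf_neq0.
move=> i; have nL' : L' i != 0 by apply/prodf_neq0 => l _; apply: expf_neq0.
rewrite size_Cmul //; split; last exact: ltn_modpN0.
rewrite -mulrA -mulrDr -Pdiv.Idomain.divp_eq -mul_polyC mulrA -polyCM.
by congr (_%:P * _); rewrite /L (bigD1 i) //= mulrC.
Qed.

Fact division_combination (R : comNzRingType) (L g x q r p : R) :
  L * x = q * p + r -> L * (g * x) = g * r + g * q * p.
Proof. by move=> E; rewrite mulrCA E; ring. Qed.

(** Over the relative algebraic closure [k] of [K] in [C], [f] stays irreducible and [z] generic. A
    relation between the [c i] becomes a combination of polynomials divisible by [f], whose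
    remainder is too small to be a nonzero multiple of [f]. Independence over [K] kills each
    remainder coefficient by coefficient, so every numerator vanishes at [z]. *)
Lemma generic_disjoint (K E C : fieldType) (e : {rmorphism K -> E})
    (j : {rmorphism E -> C}) d (f : {mpoly K[d.+1]}) (z : 'I_d.+1 -> E) :
    abs_irreducible f -> (1 < size (muni f))%N -> generic_point e f z ->
    generated_by e z ->
  forall (n : nat) (c : 'I_n -> C),
    (forall i, algebraicOver (j \o e) (c i)) ->
    (forall a : 'I_n -> K, \sum_i j (e (a i)) * c i = 0 -> forall i, a i = 0) ->
    forall a : 'I_n -> E, \sum_i j (a i) * c i = 0 -> forall i, a i = 0.
Proof.
move=> irf sf [indep fz] genz n c algc indc a ac0.
have Sclosed : divring_closed [pred x : C | `[< algebraicOver (j \o e) x >]].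
  split; first by apply/asboolP; apply: algebraic1.
    by move=> x y /asboolP ? /asboolP ?; apply/asboolP; apply: algebraic_sub.
  by move=> x y /asboolP ? /asboolP ?; apply/asboolP; apply: algebraic_div.
have [k [v vE]] := exists_subfield Sclosed.
have vE' x : algebraicOver (j \o e) x <-> exists g, v g = x.
  by rewrite -vE; split=> [?|/asboolP //]; apply/asboolP.
have algv x : algebraicOver (j \o e) (v x) by apply/vE'; exists x.
have [x|kap kapE] := @rmorph_factor _ _ _ v (j \o e) (fmorph_inj v).
  by apply/vE'/algebraic_id.
have [gam gamE] := choice (fun i => (vE' _).1 (algc i)).
pose fk := map_mpoly kap f; pose zc := j \o z.
have irk : irreducible_elt fk.
  exact/abs_irreducible_elt/abs_irreducible_map.
have sk : (1 < size (muni fk))%N by rewrite size_muni_map_mpoly.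
have ev P : mmap v zc (map_mpoly kap P) = j (mmap e z P).
  by rewrite mmap_map_mpoly rmorph_mmap; apply: mmap_ext => // x /=; rewrite kapE.
have fkz : mmap v zc fk = 0 by rewrite ev fz rmorph0.
have indk : algebraically_independent v (zc \o @wid d).
  apply: (independent_algebraic_base algv) => q q0; apply: indep.
  by apply: (fmorph_inj j); rewrite rmorph0 rmorph_mmap.
have [b [x [nb xb]]] := @common_denominator _ _ (mmap e z) n a (fun i => genz (a i)).
have nmf : muni f != 0 by rewrite -size_poly_gt0 ltnW.
have [L [q [r [nL div]]]] := common_pseudo_division (fun i => muni (x i)) nmf.
pose mk : {poly {mpoly K[d]}} -> {poly {mpoly k[d]}} := map_poly (map_mpoly kap).
have mkD p1 p2 : mk (p1 + p2) = mk p1 + mk p2 by apply: rmorphD.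
have mkM p1 p2 : mk (p1 * p2) = mk p1 * mk p2 by apply: rmorphM.
pose B := \sum_i gam i *: map_mpoly kap (x i).
have Bz : mmap v zc B = 0.
  rewrite /B raddf_sum /=.
  transitivity ((\sum_i j (a i) * c i) * j (mmap e z b)); last by rewrite ac0 mul0r.
  rewrite mulr_suml; apply: eq_bigr => i _.
  by rewrite mmapZ gamE ev -xb rmorphM /=; ring.
have /rdvd_muni dvdB := (mmap_generic B irk sk indk fkz).1 Bz.
pose rr := \sum_i (gam i)%:MP%:P * mk (r i).
have mkf : mk (muni f) = muni fk by rewrite /mk -muni_map_mpoly.
have rr0 : rr = 0.
  apply: (@size_dvd_eq0 _ (muni fk)).
    rewrite size_muni_map_mpoly -(prednK (ltnW sf)) ltnS.
    apply: (leq_trans (size_sum _ _ _)); apply/bigmax_leqP => i _.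
    rewrite mul_polyC; apply: (leq_trans (size_scale_leq _ _)).
    apply: (@leq_trans (size (r i))); first by rewrite size_poly.
    by have [_] := div i; rewrite -{1}(prednK (ltnW sf)) ltnS.
  have BE : muni B = \sum_i (gam i)%:MP%:P * mk (muni (x i)).
    rewrite /B raddf_sum; apply: eq_bigr => i _.
    by rewrite /= muniZ mul_polyC /mk -muni_map_mpoly.
  have -> : rr = mk L%:P * muni B - (\sum_i (gam i)%:MP%:P * mk (q i)) * muni fk.
    apply/eqP; rewrite eq_sym subr_eq BE mulr_sumr mulr_suml -big_split; apply/eqP.
    apply: eq_bigr => i _; have [E0 _] := div i.
    by apply: division_combination; rewrite -mkM E0 mkD mkM mkf.
  apply: rdvdD; first exact: rdvd_mull.
  by apply/rdvdN/rdvd_mull; exists 1; rewrite mul1r.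
have r0 i : r i = 0.
  apply/polyP => l; rewrite coef0; apply/mpolyP => m; rewrite mcoeff0.
  apply: (indc (fun i => (r i)`_l@_m)).
  have := congr1 (fun p : {poly {mpoly k[d]}} => v p`_l@_m) rr0.
  rewrite /rr coef0 mcoeff0 rmorph0 coef_sum raddf_sum rmorph_sum => E0.
  rewrite -[RHS]E0.
  apply: eq_bigr => i' _; rewrite coefCM /mk coef_map /= mcoeffCM mcoeff_map_mpoly.
  by rewrite rmorphM /= gamE kapE mulrC.
move=> i; have [+ _] := div i; rewrite r0 addr0 => E0.
have xz : mmap e z (x i) = 0.
  have [ep [epM epm epC]] : exists ep : {poly {mpoly K[d]}} -> E,
      [/\ forall p1 p2, ep (p1 * p2) = ep p1 * ep p2,
          forall P, ep (muni P) = mmap e z P &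
          forall c0, ep c0%:P = mmap e (z \o @wid d) c0].
    exists (fun p => (map_poly (mmap e (z \o @wid d)) p).[z ord_max]); split=> [p1 p2|P|c0].
    - by rewrite rmorphM hornerM.
    - by rewrite [RHS]mmap_muni.
    - by rewrite map_polyC hornerC.
  have E1 : ep L%:P * ep (muni (x i)) = ep (q i) * ep (muni f) by rewrite -epM E0 epM.
  have E2 := etrans E1 (etrans (congr1 ( *%R (ep (q i))) (etrans (epm f) fz)) (mulr0 _)).
  have := etrans (congr2 *%R (esym (epC L)) (esym (epm (x i)))) E2 => /eqP.
  by rewrite mulf_eq0 => /orP[/eqP/indep L0|/eqP//]; rewrite L0 eqxx in nL.
by have := xb i; rewrite /= xz => /eqP; rewrite mulf_eq0 (negPf nb) orbF => /eqP.
Qed.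

(** * Products and ultraproducts of fields *)

Section ProductRing.

Variables (J : Type) (j0 : J) (E : J -> fieldType).

(** The argument [j0] witnesses that the index type is inhabited, as [1 != 0] requires. *)
Definition prod_ring of J : Type := forall j, E j.
Local Notation P := (prod_ring j0).

HB.instance Definition _ := gen_eqMixin P.
HB.instance Definition _ := gen_choiceMixin P.

Let zero : P := fun=> 0.
Let opp (x : P) : P := fun j => - x j.
Let add (x y : P) : P := fun j => x j + y j.
Let one : P := fun=> 1.
Let mul (x y : P) : P := fun j => x j * y j.

Fact prod_addA : associative add.
Proof. by move=> x y z; apply: functional_extensionality_dep => j; apply: addrA. Qed.
Fact prod_addC : commutative add.
Proof. by move=> x y; apply: functional_extensionality_dep => j; apply: addrC. Qed.
Fact prod_add0 : left_id zero add.
Proof. by move=> x; apply: functional_extensionality_dep => j; apply: add0r. Qed.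
Fact prod_addN : left_inverse zero opp add.
Proof. by move=> x; apply: functional_extensionality_dep => j; apply: addNr. Qed.
Fact prod_mulA : associative mul.
Proof. by move=> x y z; apply: functional_extensionality_dep => j; apply: mulrA. Qed.
Fact prod_mulC : commutative mul.
Proof. by move=> x y; apply: functional_extensionality_dep => j; apply: mulrC. Qed.
Fact prod_mul1 : left_id one mul.
Proof. by move=> x; apply: functional_extensionality_dep => j; apply: mul1r. Qed.
Fact prod_mulD : left_distributive mul add.
Proof. by move=> x y z; apply: functional_extensionality_dep => j; apply: mulrDl. Qed.

HB.instance Definition _ := GRing.isZmodule.Build P prod_addA prod_addC prod_add0 prod_addN.

Fact prod_one_neq0 : (one : P) != 0.
Proof.
apply/eqP => /(congr1 (fun x : P => x j0)) E10.
by have := oner_neq0 (E j0); rewrite -[1]/(one j0) E10 eqxx.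
Qed.

HB.instance Definition _ := GRing.Zmodule_isComNzRing.Build P
  prod_mulA prod_mulC prod_mul1 prod_mulD prod_one_neq0.

Definition prod_proj j (x : P) : E j := x j.

Fact prod_proj_additive j : additive (prod_proj j).
Proof. by []. Qed.
Fact prod_proj_multiplicative j : multiplicative (prod_proj j).
Proof. by []. Qed.

HB.instance Definition _ j := GRing.isAdditive.Build P (E j) (prod_proj j)
  (prod_proj_additive j).
HB.instance Definition _ j := GRing.isMultiplicative.Build P (E j) (prod_proj j)
  (prod_proj_multiplicative j).

Lemma prod_rmorph (R : nzRingType) (f : forall j, {rmorphism R -> E j}) :
  exists h : {rmorphism R -> P}, forall x j, h x j = f j x.
Proof.
pose h (x : R) : P := fun j => f j x.
have hB : additive h.
  by move=> x y; apply: functional_extensionality_dep => j; apply: rmorphB.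
have hM : multiplicative h.
  by split=> [x y|]; apply: functional_extensionality_dep => j; [apply: rmorphM|apply: rmorph1].
pose hm : {rmorphism R -> P} := HB.pack h
  (GRing.isAdditive.Build R P h hB) (GRing.isMultiplicative.Build R P h hM).
by exists hm.
Qed.

Lemma ultraproduct_field (U : (J -> Prop) -> Prop) : @filter.UltraFilter J U ->
  exists (N : fieldType) (c : {rmorphism P -> N}),
    forall x, c x = 0 <-> U (fun j => x j = 0).
Proof.
move=> UU; pose I : {pred P} := fun x => `[< U (fun j => x j = 0) >].
have IP x : reflect (U (fun j => x j = 0)) (x \in I) by apply: asboolP.
have Iid : idealr_closed I.
  split.
  - by apply/IP; apply: ultraS (ultraT UU).
  - by apply/IP => /(ultra_ex UU)[j]; apply/eqP; apply: (oner_neq0 (E j)).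
  move=> a x y /IP Ux /IP Uy; apply/IP; apply: ultraS (ultraI UU Ux Uy) => j [xj yj].
  by rewrite -[LHS]/(a j * x j + y j) xj yj mulr0 addr0.
have Ipr : prime_idealr_closed I.
  move=> x y /IP Uxy; suff : U (fun j => x j = 0) \/ U (fun j => y j = 0).
    by case=> ?; apply/orP; [left|right]; apply/IP.
  apply/(ultraU UU); apply: ultraS Uxy => j /eqP.
  by rewrite -[(x * y) j]/(x j * y j) mulf_eq0 => /orP[] /eqP; [left|right].
have [N [c [c0 _]]] := prime_ideal_field Iid Ipr.
by exists N, c => x; rewrite c0; split=> /IP.
Qed.

End ProductRing.

(** * Splitting fields and algebraic closures *)

Definition splits_over (F E : fieldType) (i : F -> E) (p : {poly F}) : Prop :=
  exists (c : E) (n : nat) (r : 'I_n -> E), map_poly i p = c *: \prod_k ('X - (r k)%:P).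

Lemma exists_root_extension (F : fieldType) (p : {poly F}) : (1 < size p)%N ->
  exists (E : fieldType) (i : {rmorphism F -> E}) x, root (map_poly i p) x.
Proof.
move=> sp; pose Q n := `[< exists q, [/\ q %| p, (1 < size q)%N & size q = n] >].
have exQ : exists n, Q n by exists (size p); apply/asboolP; exists p.
have [k /asboolP[q [qp sq sqk]] mink] := ex_minnP exQ.
have irq : irreducible_poly q.
  split=> // d sd dq; rewrite -dvdp_size_eqp // eqn_leq dvdp_leq //=; last first.
    by rewrite -size_poly_gt0 ltnW.
  rewrite sqk; apply: mink; apply/asboolP; exists d; split=> //.
    exact: dvdp_trans qp.
  have : d != 0 by apply: contraTneq dq => ->; rewrite dvd0p -size_poly_gt0 ltnW.
  by rewrite -size_poly_gt0; move: sd; case: (size d) => [|[]].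
have [L _ [z rz _]] := irredp_FAdjoin irq.
exists L, (in_alg L), z; have /dvdpP[r ->] := qp.
by rewrite rmorphM rootM rz orbT.
Qed.

Lemma exists_splitting_extension (F : fieldType) (p : {poly F}) :
  exists (E : fieldType) (i : {rmorphism F -> E}), splits_over i p.
Proof.
have [n] := ubnP (size p); elim: n F p => // n IH F p; rewrite ltnS => sn.
have [sp|sp] := leqP (size p) 1.
  exists F, idfun, (p`_0), 0%N, (fun=> 0); rewrite big_ord0 map_poly_id //.
  by rewrite {1}(size1_polyC sp) alg_polyC.
have [E [i [x rx]]] := exists_root_extension sp.
have [q qE] := factor_theorem _ _ rx.
have sq : (size q < n)%N.
  have np : map_poly i p != 0 by rewrite map_poly_eq0 -size_poly_gt0 ltnW.
  have nq : q != 0 by apply: contra_neq np => q0; rewrite qE q0 mul0r.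
  apply: leq_trans sn; rewrite -(size_map_poly i p) qE size_Mmonic ?monicXsubC //.
  by rewrite size_XsubC addn2.
have [E' [i' [c [m [r rE]]]]] := IH E q sq.
exists E', (i' \o i), c, m.+1, (fun k => if unlift ord0 k is Some l then r l else i' x).
rewrite map_poly_comp qE rmorphM /= rE rmorphB /= map_polyX map_polyC /=.
rewrite big_ord_recl unlift_none mulrC -scalerAr; congr (_ *: (_ * _)).
by apply: eq_bigr => l _; rewrite liftK.
Qed.

Lemma splits_over_comp (F E E' : fieldType) (i : {rmorphism F -> E})
    (i' : {rmorphism E -> E'}) p :
  splits_over i p -> splits_over (i' \o i) p.
Proof.
move=> [c [n [r rE]]]; exists (i' c), n, (i' \o r).
rewrite map_poly_comp rE map_polyZ rmorph_prod; congr (_ *: _); apply: eq_bigr => k _.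
by rewrite rmorphB /= map_polyX map_polyC.
Qed.

Lemma exists_common_splitting_extension (F : fieldType) (l : seq {poly F}) :
  exists (E : fieldType) (i : {rmorphism F -> E}),
    forall p, List.In p l -> splits_over i p.
Proof.
elim: l => [|p l [E [i H]]]; first by exists F, idfun.
have [E' [i' sp]] := exists_splitting_extension (map_poly i p).
exists E', (i' \o i) => q [<-|/H]; last exact: splits_over_comp.
by have [c [n [r rE]]] := sp; exists c, n, r; rewrite map_poly_comp.
Qed.

(** A number of roots depending on [p] alone lets the factorizations in different fields be
    collected into one over their product. *)
Lemma splits_over_size (F E : fieldType) (i : {rmorphism F -> E}) (p : {poly F}) :
  splits_over i p -> exists (c : E) (r : 'I_(size p).-1 -> E),
    map_poly i p = c *: \prod_k ('X - (r k)%:P).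
Proof.
move=> [c [n [r rE]]]; have [->|np] := eqVneq p 0.
  by exists 0, (fun=> 0); rewrite scale0r raddf0.
suff nE : n = (size p).-1 by subst n; exists c, r.
have nip : map_poly i p != 0 by rewrite map_poly_eq0.
have nc : c != 0 by apply: contra_neq nip => c0; rewrite rE c0 scale0r.
rewrite -(size_map_poly i p) rE size_scale //.
have -> : \prod_k ('X - (r k)%:P) = \prod_(x <- [seq r k | k <- enum 'I_n]) ('X - x%:P).
  by rewrite big_map big_enum.
by rewrite size_prod_XsubC size_map size_enum_ord.
Qed.

(** An ultraproduct, indexed by finite lists of polynomials, of fields splitting the polynomials of
    the list. *)
Lemma exists_universal_splitting_extension (F : fieldType) :
  exists (E : fieldType) (i : {rmorphism F -> E}), forall p, splits_over i p.
Proof.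
have [U [UU UB]] := list_ultrafilter {poly F}.
have D l : exists Ei : {E : fieldType & {rmorphism F -> E}},
    forall p, List.In p l -> splits_over (projT2 Ei) p.
  by have [E [i H]] := exists_common_splitting_extension l; exists (existT _ E i).
have [Ei EiP] := choice D.
pose E l := projT1 (Ei l).
have [N [c c0]] := @ultraproduct_field _ ([::] : seq {poly F}) E U UU.
have [h hE] := @prod_rmorph _ ([::] : seq {poly F}) E F (fun l => projT2 (Ei l)).
exists N, (c \o h) => p.
have {}D l : exists cr : E l * ('I_(size p).-1 -> E l), List.In p l ->
    map_poly (projT2 (Ei l)) p = cr.1 *: \prod_k ('X - (cr.2 k)%:P).
  have [pl|] := pselect (List.In p l); last by exists (0, fun=> 0).
  by have [a [r H]] := splits_over_size (EiP l p pl); exists (a, r).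
pose cr l := projT1 (cid (D l)).
pose a : prod_ring E [::] := fun l => (cr l).1.
pose r k : prod_ring E [::] := fun l => (cr l).2 k.
pose Q := map_poly h p - a *: \prod_k ('X - (r k)%:P).
have Q0 : map_poly c Q = 0.
  apply/polyP => k; rewrite coef_map coef0; apply/c0.
  apply: ultraS (UB p) => l pl.
  have : map_poly (@prod_proj _ [::] E l) Q = 0.
    rewrite /Q rmorphB /= -map_poly_comp map_polyZ rmorph_prod.
    have -> : map_poly (@prod_proj _ [::] E l \o h) p = map_poly (projT2 (Ei l)) p.
      by apply: eq_map_poly => x; rewrite -hE.
    rewrite (projT2 (cid (D l)) pl) -/(cr l); apply/eqP; rewrite subr_eq0; apply/eqP.
    congr (_ *: _); apply: eq_bigr => k' _.
    by rewrite rmorphB /= map_polyX map_polyC.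
  by move=> /(congr1 (fun q : {poly E l} => q`_k)); rewrite coef_map coef0.
exists (c a), (size p).-1, (fun k => c (r k)).
move/eqP: Q0; rewrite rmorphB subr_eq0 /= -map_poly_comp => /eqP ->.
rewrite map_polyZ rmorph_prod; congr (_ *: _); apply: eq_bigr => k _.
by rewrite rmorphB /= map_polyX map_polyC.
Qed.

(** The algebraic elements of [E] form the closure: a root in a further extension is algebraic over
    [F], and a polynomial annihilating it has all its roots in [E] already. *)
Lemma exists_algebraic_closure (F : fieldType) :
  exists (C : fieldType) (i : {rmorphism F -> C}),
    GRing.closed_field_axiom C /\ forall x, algebraicOver i x.
Proof.
have [E [i isplit]] := exists_universal_splitting_extension F.
have Sclosed : divring_closed [pred x : E | `[< algebraicOver i x >]].
  split; first by apply/asboolP; apply: algebraic1.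
    by move=> x y /asboolP ? /asboolP ?; apply/asboolP; apply: algebraic_sub.
  by move=> x y /asboolP ? /asboolP ?; apply/asboolP; apply: algebraic_div.
have [C [v vE]] := exists_subfield Sclosed.
have vE' x : algebraicOver i x <-> exists g, v g = x.
  by rewrite -vE; split=> [?|/asboolP //]; apply/asboolP.
have [x|k kE] := @rmorph_factor _ _ _ v i (fmorph_inj v).
  by apply/vE'/algebraic_id.
have kalg x : algebraicOver k x.
  have [p np px] : algebraicOver i (v x) by apply/vE'; exists x.
  exists p => //; rewrite -(fmorph_root v) -map_poly_comp.
  by rewrite (eq_map_poly (g := i)).
exists C, k; split=> // n P n_gt0.
pose q : {poly C} := 'X^n - \poly_(l < n) P l.
have sq : size q = n.+1.
  rewrite size_polyDl size_polyXn // size_polyN ltnS; exact: size_poly.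
have [E' [i' [z rz]]] : exists (E' : fieldType) (i' : {rmorphism E -> E'}) z,
    root (map_poly i' (map_poly v q)) z.
  by apply: exists_root_extension; rewrite size_map_poly sq ltnS.
have [p np pz] : algebraicOver (i' \o i) z.
  apply: (algebraic_root _ _ rz); first by rewrite !map_poly_eq0 -size_poly_gt0 sq.
  move=> l; rewrite !coef_map /=.
  have [p np px] : algebraicOver i (v q`_l) by apply/vE'; exists q`_l.
  exists p => //; rewrite map_poly_comp; move: px; rewrite !rootE horner_map.
  by move=> /eqP ->; rewrite rmorph0.
have [a [m [r rE]]] := isplit p.
have [l zE] : exists l, z = i' (r l).
  move: pz; rewrite map_poly_comp rE map_polyZ rmorph_prod rootZ; last first.
    rewrite fmorph_eq0; apply: contra_neq np => a0.
    by apply/eqP; rewrite -(map_poly_eq0 i) rE a0 scale0r.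
  rewrite rootE horner_prod prodf_seq_eq0 => /hasP[l _] /=.
  rewrite rmorphB /= map_polyX map_polyC hornerXsubC subr_eq0 => /eqP ->.
  by exists l.
have rq : root (map_poly v q) (r l) by move: rz; rewrite zE fmorph_root.
have [x xE] : exists x, v x = r l.
  apply/vE'; apply: (algebraic_root _ _ rq); first by rewrite map_poly_eq0 -size_poly_gt0 sq.
  by move=> l'; rewrite coef_map; apply/vE'; exists q`_l'.
exists x; move: rq; rewrite -xE fmorph_root rootE /q hornerD hornerN hornerXn subr_eq0 => /eqP ->.
by rewrite horner_poly.
Qed.

Lemma generic_regular (K E : fieldType) (e : {rmorphism K -> E}) d
    (f : {mpoly K[d.+1]}) (z : 'I_d.+1 -> E) :
    abs_irreducible f -> (1 < size (muni f))%N -> generic_point e f z ->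
    generated_by e z ->
  regular e.
Proof.
move=> irf sf genf genz; have [C [j [Ccl jalg]]] := exists_algebraic_closure E.
exists C, j; split=> // n c algc indc; exact: (generic_disjoint irf sf genf genz algc indc).
Qed.

(** * Generic points in ultrapowers of large fields *)

Definition full_language (S : symbols) : language S := Language (fun=> True) (fun=> True).

Lemma formula_in_full (S : symbols) (phi : formula S) : formula_in (full_language S) phi.
Proof.
have full_term t : term_in (full_language S) t by elim: t => //=.
by elim: phi => //=.
Qed.

Lemma isomorphism_mono (S : symbols) (A : language S) (M N : structure S) (g : M -> N) :
  isomorphism (full_language S) M N g -> isomorphism A M N g.
Proof. by move=> [gbij emb]; split=> //; apply: embedding_mono emb. Qed.

Lemma isomorphism_sym (S : symbols) (A : language S) (M N : structure S) (g : M -> N) :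
  isomorphism A M N g -> exists h : N -> M, [/\ isomorphism A N M h, cancel g h & cancel h g].
Proof.
move=> iso; have [[h gK hK] emb] := iso; exists h; split=> //; split; first by exists g.
apply: embedding_of_sat => phi Aphi _ v Hv; apply/(sat_isomorphism _ iso Aphi).
by move: Hv; apply: (proj1 (sat_ext _)) => k _; rewrite hK.
Qed.

Lemma embedding_rmorphism (S : symbols) (A : language S) (K F : lfield S) (e : K -> F) :
  embedding A K F e -> exists e' : {rmorphism K -> F}, e' = e :> (K -> F).
Proof.
move=> [_ [e0 e1] [eD eN eM] _ _].
have eB : additive (e : lf_field K -> lf_field F).
  by move=> x y; apply: etrans (eD x (- y)) _; congr (_ + _); apply: eN.
have em : multiplicative (e : lf_field K -> lf_field F) by split.
pose e' : {rmorphism K -> F} := HB.pack (e : lf_field K -> lf_field F)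
  (GRing.isAdditive.Build K F (e : lf_field K -> lf_field F) eB)
  (GRing.isMultiplicative.Build K F (e : lf_field K -> lf_field F) em).
by exists e'.
Qed.

Lemma rmorphism_embedding (S : symbols) (K F : lfield S) (e : {rmorphism K -> F}) :
  embedding (ring_language S) K F e.
Proof.
split; [exact: fmorph_inj|by split; [exact: rmorph0|exact: rmorph1]| |by []|by []].
by split; [exact: rmorphD|exact: rmorphN|exact: rmorphM].
Qed.

(** [theory_of_large_fields] only provides a ring isomorphism; the other symbols of [N] are carried
    over to the same field, which keeps largeness. *)
Lemma transport_lfield (S : symbols) (K0 : lfield S) (N : structure S) (g : K0 -> N) :
  isomorphism (ring_language S) K0 N g ->
  exists (K : lfield S) (h : K -> N), lf_field K = lf_field K0 /\
    isomorphism (full_language S) K N h.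
Proof.
move=> [[g' gK g'K] [ginj g01 gops _ _]].
pose K := @LField S K0 (fun f x => g' (s_fun (fun i => g (x i))))
  (fun r x => s_rel (fun i => g (x i))).
exists K, g; split=> //; split; first by exists g'.
by split=> // f _ x; rewrite /= g'K.
Qed.

Lemma los_rmorphism (S : symbols) (J : Type) (j0 : J) (U : (J -> Prop) -> Prop)
    (M : J -> lfield S) (N : lfield S) (c : (forall j, M j) -> N) :
    @filter.UltraFilter J U ->
    (forall phi (v : nat -> forall j, M j),
      sat N (fun k => c (v k)) phi <-> U (fun j => sat (M j) (fun k => v k j) phi)) ->
  exists c' : {rmorphism prod_ring (fun j => lf_field (M j)) j0 -> N},
    (forall x, c' x = c x) /\ forall x, c' x = 0 <-> U (fun j => x j = 0).
Proof.
move=> UU los; pose X n := TVar S n.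
pose val (f g h : forall j, M j) n := nth h [:: f; g] n.
have tr phi f g h : (forall j, sat (M j) (fun k => val f g h k j) phi) ->
    sat N (fun k => c (val f g h k)) phi.
  by move=> H; apply/los; apply: ultraS (ultraT UU) => j _.
pose P := prod_ring (fun j => lf_field (M j)) j0.
pose cP : P -> N := c.
have cB : additive cP.
  move=> x y; have E1 : cP x = cP (x - y) + cP y.
    apply: (tr (FEq (X 2%N) (TAdd (X 0%N) (X 1%N))) (x - y : P) y x) => j /=.
    by rewrite -[LHS]/(x j) -[RHS]/((x j - y j) + y j) subrK.
  by rewrite E1 addrK.
have cM : multiplicative cP.
  split=> [x y|].
    by apply: (tr (FEq (X 2%N) (TMul (X 0%N) (X 1%N))) x y (x * y : P)) => j.
  by apply: (tr (FEq (X 0%N) (TOne S)) (1 : P) (1 : P) (1 : P)) => j.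
pose c' : {rmorphism P -> N} := HB.pack cP
  (GRing.isAdditive.Build P N cP cB) (GRing.isMultiplicative.Build P N cP cM).
exists c'; split=> // x.
have := los (FEq (X 0%N) (TZero S)) (fun=> x); exact.
Qed.

(* The generic point is the class of the identity in an ultrapower indexed by all
   tuples of [N]. *)
Lemma ultrapower_tuples (S : symbols) (X : Type) (N : lfield S)
    (B : ((X -> N) -> Prop) -> Prop) :
    (exists Y, B Y) -> (forall Y, B Y -> exists w, Y w) ->
    (forall Y Z, B Y -> B Z -> exists2 W, B W & forall w, W w -> Y w /\ Z w) ->
  exists (N' : lfield S) (H : N -> N') (z : X -> N'),
    [/\ forall phi (v : nat -> N), sat N v phi <-> sat N' (fun k => H (v k)) phi,
        (forall phi (s : nat -> N + X),
          (exists2 Y, B Y & forall w, Y w ->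
            sat N (fun k => match s k with inl m => m | inr x => w x end) phi) ->
          sat N' (fun k => match s k with inl m => H m | inr x => z x end) phi) &
        forall (K : fieldType) (a : {rmorphism K -> N}) n (x : 'I_n -> X) P Y, B Y ->
          ((forall w, Y w -> mmap a (fun i => w (x i)) P != 0) ->
            mmap (fun y => H (a y)) (fun i => z (x i)) P != 0) /\
          ((forall w, Y w -> mmap a (fun i => w (x i)) P = 0) ->
            mmap (fun y => H (a y)) (fun i => z (x i)) P = 0)].
Proof.
move=> Bex Bne Bdir; have [U [UU BU]] := ultra_extend Bex Bne Bdir.
have [N' [c [csurj los]]] := ultraproduct_lfield (fun=> N) UU.
exists N', (fun m => c (fun=> m)), (fun x => c (fun w => w x)); split.
- move=> phi v; rewrite (los phi (fun k _ => v k)); split=> [H|].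
    by apply: ultraS (ultraT UU).
  by move=> /(ultra_ex UU)[].
- move=> phi s [Y BY H].
  have -> : (fun k => match s k with inl m => c (fun=> m) | inr x => c (fun w => w x) end) =
      (fun k => c (fun w => match s k with inl m => m | inr x => w x end)).
    by apply: funext => k; case: (s k).
  by apply/los; apply: ultraS (BU Y BY).
move=> K a n x P Y BY; have [w0 _] := Bne Y BY.
have [c' [c'E c'0]] := los_rmorphism w0 UU los.
pose R := prod_ring (fun _ : X -> N => lf_field N) w0.
have [aR aRE] := @prod_rmorph _ w0 (fun _ : X -> N => lf_field N) K (fun=> a).
pose v := mmap aR (fun i => (fun w => w (x i)) : R) P.
have -> : mmap (fun y => c (fun=> a y)) (fun i => c (fun w => w (x i))) P = c' v.
  rewrite /v rmorph_mmap; apply: eq_bigr => m _; congr (_ * _).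
    rewrite /= c'E; congr c; apply: funext => w; exact: esym (aRE _ _).
  by apply: eq_bigr => i _; rewrite /= c'E.
have vE w : v w = mmap a (fun i => w (x i)) P.
  rewrite -[LHS]/(prod_proj w v) /v rmorph_mmap.
  by apply: mmap_ext => // y; rewrite /= /prod_proj aRE.
split=> H.
  apply/eqP => /c'0 U0; have [w [Yw /eqP]] := ultra_ex UU (ultraI UU (BU Y BY) U0).
  by rewrite vE; apply/negP/H.
by apply/c'0; apply: ultraS (BU Y BY) => w Yw; rewrite vE H.
Qed.

(** The filter base consists of the points of the hypersurface that avoid one nonzero [b]: nonempty
    by largeness, directed because [b * b'] combines two conditions. *)
Lemma dense_generic (S : symbols) (N : lfield S) (K : fieldType) (a : {rmorphism K -> N}) d
    (f : {mpoly K[d.+1]}) (y : 'I_d.+1 -> N) :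
    large N -> abs_irreducible f -> mmap a y f = 0 -> mmap a y f^`M(ord_max) != 0 ->
  exists (N' : lfield S) (H : {rmorphism N -> N'}) (z : 'I_d.+1 -> N'),
    (forall phi (v : nat -> N), sat N v phi <-> sat N' (fun k => H (v k)) phi) /\
    generic_point (H \o a) f z.
Proof.
move=> Nlarge irf fy dfy; pose fN := map_mpoly a f.
have irN : irreducible_elt fN by apply/abs_irreducible_elt/abs_irreducible_map.
pose B (Y : ('I_d.+1 -> N) -> Prop) := exists b : {mpoly N[d]}, b != 0 /\
  Y = (fun w => mmap a w f = 0 /\ b.@[w \o @wid d] != 0).
have [||| N' [H [z [el _ gen]]]] := @ultrapower_tuples S 'I_d.+1 N B.
- by exists (fun w => mmap a w f = 0 /\ (1 : {mpoly N[d]}).@[w \o @wid d] != 0), 1;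
    rewrite oner_neq0.
- move=> _ [b [nb ->]].
  have [||w [fw bw]] := @large_dense N d fN y b Nlarge irN _ _ nb.
  + by rewrite meval_map_mpoly.
  + by rewrite map_mpoly_mderiv meval_map_mpoly.
  by exists w; rewrite -meval_map_mpoly.
- move=> _ _ [b [nb ->]] [b' [nb' ->]].
  exists (fun w => mmap a w f = 0 /\ (b * b').@[w \o @wid d] != 0).
    by exists (b * b'); rewrite mulf_neq0.
  by move=> w [-> ]; rewrite mevalM mulf_eq0 negb_or => /andP[].
have Hel : elementary_embedding (full_language S) N N' H by move=> phi _; apply: el.
have [H' H'E] := embedding_rmorphism (elementary_embedding_embedding Hel).
exists N', H', z; split; first by rewrite H'E.
have B1 (b : {mpoly N[d]}) : b != 0 -> B (fun w => mmap a w f = 0 /\ b.@[w \o @wid d] != 0).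
  by move=> nb; exists b.
split.
- move=> q q0; apply/eqP; apply: contraT => nq.
  have nqa : map_mpoly a q != 0 by rewrite map_mpoly_eq0.
  have [Hne _] := gen K a d (@wid d) q _ (B1 _ nqa).
  suff : mmap (fun y => H (a y)) (fun i => z (wid i)) q != 0.
    by rewrite (_ : mmap _ _ q = 0) ?eqxx // -[RHS]q0 H'E.
  by apply: Hne => w []; rewrite meval_map_mpoly.
- have [_] := gen K a d.+1 id f _ (B1 1 (oner_neq0 _)).
  rewrite H'E; apply; by move=> w [].
Qed.

(** * Systems of equations on a hypersurface *)

(* Polynomials whose coefficients are integer multiples of parameters: the triple
   [(k, c, m)] stands for the term [(v k *+ c) *: 'X_[m]]. *)
Definition pdata (n : nat) : Type := seq (nat * nat * 'X_{1..n}).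

Definition poly_of (K : comNzRingType) n (s : pdata n) (v : nat -> K) : {mpoly K[n]} :=
  \sum_(q <- s) (v q.1.1 *+ q.1.2) *: 'X_[q.2].

(** The integer in a triple absorbs the exponents brought down by differentiation. *)
Definition pdata_deriv n (i : 'I_n) (s : pdata n) : pdata n :=
  [seq (q.1.1, (q.1.2 * q.2 i)%N, (q.2 - U_(i))%MM) | q : nat * nat * 'X_{1..n} <- s].

Definition pdata_below n (p : nat) (s : pdata n) : bool := all (fun q : nat * nat * 'X_{1..n} => q.1.1 < p)%N s.

Lemma poly_of_deriv (K : fieldType) n (i : 'I_n) s (v : nat -> K) :
  poly_of (pdata_deriv i s) v = (poly_of s v)^`M(i).
Proof.
rewrite /poly_of big_map; elim: s => [|q s IH]; first by rewrite !big_nil mderiv0.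
rewrite !big_cons mderivD IH mderivZ mderivX scalerA; congr (_ *: _ + _).
by rewrite mulrnA mulr_natr.
Qed.

Lemma poly_of_map (K E : comNzRingType) (e : {rmorphism K -> E}) n p (s : pdata n)
    (v : nat -> K) (w : nat -> E) :
  pdata_below p s -> (forall k, (k < p)%N -> w k = e (v k)) ->
  poly_of s w = map_mpoly e (poly_of s v).
Proof.
move=> sp we; rewrite /poly_of rmorph_sum; apply: eq_big_seq => q qs.
by rewrite /= map_mpolyZ map_mpolyX we ?rmorphMn // (allP sp).
Qed.

Lemma pdata_deriv_below n p (i : 'I_n) s : pdata_below p s -> pdata_below p (pdata_deriv i s).
Proof. by rewrite /pdata_below all_map. Qed.

Section Terms.

Variable S : symbols.
Implicit Types t : term S.

Definition tnat (c : nat) t := iter c (TAdd t) (TZero S).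
Definition tpow t (k : nat) := iter k (TMul t) (TOne S).
Definition tmon n (b : nat) (m : 'X_{1..n}) :=
  foldr (fun i : 'I_n => TMul (tpow (TVar S (b + i)) (m i))) (TOne S) (enum 'I_n).
Definition term_of n (b : nat) (s : pdata n) : term S :=
  foldr (fun q : nat * nat * 'X_{1..n} => TAdd (TMul (tnat q.1.2 (TVar S q.1.1)) (tmon b q.2))) (TZero S) s.

Lemma eval_term_of (E : lfield S) n b (s : pdata n) (w : nat -> E) :
  eval (M := E) w (term_of b s) = (poly_of s w).@[fun i => w (b + i)%N].
Proof.
rewrite /poly_of; elim: s => [|q s IH] /=; first by rewrite big_nil meval0.
rewrite big_cons mevalD IH mevalZ mevalX; congr (_ * _ + _).
  by elim: q.1.2 => [|c IHc] /=; rewrite ?mulr0n // IHc mulrS.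
rewrite /tmon -big_enum /=; elim: (enum 'I_n) => [|i l IHl] /=; first by rewrite big_nil.
rewrite big_cons IHl; congr (_ * _).
by elim: (q.2 i) => [|k IHk] /=; rewrite ?expr0 // IHk exprS.
Qed.

Lemma eval_term_of_mmap (K : fieldType) (E : lfield S) (e : {rmorphism K -> E}) n b p
    (s : pdata n) (v : nat -> K) (w : nat -> E) :
    pdata_below p s -> (forall k, (k < p)%N -> w k = e (v k)) ->
  eval (M := E) w (term_of b s) = mmap e (fun i => w (b + i)%N) (poly_of s v).
Proof. by move=> sp we; rewrite eval_term_of (poly_of_map sp we) meval_map_mpoly. Qed.

Lemma term_of_in n b (s : pdata n) (A : language S) : term_in A (term_of b s).
Proof.
elim: s => [|q s IH] //=; split=> //; split; first by elim: q.1.2.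
rewrite /tmon; elim: (enum 'I_n) => [|i l IHl] //=; split=> //.
by elim: (q.2 i).
Qed.

Lemma term_of_var n b p (s : pdata n) k : pdata_below p s -> (p <= b)%N ->
  term_var k (term_of b s) -> (k < b + n)%N.
Proof.
move=> sp pb; elim: s sp => [|q s IH] //= /andP[qp sp] [[|]|/(IH sp)//].
  by elim: q.1.2 => //= c IHc [->|//]; rewrite (leq_trans qp) // (leq_trans pb) ?leq_addr.
rewrite /tmon; elim: (enum 'I_n) => [|i l IHl] //= [|/IHl//].
by elim: (q.2 i) => //= c IHc [->|//]; rewrite ltn_add2l.
Qed.

End Terms.

(* A system of equations in the variables [x_0, ..., x_(hq D - 1)]: the first [hp D] are
   parameters, the next [hd D + 1] are the coordinates of a point of the hypersurface
   [hf D], the last of which depends on the others, and the remaining [hm D] are the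
   values of the rational functions [hP D l / hQ D l] at that point. *)
Record hdata := HData {
  hp : nat; hd : nat; hm : nat;
  hf : pdata hd.+1; hP : nat -> pdata hd.+1; hQ : nat -> pdata hd.+1 }.

Definition hq (D : hdata) : nat := (hp D + (hd D).+1 + hm D)%N.

Definition hwf (D : hdata) : Prop :=
  pdata_below (hp D) (hf D) /\
  forall l, pdata_below (hp D) (hP D l) /\ pdata_below (hp D) (hQ D l).

Section Hypersurface.

Variables (S : symbols) (D : hdata).
Local Notation p := (hp D).
Local Notation d := (hd D).
Local Notation m := (hm D).

Definition hzero : formula S := FEq (term_of S p (hf D)) (TZero S).
Definition hsmooth : formula S :=
  FAnd hzero (FNot (FEq (term_of S p (pdata_deriv ord_max (hf D))) (TZero S))).
Definition hfrac : formula S := conj_list [seq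
  FAnd (FEq (TMul (term_of S p (hQ D l)) (TVar S (p + d.+1 + l))) (term_of S p (hP D l)))
       (FNot (FEq (term_of S p (hQ D l)) (TZero S))) | l <- iota 0 m].

Definition hvar (X : Type) (w : nat -> X) (i : 'I_d.+1) : X := w (p + i)%N.

Definition gen_solution (K : fieldType) (E : lfield S) (e : K -> E) (v : nat -> K)
    (lam : formula S) (w : nat -> E) : Prop :=
  [/\ forall k, (k < p)%N -> w k = e (v k),
      algebraically_independent e (hvar w \o @wid d) &
      sat E w (FAnd hzero (FAnd hfrac lam))].

(** The values that a solution with coordinates [z] is forced to take. *)
Definition canon (K E : fieldType) (e : K -> E) (z : 'I_d.+1 -> E) (v : nat -> K) (k : nat) : E :=
  if (k < p)%N then e (v k)
  else if (k < p + d.+1)%N then z (inord (k - p))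
  else let l := (k - (p + d.+1))%N in
       mmap e z (poly_of (hP D l) v) / mmap e z (poly_of (hQ D l) v).

Hypothesis wfD : hwf D.

Lemma canon_param (K E : fieldType) (e : K -> E) z (v : nat -> K) k :
  (k < p)%N -> canon e z v k = e (v k).
Proof. by rewrite /canon => ->. Qed.

Lemma canon_var (K E : fieldType) (e : K -> E) z (v : nat -> K) :
  hvar (canon e z v) = z.
Proof.
apply: funext => i; rewrite /hvar /canon ltnNge leq_addr /= ltn_add2l ltn_ord.
by congr z; apply: val_inj; rewrite /= inordK addKn.
Qed.

Lemma canon_frac (K E : fieldType) (e : K -> E) z (v : nat -> K) l :
  canon e z v (p + d.+1 + l) =
  mmap e z (poly_of (hP D l) v) / mmap e z (poly_of (hQ D l) v).
Proof. by rewrite /canon ltnNge -addnA leq_addr /= addnA ltnNge leq_addr /= addKn. Qed.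

Lemma hzero_sat (K : fieldType) (E : lfield S) (e : {rmorphism K -> E}) (v : nat -> K)
    (w : nat -> E) : (forall k, (k < p)%N -> w k = e (v k)) ->
  sat E w hzero <-> mmap e (hvar w) (poly_of (hf D) v) = 0.
Proof.
by move=> we; rewrite /hzero /= (eval_term_of_mmap _ (proj1 wfD) we).
Qed.

Lemma hsmooth_sat (K : fieldType) (E : lfield S) (e : {rmorphism K -> E}) (v : nat -> K)
    (w : nat -> E) : (forall k, (k < p)%N -> w k = e (v k)) ->
  sat E w hsmooth <-> mmap e (hvar w) (poly_of (hf D) v) = 0 /\
    mmap e (hvar w) (poly_of (hf D) v)^`M(ord_max) != 0.
Proof.
move=> we; rewrite -[sat E w hsmooth]/(sat E w hzero /\ _) (hzero_sat we) /=.
rewrite (eval_term_of_mmap _ (pdata_deriv_below _ (proj1 wfD)) we) poly_of_deriv.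
by split=> -[H1 H2]; split=> //; apply/eqP.
Qed.

Lemma hfrac_sat (K : fieldType) (E : lfield S) (e : {rmorphism K -> E}) (v : nat -> K)
    (w : nat -> E) : (forall k, (k < p)%N -> w k = e (v k)) ->
  sat E w hfrac <-> forall l, (l < m)%N ->
    mmap e (hvar w) (poly_of (hQ D l) v) != 0 /\
    w (p + d.+1 + l)%N =
      mmap e (hvar w) (poly_of (hP D l) v) / mmap e (hvar w) (poly_of (hQ D l) v).
Proof.
move=> we; rewrite /hfrac sat_conj_list; split=> [H l lm|H phi].
  have [|E1 /eqP E2] := H (FAnd (FEq (TMul (term_of S p (hQ D l)) (TVar S (p + d.+1 + l)))
      (term_of S p (hP D l))) (FNot (FEq (term_of S p (hQ D l)) (TZero S)))).
    by apply/List.in_map_iff; exists l; split=> //; apply: in_iota.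
  move: E1 E2; rewrite /= !(eval_term_of_mmap _ _ we) ?(proj1 ((proj2 wfD) l)) //;
    try exact: (proj2 ((proj2 wfD) l)).
  by move=> E1 E2; split=> //; rewrite -E1 [X in X / _]mulrC mulfK.
move=> /List.in_map_iff[l [<-]] /List.in_seq [_ lm].
have {}lm : (l < m)%N by lia.
have [nQ wE] := H l lm.
rewrite /= wE !(eval_term_of_mmap _ _ we) ?(proj1 ((proj2 wfD) l)) //;
  try exact: (proj2 ((proj2 wfD) l)).
by split; [rewrite [LHS]mulrC divfK|apply/eqP].
Qed.

(** All generic solutions are images of the one in the function field; this gathers solutions from
    unrelated extensions on a single field. *)
Lemma gen_solution_factor (K F : fieldType) (eF : {rmorphism K -> F}) (zF : 'I_d.+1 -> F)
    (E : lfield S) (e : {rmorphism K -> E}) v lam w :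
    let f := poly_of (hf D) v in
    irreducible_elt f -> (1 < size (muni f))%N ->
    generic_point eF f zF -> generated_by eF zF -> gen_solution e v lam w ->
  (forall l, (l < m)%N -> mmap eF zF (poly_of (hQ D l) v) != 0) /\
  exists h : {rmorphism F -> E}, (forall c, h (eF c) = e c) /\
    forall k, (k < hq D)%N -> h (canon eF zF v k) = w k.
Proof.
move=> f irf sf genF gen_ [wp indep [/(hzero_sat wp) fz [/(hfrac_sat wp) fr _]]].
have [h [he hz]] := generic_lift irf sf genF gen_ (conj indep fz).
have hmm P : h (mmap eF zF P) = mmap e (hvar w) P.
  by rewrite rmorph_mmap; apply: mmap_ext => // c; rewrite /= ?he.
split=> [l lm|].
  by have [+ _] := fr l lm; rewrite -hmm fmorph_eq0.
exists h; split=> // k kq; have [kp|pk] := ltnP k p; first by rewrite canon_param // he wp.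
have [kd|dk] := ltnP k (p + d.+1).
  have lt : (k - p < d.+1)%N by lia.
  have := hz (Ordinal lt); rewrite /hvar /= subnKC // => <-.
  congr (h _); rewrite -[X in _ = X _](canon_var eF zF v) /hvar /= subnKC //.
have {1}-> : k = (p + d.+1 + (k - (p + d.+1)))%N by lia.
have lm : (k - (p + d.+1) < m)%N by move: kq; rewrite /hq; lia.
have [_ wE] := fr _ lm; rewrite canon_frac fmorph_div !hmm -wE.
by congr w; lia.
Qed.

Lemma gen_solution_canon (K : fieldType) (F : lfield S) (e : {rmorphism K -> F}) z v lam :
    generic_point e (poly_of (hf D) v) z ->
    (forall l, (l < m)%N -> mmap e z (poly_of (hQ D l) v) != 0) ->
    sat F (canon e z v) lam ->
  gen_solution e v lam (canon e z v).
Proof.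
move=> [indep fz] nQ sl.
have wp k : (k < p)%N -> canon e z v k = e (v k) by apply: canon_param.
split=> //; first by rewrite canon_var.
split; first by apply/(hzero_sat wp); rewrite canon_var.
split=> //; apply/(hfrac_sat wp) => l lm; rewrite canon_var canon_frac; split=> //.
exact: nQ.
Qed.

End Hypersurface.

(** * Density of generic solutions *)

Lemma distinct_or_covered (X : eqType) (P : X -> Prop) D :
  (exists y : nat -> X, (forall l, (l < D)%N -> P (y l)) /\
     forall l l', (l' < l < D)%N -> y l <> y l') \/
  exists s : seq X, forall x, P x -> x \in s.
Proof.
elim: D => [|D [[y [yP yD]]|]]; last by right.
  case: (pselect (exists x, P x)) => [[x _]|nP]; first by left; exists (fun=> x); split=> // l l'; lia.
  by right; exists [::] => x Px; case: nP; exists x.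
case: (pselect (exists x, P x /\ x \notin [seq y l | l <- iota 0 D])) => [[x [Px xy]]|nx]; last first.
  right; exists [seq y l | l <- iota 0 D] => x Px; apply: contrapT => xy; case: nx; exists x.
  by split=> //; apply/negP.
left; exists (fun l => if l == D then x else y l); split=> [l lD|l l' ll].
  by case: eqP => // lD'; apply: yP; lia.
have /negPf-> : l' != D by lia.
case: eqP => [_ E|lD]; last by apply: yD; lia.
by move/negP: xy; apply; rewrite E map_f // mem_iota; lia.
Qed.

Section Independence.

Variable S : symbols.
Implicit Types (A : language S) (chi : formula S).

Lemma sat_conj_map (M : structure S) (v : nat -> M) (f : nat -> formula S) n :
  sat M v (conj_list [seq f l | l <- iota 0 n]) <-> forall l, (l < n)%N -> sat M v (f l).
Proof.
rewrite sat_conj_list; split=> [H l ln|H phi].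
  by apply: H; apply/List.in_map_iff; exists l; split=> //; apply: in_iota.
by move=> /List.in_map_iff[l [<-]] /List.in_seq [_ ln]; apply: H; lia.
Qed.

Lemma formula_in_conj_map A (f : nat -> formula S) n :
  (forall l, (l < n)%N -> formula_in A (f l)) -> formula_in A (conj_list [seq f l | l <- iota 0 n]).
Proof.
move=> H; apply: formula_in_conj_list => phi /List.in_map_iff[l [<-]] /List.in_seq [_ ln].
by apply: H; lia.
Qed.

Lemma free_var_conj_map (f : nat -> formula S) n k :
  free_var k (conj_list [seq f l | l <- iota 0 n]) -> exists2 l, (l < n)%N & free_var k (f l).
Proof.
move=> /free_var_conj_list[phi [/List.in_map_iff[l [<-]] /List.in_seq [_ ln]] kl].
by exists l => //; lia.
Qed.

(** The counting quantifier [at least D values of the variable p], with the candidates at the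
    variables from [p.+1] on. *)
Definition many_solutions p D chi : formula S := exs (iota p.+1 D) (FAnd
  (conj_list [seq formula_ren (fun k => if k == p then (p.+1 + l)%N else k) chi | l <- iota 0 D])
  (conj_list [seq conj_list [seq FNot (FEq (TVar S (p.+1 + l)) (TVar S (p.+1 + l')))
     | l' <- iota 0 l] | l <- iota 0 D])).

Lemma sat_many_solutions p D chi (M : structure S) (v : nat -> M) :
    quantifier_free chi -> (forall k, free_var k chi -> (k < p.+1)%N) ->
  sat M v (many_solutions p D chi) <->
    exists y : nat -> M, (forall l, (l < D)%N -> sat M (update v p (y l)) chi) /\
      forall l l', (l' < l < D)%N -> y l <> y l'.
Proof.
move=> qchi chip; rewrite sat_exs.
have E (x : nat -> M) l : (l < D)%N ->
    (if (p.+1 + l)%N \in iota p.+1 D then x (p.+1 + l)%N else v (p.+1 + l)%N) = x (p.+1 + l)%N.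
  by move=> lD; rewrite mem_iota; case: ifP => //; lia.
have E2 (x : nat -> M) l : (l < D)%N ->
    sat M (fun k => if k \in iota p.+1 D then x k else v k)
      (formula_ren (fun k => if k == p then (p.+1 + l)%N else k) chi) <->
    sat M (update v p (x (p.+1 + l)%N)) chi.
  move=> lD; rewrite (sat_ren _ _ qchi); apply: sat_ext => k kp /=; rewrite /update.
  case: (eqVneq k p) => [_|kp']; first exact: E.
  have := chip _ kp; case: ifP => //; rewrite mem_iota; move/eqP: kp'; lia.
split=> [[x [/sat_conj_map H1 /sat_conj_map H2]]|[y [yP yD]]].
  exists (fun l => x (p.+1 + l)%N); split=> [l lD|l l' ll]; first by apply/E2 => //; apply: H1.
  have lD : (l < D)%N by lia.
  have /sat_conj_map /(_ l') /= := H2 l lD; rewrite !E //; last lia.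
  by apply; lia.
exists (fun k => y (k - p.+1)%N); split; apply/sat_conj_map => l lD.
  by apply/E2 => //; rewrite addKn; apply: yP.
apply/sat_conj_map => l' ll /=; rewrite (E (fun k => y (k - p.+1)%N)) //.
rewrite (E (fun k => y (k - p.+1)%N)) ?addKn; last lia.
by apply: yD; lia.
Qed.

Lemma formula_in_many_solutions A p D chi : formula_in A chi -> formula_in A (many_solutions p D chi).
Proof.
move=> Achi; apply/formula_in_exs; split; apply: formula_in_conj_map => l lD.
  exact: formula_in_ren.
exact: formula_in_conj_map.
Qed.

Lemma free_var_many_solutions p D chi k :
    quantifier_free chi -> (forall k, free_var k chi -> (k < p.+1)%N) ->
  free_var k (many_solutions p D chi) -> (k < p)%N.
Proof.
move=> qchi chip /free_var_exs[]; rewrite mem_iota => kp [] /free_var_conj_map[l lD].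
  by move=> /(free_var_ren qchi)[k' [/chip k'p]]; case: eqP; lia.
by move=> /free_var_conj_map[l' ll] /= [] E; lia.
Qed.

Lemma independent_injective (K E : fieldType) (e : {rmorphism K -> E}) d n (t : 'I_d -> 'I_n)
    (x : 'I_n -> E) :
  algebraically_independent e (fun i => x (t i)) -> injective t.
Proof.
move=> indep i j tij; apply: contrapT => /eqP ij.
have /eqP : 'X_i - 'X_j = 0 :> {mpoly K[d]}.
  by apply: indep; rewrite rmorphB /= !mmapX !mmap1U tij subrr.
rewrite subr_eq0 => /eqP /mpolyP /(_ U_(i)%MM); rewrite !mcoeffX eqxx.
by rewrite eq_mnm1 eq_sym (negPf ij) => /eqP; rewrite oner_eq0.
Qed.

(** Induction on the number of coordinates. The last one is not algebraic over the field generated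
    by the others, so by (A) [chi] has infinitely many solutions in it. Having at least [D] of them
    is a quantifier-free condition on the others; the induction hypothesis moves these off the zeros
    of the leading coefficient of [q], and a nonzero polynomial of size at most [D] misses one of
    [D] values. *)
Lemma independent_solution_dense A (T : theory S) (d p : nat) (K M : lfield S)
    (a : {rmorphism K -> M}) (w : nat -> M) chi (q : {mpoly M[d]}) :
    relational A -> eliminates_quantifiers A T -> condition_A A T ->
    models M T -> embedding A K M a -> formula_in A chi -> quantifier_free chi ->
    (forall k, free_var k chi -> (k < p + d)%N) ->
    (forall k, (k < p)%N -> exists c, w k = a c) ->
    algebraically_independent a (fun i : 'I_d => w (p + i)%N) ->
    sat M w chi -> q != 0 ->
  exists w' : nat -> M, [/\ forall k, (k < p)%N -> w' k = w k, sat M w' chi &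
    q.@[fun i => w' (p + i)%N] != 0].
Proof.
move=> relA qeA cA MT emba; elim: d chi q w => [|d IH] chi q w Achi qchi chip wa indep wchi q0.
  exists w; split=> //; move: q0; rewrite (nvar0_mpolyC q) mevalC.
  by apply: contra_neq => ->.
have chip' k : free_var k chi -> (k < (p + d).+1)%N by rewrite -addnS; apply: chip.
set D := size (muni q); set b := w (p + d)%N.
pose t (i : 'I_d) := w (p + i)%N.
have indept : algebraically_independent a t.
  move=> P; rewrite (_ : mmap a t P = mmap a (fun i : 'I_d.+1 => w (p + i)%N) (mwiden P)).
    by move/indep=> E; apply: inj_mwiden; rewrite E mwiden0.
  by rewrite mmap_wid; apply: mmap_ext.
have transc (G : fieldType) (v : {rmorphism G -> M}) :
    (forall g, in_gen a t (v g)) -> ~ algebraicOver v b.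
  move=> vg /(relation_of_algebraic vg)[g g0 gt0].
  move/eqP: g0; apply; apply: indep; rewrite -[RHS]gt0; apply: mmap_ext => // i.
  by elim/ord_last_ind: i => [i|] /=; rewrite ?snoc_wid ?snoc_max.
have [psi [Apsi qpsi psip psiE]] := qeA _ (formula_in_many_solutions (p + d)%N D Achi).
have psiE' u : sat M u psi <-> exists y : nat -> M,
    (forall l, (l < D)%N -> sat M (update u (p + d)%N (y l)) chi) /\
    forall l l', (l' < l < D)%N -> y l <> y l'.
  by rewrite -psiE // sat_many_solutions.
have psip' k : free_var k psi -> (k < p + d)%N.
  by move=> /psip; apply: free_var_many_solutions.
have wpsi : sat M w psi.
  apply/psiE'.
  (* If a finite list covered the solutions, [b] would lie in the model-theoretic closure of the
     field generated by [t]. *)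
  have [//|[s sP]] := distinct_or_covered (fun y => sat M (update w (p + d)%N y) chi) D.
  have [G [v [th [vgen vth]]]] := exists_gen_field a t.
  (* The generated field with the relations induced from [M]; as [A] is relational, function symbols
     may be interpreted at will. *)
  pose F := @LField S G (fun _ _ => 0) (fun r x => @s_rel S M r (fun i => v (x i))).
  have embF : embedding A F M v.
    split; [exact: fmorph_inj|by split; [exact: rmorph0|exact: rmorph1]| |by move=> f /relA|by []].
    by split; [exact: rmorphD|exact: rmorphN|exact: rmorphM].
  have FT := models_universal_substructure embF (models_universal_consequences (A := A) MT).
  case: (transc G v); first by move=> g; apply/vgen; exists g.
  apply: (cA F FT M v MT embF).
  have /choice[u uw] : forall k, exists g : G, (k < p + d)%N -> v g = w k.
    move=> k; have [kp|pk] := ltnP k (p + d); last by exists 0.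
    have /vgen[g gk] : in_gen a t (w k).
      have [/wa[c ->]|pk] := ltnP k p; first exact: in_gen_const.
      have lt : (k - p < d)%N by lia.
      by have := in_gen_var a t (Ordinal lt); rewrite /t /= subnKC.
    by exists g.
  (* [acl] reserves the variable 0 for the element, so the parameters are shifted by one. *)
  pose r k := if k == (p + d)%N then 0%N else k.+1.
  have rE y : sat M (update (fun k => v (u k.-1)) 0%N y) (formula_ren r chi) <->
      sat M (update w (p + d)%N y) chi.
    rewrite (sat_ren _ _ qchi); apply: sat_ext => k kp; rewrite /= /update /r.
    have := chip' _ kp; case: (eqVneq k (p + d)%N) => //= /eqP kpd kpd'; apply: uw; lia.
  exists (formula_ren r chi), (fun k => u k.-1); split.
  - exact: formula_in_ren.
  - apply/rE; apply: (proj1 (sat_ext _)) wchi => k _; rewrite /update /b.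
    by case: eqP => // ->.
  - exists (size s), (fun i => nth 0 s i) => x /rE /sP xs.
    by exists (Ordinal (etrans (index_mem x s) xs)); rewrite /= nth_index.
have mq0 : muni q != 0 by apply: contra_neq q0 => E; rewrite -[q]muniK E /poly_last rmorph0 horner0.
have lq0 : lead_coef (muni q) != 0 by rewrite lead_coef_eq0.
have [w0 [w0p /psiE'[y [yP yD]] lw0]] := IH psi _ w Apsi qpsi psip' wa indept wpsi lq0.
pose qy := map_poly (mmap (@idfun M) (fun i : 'I_d => w0 (p + i)%N)) (muni q).
have cqy : qy`_D.-1 != 0 by rewrite coef_map.
have qy0 : qy != 0 by apply: contra_neq cqy => ->; rewrite coef0.
have [l lD ly] : exists2 l, (l < D)%N & ~~ root qy (y l).
  apply: contrapT => nl.
  have : (size [seq y l | l <- iota 0 D] < size qy)%N.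
    apply: max_poly_roots => //.
      apply/allP => x /mapP[l]; rewrite mem_iota => lD ->.
      by apply/negPn/negP => ly; apply: nl; exists l.
    rewrite map_inj_in_uniq ?iota_uniq // => l l'; rewrite !mem_iota => lD lD' E.
    by case: (ltngtP l l') => // ll; [have := yD l' l|have := yD l l']; rewrite ll E => H; case: H => //; lia.
  by rewrite size_map size_iota ltnNge size_poly.
exists (update w0 (p + d)%N (y l)); split; [|exact: yP|].
  by move=> k kp; rewrite /update; case: eqP => [kd|_]; [lia|exact: w0p].
move: ly; rewrite /root (_ : _.[_] = q.@[fun i : 'I_d.+1 => update w0 (p + d)%N (y l) (p + i)%N]) //.
rewrite -[RHS]/(mmap (@idfun M) _ _) mmap_muni /update /= eqxx; congr (_.[_]).
apply: eq_map_poly => P; apply: mmap_ext => // i /=; rewrite eqn_add2l.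
by case: eqP => // iE; have := ltn_ord i; rewrite iE ltnn.
Qed.

End Independence.

(** * Diagrams and products of fields *)

Lemma isomorphism_refl (S : symbols) (M : structure S) (B : language S) : isomorphism B M M id.
Proof. by split; [exists id|split]. Qed.

Lemma term_in_mono (S : symbols) (A B : language S) t :
  (forall f, has_fun A f -> has_fun B f) -> term_in A t -> term_in B t.
Proof.
move=> AB; elim: t => //= [t1 IH1 t2 IH2 [/IH1 ? /IH2 ?]|t1 IH1 t2 IH2 [/IH1 ? /IH2 ?]|f ts IH [/AB ? H]] //.
by split=> // i; apply: IH.
Qed.

Lemma formula_in_mono (S : symbols) (A B : language S) phi :
    (forall f, has_fun A f -> has_fun B f) -> (forall r, has_rel A r -> has_rel B r) ->
  formula_in A phi -> formula_in B phi.
Proof.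
move=> ABf ABr; elim: phi => //=
  [t t'|r ts [/ABr ? H]|p IHp q IHq [/IHp ? /IHq ?]|p IHp q IHq [/IHp ? /IHq ?]] //.
  by move=> [H1 H2]; split; exact: term_in_mono ABf _.
by split=> // i; exact: term_in_mono ABf _.
Qed.

Lemma formula_in_ring (S : symbols) (A : language S) phi :
  formula_in (ring_language S) phi -> formula_in A phi.
Proof. by apply: formula_in_mono. Qed.

Lemma hzero_in (S : symbols) D A : formula_in A (hzero S D).
Proof. by split=> //; exact: term_of_in. Qed.

Lemma hsmooth_in (S : symbols) D A : formula_in A (hsmooth S D).
Proof. by split; [exact: hzero_in|split=> //; exact: term_of_in]. Qed.

Lemma hfrac_in (S : symbols) D A : formula_in A (hfrac S D).
Proof.
apply: formula_in_conj_list => phi /List.in_map_iff[l [<- _]] /=.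
by do ! split=> //; exact: term_of_in.
Qed.

Lemma hfrac_qf (S : symbols) D : quantifier_free (hfrac S D).
Proof. by apply: qf_conj_list => phi /List.in_map_iff[l [<- _]]. Qed.

Lemma hsmooth_var (S : symbols) D k : hwf D ->
  free_var k (hsmooth S D) -> (k < hp D + (hd D).+1)%N.
Proof.
by move=> [fD _] [[/(term_of_var fD (leqnn _))|]|[/(term_of_var (pdata_deriv_below _ fD) (leqnn _))|]].
Qed.

Lemma gen_solution_embedding (S : symbols) D (A : language S) (K : fieldType) (F N : lfield S)
    (e : {rmorphism K -> F}) (a : F -> N) v lam w :
    embedding A F N a -> formula_in A lam -> quantifier_free lam ->
    gen_solution D e v lam w ->
  gen_solution D (fun x => a (e x)) v lam (fun k => a (w k)).
Proof.
move=> emba Alam qlam [wp indep wsat]; split.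
- by move=> k /wp ->.
- have [a' a'E] := embedding_rmorphism emba; rewrite -a'E => q q0; apply: indep.
  by apply: (fmorph_inj a'); rewrite rmorph0 rmorph_mmap -[RHS]q0.
apply/(sat_embedding (M := F) w emba) => //; last by split=> //; split=> //; exact: hfrac_qf.
by split; [exact: hzero_in|split=> //; exact: hfrac_in].
Qed.

Section Diagram.

Variables (S : symbols) (I : Type) (LI : I -> language S).
Hypothesis LI_relational : forall i, relational (LI i).

Lemma term_in_bigunion t : term_in (lang_bigunion LI) t -> term_in (ring_language S) t.
Proof. by apply: term_in_mono => f [i /LI_relational]. Qed.

(** Truth of [psi] is settled by finitely many formulas of a single language each, because no atom
    mixes two of the [LI i]. *)
Definition has_diagram (F : structure S) (w : nat -> F) (psi : formula S) : Prop :=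
  exists ls : seq (formula S),
    (forall l, List.In l ls -> [/\ sat F w l, quantifier_free l,
       forall k, free_var k l -> free_var k psi &
       formula_in (ring_language S) l \/ exists i, formula_in (LI i) l]) /\
    forall (M : structure S) (u : nat -> M), (forall l, List.In l ls -> sat M u l) ->
      (sat F w psi <-> sat M u psi).

Lemma literal_diagram (F : structure S) (w : nat -> F) psi :
    quantifier_free psi ->
    formula_in (ring_language S) psi \/ (exists i, formula_in (LI i) psi) ->
  has_diagram w psi.
Proof.
move=> qpsi psi_in; have [wpsi|npsi] := pselect (sat F w psi).
  exists [:: psi]; split=> [l [<-|[]]//|M u H]; split=> // _.
  by apply: H; left.
exists [:: FNot psi]; split=> [l [<-|[]]//|M u H]; split=> // upsi.
by case: (H (FNot psi)) => //; left.
Qed.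

Lemma binary_diagram (F : structure S) (w : nat -> F) p q r :
    (forall (M : structure S) (u : nat -> M), (sat F w p <-> sat M u p) ->
       (sat F w q <-> sat M u q) -> (sat F w r <-> sat M u r)) ->
    (forall k, free_var k r <-> free_var k p \/ free_var k q) ->
    has_diagram w p -> has_diagram w q ->
  has_diagram w r.
Proof.
move=> rsat rfree [lp [lp1 lp2]] [lq [lq1 lq2]]; exists (lp ++ lq); split=> [l|M u H].
  by move=> /List.in_app_iff[/lp1|/lq1] [H1 H2 H3 H4]; split=> // k /H3 ?; apply/rfree; tauto.
by apply: rsat; [apply: lp2|apply: lq2] => l ll; apply: H; apply/List.in_app_iff; tauto.
Qed.

Lemma exists_diagram (F : structure S) (w : nat -> F) psi :
  formula_in (lang_bigunion LI) psi -> quantifier_free psi -> has_diagram w psi.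
Proof.
elim: psi => [t t'|r ts|p IHp|p IHp q IHq|p IHp q IHq|//|//] /=.
- by move=> [t_in t'_in] _; apply: literal_diagram => //; left; split; exact: term_in_bigunion.
- move=> [[i ir] ts_in] _; apply: literal_diagram => //; right; exists i; split=> // j.
  exact: term_in_mono (term_in_bigunion (ts_in j)).
- move=> pin qp; have [ls [ls1 ls2]] := IHp pin qp; exists ls; split=> // M u /ls2 /=; tauto.
- move=> [pin qin] [qp qq]; apply: binary_diagram (IHp pin qp) (IHq qin qq) => // M u /=; tauto.
- move=> [pin qin] [qp qq]; apply: binary_diagram (IHp pin qp) (IHq qin qq) => // M u /=; tauto.
Qed.

(** The formulas of the diagram are sorted by language. [lam i] is given for every [i], but the
    finitely many [i] in [I0] suffice to imply [psi]. *)
Lemma exists_split_diagram (F : structure S) (w : nat -> F) psi :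
    formula_in (lang_bigunion LI) psi -> quantifier_free psi -> sat F w psi ->
  exists rho (lam : I -> formula S) (I0 : seq I),
    [/\ [/\ formula_in (ring_language S) rho, quantifier_free rho, sat F w rho &
          forall k, free_var k rho -> free_var k psi],
        forall i, [/\ formula_in (LI i) (lam i), quantifier_free (lam i), sat F w (lam i) &
          forall k, free_var k (lam i) -> free_var k psi] &
        forall (M : structure S) (u : nat -> M), sat M u rho ->
          (forall i, List.In i I0 -> sat M u (lam i)) -> sat M u psi].
Proof.
move=> psi_in qpsi wpsi; have [ls [lsP lsE]] := exists_diagram w psi_in qpsi.
pose part A := conj_list [seq l <- ls | `[< formula_in A l >]].
have partP A l : List.In l [seq l <- ls | `[< formula_in A l >]] <-> List.In l ls /\ formula_in A l.
  split=> [/List.filter_In[H /asboolP]//|[H1 H2]].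
  by apply/List.filter_In; split=> //; apply/asboolP.
have partQ A : [/\ formula_in A (part A), quantifier_free (part A), sat F w (part A) &
    forall k, free_var k (part A) -> free_var k psi].
  split.
  - by apply: formula_in_conj_list => l /partP[].
  - by apply: qf_conj_list => l /partP[/lsP[]].
  - by apply/sat_conj_list => l /partP[/lsP[]].
  - by move=> k /free_var_conj_list[l [/partP[/lsP[_ _ + _] _]]]; apply.
have [I0 I0P] : exists I0 : seq I, forall l, List.In l ls ->
    formula_in (ring_language S) l \/ exists2 i, List.In i I0 & formula_in (LI i) l.
  have : forall l, List.In l ls -> formula_in (ring_language S) l \/ exists i, formula_in (LI i) l.
    by move=> l /lsP[].
  elim: ls {lsP lsE partP partQ part} => [|l ls IH] H; first by exists [::].
  have [|I0 I0P] := IH; first by move=> l' l'l; apply: H; right.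
  have [lr|[i il]] := H l (or_introl erefl).
    by exists I0 => l' [<-|/I0P//]; left.
  exists (i :: I0) => l' [<-|/I0P[|[j jI jl]]]; [right; exists i => //; by left|by left|].
  by right; exists j => //; right.
exists (part (ring_language S)), (fun i => part (LI i)), I0; split=> // M u.
move=> /sat_conj_list urho ulam; apply: (proj1 (lsE M u _)) => // l ll.
have [lr|[i iI il]] := I0P l ll; first by apply: urho; apply/partP.
by move/sat_conj_list: (ulam i iI); apply; apply/partP.
Qed.

End Diagram.

(** * Encoding polynomials by positions in a list of coefficients *)

Section Coding.

Variables (K : fieldType) (pl : seq K).

Definition code n (P : {mpoly K[n]}) : pdata n :=
  [seq ((index P@_m pl, 1%N), m) | m <- msupp P].

Definition coefficients n (P : {mpoly K[n]}) : seq K := [seq P@_m | m <- msupp P].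

Lemma poly_of_code n (P : {mpoly K[n]}) :
  {subset coefficients P <= pl} -> poly_of (code P) (nth 0 pl) = P.
Proof.
move=> sub; rewrite /poly_of big_map [RHS]mpolyE; apply: eq_big_seq => m mP /=.
by rewrite mulr1n nth_index //; apply: sub; apply/mapP; exists m.
Qed.

Lemma code_below n (P : {mpoly K[n]}) :
  {subset coefficients P <= pl} -> pdata_below (size pl) (code P).
Proof.
by move=> sub; apply/allP => q /mapP[m mP ->] /=; rewrite index_mem; apply: sub; apply/mapP; exists m.
Qed.

End Coding.

(** * Polynomials over ultraproducts *)

Section ProductPolynomials.

Variables (J : Type) (j0 : J) (U : (J -> Prop) -> Prop).
Hypothesis UU : @filter.UltraFilter J U.
Variables (E : J -> fieldType) (N : fieldType) (c : {rmorphism prod_ring E j0 -> N}).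
Hypothesis cE : forall x, c x = 0 <-> U (fun j => x j = 0).
Local Notation proj := (@prod_proj J j0 E).

Lemma ultra_seq (X : Type) (s : seq X) (P : X -> J -> Prop) :
  (forall x, List.In x s -> U (P x)) -> U (fun j => forall x, List.In x s -> P x j).
Proof.
elim: s => [|x s IH] H; first by apply: ultraS (ultraT UU) => j _ x [].
have Us : U (fun j => forall y, List.In y s -> P y j) by apply: IH => y ys; apply: H; right.
by apply: ultraS (ultraI UU Us (H x (or_introl erefl))) => j [H1 H2] y [<-|/H1].
Qed.

Lemma mem_In (X : eqType) (s : seq X) x : x \in s -> List.In x s.
Proof.
elim: s => [|y s IH] //=; rewrite in_cons => /orP[/eqP->|/IH]; [by left|by right].
Qed.

(** Finitely many coefficients are involved, so almost every factor agrees with the ultraproduct on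
    which of them vanish. *)
Lemma ultra_coefficients n (Q : {mpoly prod_ring E j0[n]}) :
  U (fun j => forall m, (map_mpoly (proj j) Q)@_m = 0 <-> (map_mpoly c Q)@_m = 0).
Proof.
have : U (fun j => forall m, List.In m (msupp Q) -> (Q@_m j = 0 <-> c Q@_m = 0)).
  apply: ultra_seq => m _; have [Hc|Hc] := pselect (c Q@_m = 0).
    by move/cE: (Hc); apply: ultraS => j Hj; split.
  have /(ultraN UU) : ~ U (fun j => Q@_m j = 0) by move/cE.
  by apply: ultraS => j Hj; split.
apply: ultraS => j H m; rewrite !mcoeff_map_mpoly /=.
have [/mem_In/H//|] := boolP (m \in msupp Q).
by move/memN_msupp_eq0 => ->; rewrite !rmorph0.
Qed.

Lemma map_mpoly_ultra n (Q : {mpoly prod_ring E j0[n]}) :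
  map_mpoly c Q = 0 <-> U (fun j => map_mpoly (proj j) Q = 0).
Proof.
split=> [Q0|UQ].
  apply: ultraS (ultra_coefficients Q) => j H; apply/mpolyP => m.
  by rewrite mcoeff0; apply/H; rewrite Q0 mcoeff0.
have [j [Q0 H]] := ultra_ex UU (ultraI UU UQ (ultra_coefficients Q)).
by apply/mpolyP => m; rewrite mcoeff0; apply/H; rewrite Q0 mcoeff0.
Qed.

Lemma msize_ultra n (Q : {mpoly prod_ring E j0[n]}) :
  U (fun j => msize (map_mpoly (proj j) Q) = msize (map_mpoly c Q)).
Proof.
apply: ultraS (ultra_coefficients Q) => j H; rewrite !mmeasureE; apply: perm_big.
apply: uniq_perm; rewrite ?msupp_uniq // => m; rewrite !mcoeff_msupp; congr (~~ _).
by apply/eqP/eqP => /H.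
Qed.

(** The common degree bound makes the coefficients of the whole family fit into one finite sum over
    the product ring. *)
Lemma family_mpoly n B (g : forall j, {mpoly E j[n]}) :
    (forall j, (msize (g j) <= B)%N) ->
  exists2 G : {mpoly prod_ring E j0[n]}, (msize G <= B)%N &
    forall j, map_mpoly (proj j) G = g j.
Proof.
move=> gB; exists (\sum_(m : 'X_{1..n < B}) ((fun j => (g j)@_m) : prod_ring E j0) *: 'X_[m]).
  rewrite msizeE; apply/bigmax_leqP_seq => m mG _; rewrite ltnNge -ltnS; apply/negP => Bm.
  move: mG; rewrite mcoeff_msupp raddf_sum big1 ?eqxx // => m' _.
  rewrite /= mcoeffZ mcoeffX; case: eqP => [mm'|]; last by rewrite mulr0.
  by have := bmdeg m'; rewrite mm'; lia.
move=> j; rewrite rmorph_sum [RHS](mpolywE (gB j)); apply: eq_bigr => m _.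
by rewrite /= map_mpolyZ map_mpolyX.
Qed.

Lemma surjective_mpoly n (q : {mpoly N[n]}) : (forall x, exists y, c y = x) ->
  exists Q, map_mpoly c Q = q.
Proof.
move=> csurj; have [r rE] := choice csurj.
exists (\sum_(m <- msupp q) r q@_m *: 'X_[m]); rewrite rmorph_sum [RHS]mpolyE.
by apply: eq_bigr => m _; rewrite /= map_mpolyZ map_mpolyX rE.
Qed.

Lemma mmap_ultra (K : J -> fieldType) (k : {rmorphism prod_ring K j0 -> prod_ring E j0}) n
    (z : 'I_n -> prod_ring E j0) (Q : {mpoly prod_ring K j0[n]})
    (e : forall j, {rmorphism K j -> E j}) :
    (forall x j, k x j = e j (x j)) ->
  c (mmap k z Q) = 0 <->
    U (fun j => mmap (e j) (fun i => z i j) (map_mpoly (@prod_proj J j0 K j) Q) = 0).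
Proof.
move=> kE; rewrite cE.
have E1 j : mmap k z Q j = mmap (e j) (fun i => z i j) (map_mpoly (@prod_proj J j0 K j) Q).
  rewrite -[LHS]/(proj j (mmap k z Q)) rmorph_mmap mmap_map_mpoly.
  by apply: mmap_ext => // x /=; rewrite /prod_proj kE.
by split; apply: ultraS => j; rewrite E1.
Qed.

End ProductPolynomials.

Section ProductLift.

Variables (J : Type) (j0 : J) (U : (J -> Prop) -> Prop).
Hypothesis UU : @filter.UltraFilter J U.
Variables (K E : J -> fieldType) (N F : fieldType).
Variables (c : {rmorphism prod_ring K j0 -> N}) (cF : {rmorphism prod_ring E j0 -> F}).
Hypotheses (csurj : forall x, exists y, c y = x)
  (cE : forall x, c x = 0 <-> U (fun j => x j = 0))
  (cFE : forall x, cF x = 0 <-> U (fun j => x j = 0)).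
Variable e : forall j, {rmorphism K j -> E j}.

Lemma product_lift : exists (k : {rmorphism prod_ring K j0 -> prod_ring E j0})
    (eN : {rmorphism N -> F}),
  (forall x j, k x j = e j (x j)) /\ forall x, eN (c x) = cF (k x).
Proof.
have [k kE] := prod_rmorph j0 (fun j => e j \o @prod_proj J j0 K j).
have [|a|eN eNE] := @field_lift _ N F c (cF \o k).
- move=> x; rewrite cE cFE; split; apply: ultraS => j; rewrite kE /=.
    by move=> xj; rewrite /prod_proj xj rmorph0.
  by move/eqP; rewrite fmorph_eq0 => /eqP.
- have [y <-] := csurj a; exists y, 1; rewrite rmorph1 divr1; split=> //.
  exact/eqP/oner_neq0.
by exists k, eN; split=> // x j; rewrite kE.
Qed.

End ProductLift.

Lemma poly_of_rmorph (R R' : comNzRingType) (e : {rmorphism R -> R'}) n (s : pdata n)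
    (v : nat -> R) : poly_of s (fun k => e (v k)) = map_mpoly e (poly_of s v).
Proof.
rewrite /poly_of rmorph_sum; apply: eq_bigr => q _.
by rewrite /= map_mpolyZ map_mpolyX rmorphMn.
Qed.

Lemma msize_map_mpoly_le (R R' : comNzRingType) (e : {rmorphism R -> R'}) n
    (p : {mpoly R[n]}) : (msize (map_mpoly e p) <= msize p)%N.
Proof.
rewrite msizeE; apply/bigmax_leqP_seq => m mp _; apply: msize_mdeg_lt.
move: mp; rewrite !mcoeff_msupp mcoeff_map_mpoly; apply: contra_neq => ->.
exact: rmorph0.
Qed.

(** Packs a factorization with its field, so that one choice over the indices returns both. *)
Record two_polynomials (K : fieldType) n := TwoPolynomials {
  tp_field : fieldType; tp_morph : {rmorphism K -> tp_field};
  tp_left : {mpoly tp_field[n]}; tp_right : {mpoly tp_field[n]} }.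

(** Otherwise almost every factor admits a factorization over some extension, in degrees bounded by
    that of the limit; these assemble into one over the ultraproduct of the extensions. *)
Lemma ultra_abs_irreducible (J : Type) (j0 : J) (U : (J -> Prop) -> Prop)
    (K : J -> fieldType) (N : fieldType) (c : {rmorphism prod_ring K j0 -> N}) n
    (Q : {mpoly prod_ring K j0[n]}) :
    @filter.UltraFilter J U -> (forall x, exists y, c y = x) ->
    (forall x, c x = 0 <-> U (fun j => x j = 0)) ->
    abs_irreducible (map_mpoly c Q) ->
  U (fun j => abs_irreducible (map_mpoly (@prod_proj J j0 K j) Q)).
Proof.
move=> UU csurj cE [B1 Qirr]; apply: contrapT => /(ultraN UU) nirr.
set B := msize (map_mpoly c Q) in B1 Qirr.
pose Qj j := map_mpoly (@prod_proj J j0 K j) Q.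
have factors j : exists X : two_polynomials (K j) n,
    [/\ (msize (tp_left X) <= B.-1)%N, (msize (tp_right X) <= B.-1)%N &
      ~ abs_irreducible (Qj j) -> msize (Qj j) = B ->
      tp_left X * tp_right X = map_mpoly (tp_morph X) (Qj j)].
  have [[nj Bj]|nnj] := pselect (~ abs_irreducible (Qj j) /\ msize (Qj j) = B); last first.
    exists (TwoPolynomials (@idfun (K j)) 0 (0 : {mpoly (K j)[n]})).
    by split; rewrite /= ?msize0 // => ? ?; case: nnj.
  apply: contrapT => nX; case: nj; split=> [|E e g h gB hB gh]; first by rewrite Bj.
  rewrite Bj in gB hB; case: nX; exists (TwoPolynomials e g h); split=> //=; lia.
pose X j := projT1 (cid (factors j)).
pose E j := tp_field (X j).
pose e j : {rmorphism K j -> E j} := tp_morph (X j).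
pose g j : {mpoly (E j)[n]} := tp_left (X j).
pose h j : {mpoly (E j)[n]} := tp_right (X j).
have gB j : (msize (g j) <= B.-1)%N by have [] := projT2 (cid (factors j)).
have hB j : (msize (h j) <= B.-1)%N by have [] := projT2 (cid (factors j)).
have gh j : ~ abs_irreducible (Qj j) -> msize (Qj j) = B -> g j * h j = map_mpoly (e j) (Qj j).
  by have [] := projT2 (cid (factors j)).
have [F [cF cFE]] := ultraproduct_field j0 E UU.
have [k [eN [kE eNE]]] := product_lift UU csurj cE cFE e.
have BB : (B.-1 < B)%N by rewrite ltn_predL ltnW.
have [G GB GE] := family_mpoly j0 gB.
have [H HB HE] := family_mpoly j0 hB.
apply: (Qirr F eN (map_mpoly cF G) (map_mpoly cF H)).
- exact: leq_ltn_trans (leq_trans (msize_map_mpoly_le _ _) GB) BB.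
- exact: leq_ltn_trans (leq_trans (msize_map_mpoly_le _ _) HB) BB.
have -> : map_mpoly eN (map_mpoly c Q) = map_mpoly cF (map_mpoly k Q).
  by apply/mpolyP => m; rewrite !mcoeff_map_mpoly /= eNE.
apply/eqP; rewrite -subr_eq0 -rmorphM -rmorphB; apply/eqP/(map_mpoly_ultra UU cFE).
apply: ultraS (ultraI UU nirr (msize_ultra UU cE Q)) => j [nj Bj].
rewrite rmorphB rmorphM /= GE HE gh //; apply/eqP; rewrite subr_eq0; apply/eqP/mpolyP => m.
by rewrite !mcoeff_map_mpoly /= /prod_proj kE.
Qed.

Definition pure_lfield (S : symbols) (F : fieldType) : lfield S :=
  @LField S F (fun _ _ => 0) (fun _ _ => False).

Section Transfer.

Variables (S : symbols) (D : hdata).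
Hypothesis wfD : hwf D.

Lemma canon_rmorph (K E E' : fieldType) (e : {rmorphism K -> E}) (e' : {rmorphism K -> E'})
    (h : {rmorphism E -> E'}) z z' (v : nat -> K) k :
    (forall x, h (e x) = e' x) -> (forall i, h (z i) = z' i) ->
  h (canon (D := D) e z v k) = canon (D := D) e' z' v k.
Proof.
move=> he hz; rewrite /canon; case: ifP => // _; case: ifP => // _.
by rewrite fmorph_div !rmorph_mmap; congr (_ / _); apply: mmap_ext.
Qed.

(** A quantifier-free ring formula sees only the function field, which embeds in both extensions: it
    holds at all generic points or at none. *)
Lemma gen_solution_transfer (K : fieldType) (E E' : lfield S) (e : {rmorphism K -> E})
    (e' : {rmorphism K -> E'}) (v : nat -> K) rho w z' :
    let f := poly_of (hf D) v in
    formula_in (ring_language S) rho -> quantifier_free rho ->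
    (forall k, free_var k rho -> (k < hq D)%N) ->
    abs_irreducible f -> f^`M(ord_max) != 0 ->
    gen_solution D e v rho w -> generic_point e' f z' ->
  gen_solution D e' v rho (canon (D := D) e' z' v).
Proof.
move=> f rhoin qrho rhoq airf df sol genz'.
have irf := abs_irreducible_elt airf.
have sf := mderiv_size_muni df.
have [F0 [eF [zF [genF gen_]]]] := generic_field irf sf.
have [nQ [h [he hw]]] := gen_solution_factor wfD irf sf genF gen_ sol.
have [h' [he' hz']] := generic_lift irf sf genF gen_ genz'.
have hc := canon_rmorph v _ he' hz'.
apply: gen_solution_canon => // [l lm|].
  rewrite (_ : mmap e' z' _ = h' (mmap eF zF (poly_of (hQ D l) v))).
    by rewrite fmorph_eq0 nQ.
  by rewrite rmorph_mmap; apply: mmap_ext => ?; rewrite /= ?he' ?hz'.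
pose F := pure_lfield S F0.
have wF : sat F (canon (D := D) eF zF v) rho.
  apply: (proj1 (sat_embedding (M := F) _ (@rmorphism_embedding S F E h) rhoin qrho)).
  have [_ _ [_ [_ wrho]]] := sol; apply: (proj1 (sat_ext _)) wrho => k /rhoq kq.
  by rewrite hw.
apply: (proj1 (sat_ext _)) (proj2 (sat_embedding (M := F) _
  (@rmorphism_embedding S F E' h') rhoin qrho) wF) => k _.
exact: hc.
Qed.

End Transfer.

(** Generic points of the factor hypersurfaces, put together, form a generic point over the
    ultraproduct. At this particular point Łoś's theorem relates ring formulas to the factors. *)
Lemma ultraproduct_generic_point (S : symbols) (J : Type) (j0 : J) (U : (J -> Prop) -> Prop)
    (K : J -> fieldType) (N : fieldType) (c : {rmorphism prod_ring K j0 -> N}) d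
    (Q : {mpoly prod_ring K j0[d.+1]}) :
    @filter.UltraFilter J U -> (forall x, exists y, c y = x) ->
    (forall x, c x = 0 <-> U (fun j => x j = 0)) ->
    U (fun j => abs_irreducible (map_mpoly (@prod_proj J j0 K j) Q)) ->
    U (fun j => (map_mpoly (@prod_proj J j0 K j) Q)^`M(ord_max) != 0) ->
  exists (E : J -> lfield S) (e : forall j, {rmorphism K j -> E j})
      (z : 'I_d.+1 -> forall j, E j) (F : lfield S) (cF : (forall j, E j) -> F)
      (eN : {rmorphism N -> F}),
    [/\ forall phi (v : nat -> forall j, E j),
          sat F (fun k => cF (v k)) phi <-> U (fun j => sat (E j) (fun k => v k j) phi),
        forall y, exists x, cF x = y,
        forall x, eN (c x) = cF (fun j => e j (x j)),
        generic_point eN (map_mpoly c Q) (fun i => cF (z i)) &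
        U (fun j => generic_point (e j) (map_mpoly (@prod_proj J j0 K j) Q) (fun i => z i j))].
Proof.
move=> UU csurj cE Uair Udf; pose Qj j := map_mpoly (@prod_proj J j0 K j) Q.
have gen j : exists X : {E : fieldType & ({rmorphism K j -> E} * ('I_d.+1 -> E))%type},
    abs_irreducible (Qj j) -> (Qj j)^`M(ord_max) != 0 ->
    generic_point (projT2 X).1 (Qj j) (projT2 X).2.
  have [[aj dj]|nj] := pselect (abs_irreducible (Qj j) /\ (Qj j)^`M(ord_max) != 0); last first.
    exists (existT (fun E : fieldType => ({rmorphism K j -> E} * ('I_d.+1 -> E))%type)
      (K j) (idfun : {rmorphism K j -> K j}, (fun=> 0))).
    by move=> ? ?; case: nj.
  have [E [e [z [genz _]]]] := generic_field (abs_irreducible_elt aj) (mderiv_size_muni dj).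
  by exists (existT (fun E : fieldType => ({rmorphism K j -> E} * ('I_d.+1 -> E))%type) E (e, z)).
pose X j := projT1 (cid (gen j)).
pose E j := pure_lfield S (projT1 (X j)).
pose e j : {rmorphism K j -> E j} := (projT2 (X j)).1.
pose z (i : 'I_d.+1) j : E j := (projT2 (X j)).2 i.
have genz j : abs_irreducible (Qj j) -> (Qj j)^`M(ord_max) != 0 ->
    generic_point (e j) (Qj j) (fun i => z i j).
  exact: (projT2 (cid (gen j))).
have Ugen : U (fun j => generic_point (e j) (Qj j) (fun i => z i j)).
  by apply: ultraS (ultraI UU Uair Udf) => j [aj dj]; apply: genz.
have [F [cF0 [cFsurj los]]] := ultraproduct_lfield E UU.
have [cF [cFE cF0E]] := los_rmorphism j0 UU los.
have [k [eN [kE eNE]]] := product_lift UU csurj cE cF0E e.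
have mmapE n (t : 'I_n -> forall j, E j) (P : {mpoly prod_ring K j0[n]}) :
    mmap eN (fun i => cF0 (t i)) (map_mpoly c P) = 0 <->
    U (fun j => mmap (e j) (fun i => t i j) (map_mpoly (@prod_proj J j0 K j) P) = 0).
  rewrite -(mmap_ultra (c := cF) UU cF0E (k := k) t P kE).
  suff -> : mmap eN (fun i => cF0 (t i)) (map_mpoly c P) = cF (mmap k t P) by [].
  rewrite (mmap_map_mpoly c eN) (rmorph_mmap k cF).
  by apply: mmap_ext => x /=; rewrite ?eNE ?cFE.
exists E, e, z, F, cF0, eN; split=> //.
  by move=> x; rewrite eNE -cFE; congr (cF _); apply: functional_extensionality_dep => j; rewrite kE.
split.
  move=> q; have [Q' <-] := surjective_mpoly q csurj.
  rewrite (@mmap_ext _ _ _ eN _ _ (fun i : 'I_d => cF0 (z (wid i)))) // => /mmapE Uq.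
  apply/(map_mpoly_ultra UU cE); apply: ultraS (ultraI UU Uq Ugen) => j [qj [indep _]].
  by apply: indep; rewrite -[RHS]qj; apply: mmap_ext.
by apply/mmapE; apply: ultraS Ugen => j [].
Qed.

(** * The criterion *)

Section Main.

Variables (S : symbols) (L : language S) (T : theory S) (I : Type) (LI : I -> language S)
  (TI : I -> theory S).
Hypotheses (T_in : theory_in L T) (T_large : theory_of_large_fields T)
  (TI_in : forall i, theory_in (LI i) (TI i)) (LI_relational : forall i, relational (LI i))
  (LI_disjoint : pairwise_disjoint LI)
  (TI_qe : forall i, eliminates_quantifiers (LI i) (TI i))
  (TI_expand : forall i, expansion_property L T LI TI i)
  (TI_A : forall i, condition_A (LI i) (TI i))
  (TI_Z : forall i, condition_Z (LI i) (TI i)).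

(** * Generic solutions and their definability *)

Lemma large_lfield (N : structure S) : models N T ->
  exists (K : lfield S) (h : K -> N), large K /\ isomorphism (full_language S) K N h.
Proof.
move=> /T_large[K0 [g [gN K0l]]].
by have [K [h [KK0 hN]]] := transport_lfield gN; exists K, h; rewrite KK0.
Qed.

(** A model of [TI i] over [K] is expanded to a model of [T], so that a single large field extends
    [K] in both languages. *)
Lemma model_of_TI i (K : lfield S) : models_TI LI TI K ->
  exists (N : lfield S) (a : K -> N), [/\ large N, models N T, models N (TI i),
    embedding L K N a & embedding (LI i) K N a].
Proof.
move=> KI; have [M [a [MT emba]]] := embed_in_model (KI i).
have [N' [g [gN N'T embL]]] := TI_expand KI MT emba.
have [N [h [Nl hN]]] := large_lfield N'T.
have [h' [hN' hK hK']] := isomorphism_sym hN.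
exists N, (fun x => h' (g (a x))); split=> //.
- by apply/(models_isomorphism T_in (isomorphism_mono L hN)).
- apply: (proj2 (models_isomorphism (@TI_in i) (isomorphism_mono (LI i) hN))).
  exact: (proj1 (models_isomorphism (@TI_in i) gN)).
- exact: embedding_comp embL (proj2 (isomorphism_mono L hN')).
- exact: embedding_comp (embedding_comp emba (proj2 gN)) (proj2 (isomorphism_mono _ hN')).
Qed.

Definition generic_sat i p d (chi : formula S) (K : lfield S) (v : nat -> K) : Prop :=
  exists (M : lfield S) (a : K -> M) (w : nat -> M),
    [/\ models M (TI i), embedding (LI i) K M a, forall k, (k < p)%N -> w k = a (v k),
        algebraically_independent a (fun i : 'I_d => w (p + i)%N) & sat M w chi].

(* A solution that is generic over [K] is turned into one that is generic over [M]:
   by condition (A), the solutions are dense. *)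
Lemma generic_sat_dim i p d chi (K : lfield S) (v : nat -> K) :
    formula_in (LI i) chi -> quantifier_free chi ->
    (forall k, free_var k chi -> (k < p + d)%N) -> generic_sat i p d chi v ->
  exists (M : lfield S) (a : K -> M), [/\ models M (TI i), embedding (LI i) K M a &
    fiber_dim_ge (LI i) chi p d (fun k => a (v k)) d].
Proof.
move=> ichi qchi chip [M [a [w [MT emba wp indep wchi]]]]; exists M, a; split=> //.
have [a' a'E] := embedding_rmorphism emba; rewrite -a'E in emba wp indep *.
(* The conditions: solutions with the same parameters that avoid the zeros of one nonzero [q] over
   [M]. *)
pose Y q := [set w' : nat -> M | [/\ forall k, (k < p)%N -> w' k = w k, sat M w' chi &
  q.@[fun i : 'I_d => w' (p + i)%N] != 0]]%classic.
pose B Z := exists2 q, q != 0 & Z = Y q.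
have B1 : exists Z, B Z by exists (Y 1), 1 => //; exact: oner_neq0.
have [||M' [H [z [Hsat zsat zind]]]] := @ultrapower_tuples S nat M B B1.
- move=> Z [q q0 ->].
  have [w' w'P] := independent_solution_dense (@LI_relational i) (@TI_qe i) (@TI_A i) MT emba
    ichi qchi chip (fun k kp => ex_intro _ (v k) (wp k kp)) indep wchi q0.
  by exists w'.
- move=> Z Z' [q q0 ->] [q' q0' ->]; exists (Y (q * q')); first by exists (q * q') => //; exact: mulf_neq0.
  move=> w' [w'p w'chi]; rewrite mevalM mulf_eq0 negb_or => /andP[nq nq'].
  by split; split.
(* Parameters are read from [w] and not from the generic tuple, so they are images under [H] by
   definition. *)
exists M', H, (fun k => if (k < p)%N then H (w k) else z k); split.
- by move=> phi _ u; apply: Hsat.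
- by move=> k kp; rewrite kp -wp.
- have /zsat H1 : exists2 Z, B Z & forall w', Z w' -> sat M (fun k =>
      match (if (k < p)%N then inl (w k) else inr k) with inl m => m | inr x => w' x end) chi.
    exists (Y 1); first by exists 1 => //; exact: oner_neq0.
    move=> w' [w'p w'chi _]; apply: (proj1 (sat_ext _)) w'chi => k _.
    by case: ltnP => // /w'p.
  by apply: (proj1 (sat_ext _)) H1 => k _; case: ltnP.
exists id => q zq; apply: contrapT => /eqP q0.
have Bq : B (Y q) by exists q.
have [H1 _] := zind M (@idfun M) d (fun i : 'I_d => (p + i)%N) q (Y q) Bq.
move/eqP: zq; apply/negP; rewrite (@mmap_ext _ _ _ H _ _ (fun i : 'I_d => z (p + i)%N)) //.
  by apply: H1 => w' [].
by move=> j /=; rewrite ltnNge leq_addr.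
Qed.

(** By (Z) a quantifier-free [theta] detects full dimension, and it can be read in [K] or in any
    model over [K]. If it holds, a point generic over the model of [model_of_TI] is in particular
    generic over [K]; the converse is [generic_sat_dim]. *)
Lemma definable_generic_sat i p d chi :
    formula_in (LI i) chi -> (forall k, free_var k chi -> (k < p + d)%N) ->
  exists theta : formula S, [/\ formula_in (LI i) theta, quantifier_free theta,
    forall k, free_var k theta -> (k < p)%N &
    forall K : lfield S, models_TI LI TI K ->
      forall v : nat -> K, sat K v theta <-> generic_sat i p d chi v].
Proof.
move=> ichi0 chip0; have [chi' [ichi qchi chip' chiE]] := TI_qe ichi0.
have chip k : free_var k chi' -> (k < p + d)%N by move/chip'; apply: chip0.
have gE (K : lfield S) (v : nat -> K) : generic_sat i p d chi' v <-> generic_sat i p d chi v.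
  by split=> -[M [a [w [MT emba wp indep wchi]]]]; exists M, a, w; split=> //; apply/(chiE M MT).
have [theta [itheta qtheta thetap thetaE]] := TI_Z ichi qchi chip.
exists theta; split=> // K KI v; rewrite -gE; split=> [vtheta|].
  have [M [a [_ _ MT _ emba]]] := model_of_TI i KI.
  have [[N [h [w [elh wp wchi [t indep]]]]] _] :
      fiber_dim (LI i) chi' p d (fun k => a (v k)) d.
    by apply/thetaE => //; apply/(sat_embedding (M := K) v emba itheta qtheta).
  exists N, (fun x => h (a x)), w; split=> //.
  - exact: models_elementary (@TI_in i) elh MT.
  - exact: embedding_comp emba (elementary_embedding_embedding elh).
  have [a' a'E] := embedding_rmorphism emba.
  have [h' h'E] := embedding_rmorphism (elementary_embedding_embedding elh).
  rewrite -a'E -h'E in indep *.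
  (* [t] is an injection of ['I_d] into itself, hence a permutation, which is undone below. *)
  have tinj := independent_injective (x := fun i : 'I_d => w (p + i)%N) indep.
  move=> q q0; apply/eqP; rewrite -(map_mpoly_eq0 a'); apply/eqP.
  have mi : injective (msym (perm tinj)^-1 : {mpoly M[d]} -> _).
    by move=> x y /(congr1 (msym (perm tinj))); rewrite -!msymMm mulVg !msym1m.
  apply: mi; rewrite raddf0; apply: indep; rewrite mmap_msym mmap_map_mpoly -[RHS]q0.
  by apply: mmap_ext => // j /=; rewrite -[X in (p + X)%N]/(val _) -permE permKV.
move=> /(generic_sat_dim ichi qchi chip)[M [a [MT emba dimM]]].
apply/(sat_embedding (M := K) v emba itheta qtheta); apply/thetaE => //; split=> //.
move=> [N [h [w [elh _ _ [t indep]]]]].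
have [h' h'E] := embedding_rmorphism (elementary_embedding_embedding elh).
rewrite -h'E in indep.
have := leq_card _ (independent_injective (x := fun i : 'I_d => w (p + i)%N) indep).
by rewrite !card_ord ltnn.
Qed.

(** Stands for [totally] of the function field: largeness turns such a point into a generic one. *)
Definition totally_smooth D (K : lfield S) (v : nat -> K) : Prop :=
  forall (M : structure S) (a : K -> M), models M T -> embedding L K M a ->
    exists w : nat -> M, (forall k, (k < hp D)%N -> w k = a (v k)) /\ sat M w (hsmooth S D).

(* Pseudo-closedness in terms of systems on hypersurfaces:
   [rho] and [lam i] are the ring and the [LI i] parts of a quantifier-free system,
   and each part needs a generic solution in an extension of its own. *)
Definition hypersurface_closed (K : lfield S) : Prop :=
  forall (D : hdata) (I0 : seq I) (rho : formula S) (lam : I -> formula S),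
    hwf D ->
    [/\ formula_in (ring_language S) rho, quantifier_free rho &
        forall k, free_var k rho -> (k < hq D)%N] ->
    (forall i, [/\ formula_in (LI i) (lam i), quantifier_free (lam i) &
        forall k, free_var k (lam i) -> (k < hq D)%N]) ->
  forall v : nat -> K,
    abs_irreducible (poly_of (hf D) v) -> (poly_of (hf D) v)^`M(ord_max) != 0 ->
    totally_smooth D v ->
    (exists (E : lfield S) (e : {rmorphism K -> E}) w, gen_solution D e v rho w) ->
    (forall i, List.In i I0 -> exists (M : lfield S) (a : K -> M) w,
      [/\ models M (TI i), embedding (LI i) K M a & gen_solution D a v (lam i) w]) ->
  exists w : nat -> K, [/\ forall k, (k < hp D)%N -> w k = v k, sat K w rho &
    forall i, List.In i I0 -> sat K w (lam i)].

Lemma totally_smooth_generic D (K : lfield S) (v : nat -> K) (N : lfield S)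
    (a : {rmorphism K -> N}) :
    hwf D -> abs_irreducible (poly_of (hf D) v) -> totally_smooth D v ->
    large N -> models N T -> embedding L K N a ->
  exists (N' : lfield S) (H : {rmorphism N -> N'}) z,
    (forall phi (v : nat -> N), sat N v phi <-> sat N' (fun k => H (v k)) phi) /\
    generic_point (H \o a) (poly_of (hf D) v) z.
Proof.
move=> wfD airf tot Nl NT emba; have [w [wp wsat]] := tot N a NT emba.
have [f0 f'0] := proj1 (hsmooth_sat wfD wp) wsat.
by have [N' [H [z HP]]] := dense_generic Nl airf f0 f'0; exists N', H, z.
Qed.

Lemma pseudo_closed_hypersurface (K : lfield S) :
  pseudo_closed L T LI TI K -> hypersurface_closed K.
Proof.
move=> [KI pcK] D I0 rho lam wfD [rhoin qrho rhoq] lamP v airf df tot [E [eE [wE solE]]] solI.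
set f := poly_of (hf D) v in airf df.
have irf := abs_irreducible_elt airf.
have sf := mderiv_size_muni df.
have [F0 [eF [zF [genF gen_]]]] := generic_field irf sf.
set c := canon eF zF v.
have [nQ [hE [hEe hEw]]] := gen_solution_factor wfD irf sf genF gen_ solE.
(* The function field enters a model of every [TI i], along the given solution for [i] in [I0] and
   along a generic point in an elementary extension for the others. *)
have /choice[h hP] : forall i, exists X : {M : lfield S & {rmorphism F0 -> M}},
    [/\ models (projT1 X) (TI i), embedding (LI i) K (projT1 X) (projT2 X \o eF) &
      List.In i I0 -> sat (projT1 X) (projT2 X \o c) (lam i)].
  move=> i; have [/solI[M [a [w [MT emba sol]]]]|nI] := pselect (List.In i I0).
    have [a' a'E] := embedding_rmorphism emba; rewrite -a'E in sol emba.
    have [_ [h [he hw]]] := gen_solution_factor wfD irf sf genF gen_ sol.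
    exists (existT _ M h); split=> //=; first by rewrite (_ : h \o eF = a' :> (_ -> _)) //; apply: funext.
    have [_ _ [_ [_ wlam]]] := sol => _; apply: (proj1 (sat_ext _)) wlam => k kl.
    by apply/esym/hw; have [_ _] := lamP i; apply.
  have [N [a [Nl NT NTi embL embi]]] := model_of_TI i KI.
  have [a' a'E] := embedding_rmorphism embL; rewrite -a'E in embL embi.
  have [N' [H [z [Hsat genz]]]] := totally_smooth_generic wfD airf tot Nl NT embL.
  have [h [he hz]] := generic_lift irf sf genF gen_ genz.
  exists (existT _ N' h); split=> //=.
    by apply: (models_elementary (@TI_in i) _ NTi) => phi _ u; apply: Hsat.
  rewrite (_ : h \o eF = H \o a' :> (_ -> _)); last exact: funext.
  apply: embedding_comp embi _; apply: elementary_embedding_embedding.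
  by move=> phi _ u; apply: Hsat.
(* Each relation is pulled back from the model attached to its language; disjointness makes that
   language unique. *)
pose F := @LField S F0 (fun _ _ => 0) (fun r x => exists i,
  has_rel (LI i) r /\ @s_rel S (projT1 (h i)) r (fun j => projT2 (h i) (x j))).
have embF i : embedding (LI i) F (projT1 (h i)) (projT2 (h i)).
  split; [exact: fmorph_inj|by split; [exact: rmorph0|exact: rmorph1]| |by move=> f0 /LI_relational|].
    by split; [exact: rmorphD|exact: rmorphN|exact: rmorphM].
  move=> r ir x; split=> [[j [jr]]|]; last by exists i.
  have [->//|ij] := pselect (i = j).
  by case: (proj2 (LI_disjoint ij) r).
have FI : models_TI LI TI F.
  move=> i; have [hT _ _] := hP i.
  exact: (models_universal_substructure (embF i) (models_universal_consequences hT)).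
have embK : embedding (lang_bigunion LI) K F eF.
  split; [exact: fmorph_inj|by split; [exact: rmorph0|exact: rmorph1]| |by move=> f0 [i /LI_relational]|].
    by split; [exact: rmorphD|exact: rmorphN|exact: rmorphM].
  move=> r [i ir] x; have [_ [_ _ _ _ /(_ r ir x) ->] _] := hP i.
  by have [_ _ _ _ /(_ r ir) ->] := embF i.
have regF : regular eF by apply: generic_regular airf sf genF gen_.
(* A smooth point of the model becomes generic in an elementary extension, into which the function
   field then maps over [K]. *)
have totF : totally L T K F eF.
  move=> M a MT emba; have [N [k [Nl kN]]] := large_lfield MT.
  have [k' [kM kK kK']] := isomorphism_sym kN.
  have embN := embedding_comp emba (proj2 (isomorphism_mono L kM)).
  have [a' a'E] := embedding_rmorphism embN; rewrite -a'E in embN.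
  have NT : models N T by apply: (proj2 (models_isomorphism T_in (isomorphism_mono L kN))).
  have [N' [H [z [Hsat genz]]]] := totally_smooth_generic wfD airf tot Nl NT embN.
  have [g [ge gz]] := generic_lift irf sf genF gen_ genz.
  exists N', (fun x => H (k' x)), g; split; last by move=> x; rewrite ge /= a'E.
    move=> phi _ u; rewrite -(Hsat phi (fun j => k' (u j))).
    exact: (sat_isomorphism u kM (formula_in_full _)).
  exact: (@rmorphism_embedding S F N' g).
have ecF := existentially_closed_normal (pcK F eF embK FI regF totF).
pose psi := FAnd rho (conj_list [seq lam i | i <- I0]).
have qpsi : quantifier_free psi.
  split=> //; apply: qf_conj_list => phi /List.in_map_iff[i [<- _]].
  by have [] := lamP i.
have psiin : formula_in (lang_bigunion LI) psi.
  split; first exact: formula_in_ring.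
  apply: formula_in_conj_list => phi /List.in_map_iff[i [<- _]].
  by have [H _ _] := lamP i; apply: formula_in_mono H => s; exists i.
have cpsi : sat F c psi.
  split.
    apply/(sat_embedding (M := F) c (@rmorphism_embedding S F E hE) rhoin qrho).
    have [_ _ [_ [_ wrho]]] := solE; apply: (proj1 (sat_ext _)) wrho => k /rhoq kq.
    by rewrite hEw.
  apply/sat_conj_list => phi /List.in_map_iff[i [<- iI]].
  have [_ _ /(_ iI) H] := hP i; have [lamin qlam _] := lamP i.
  exact/(sat_embedding (M := F) c (embF i) lamin qlam).
have cp k : (k < hp D)%N -> c k = eF (v k) by exact: canon_param.
have [w [wp [wrho /sat_conj_list wlam]]] := ec_normal_pullback ecF psiin qpsi cp cpsi.
by exists w; split=> // i iI; apply: wlam; apply: List.in_map.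
Qed.

Lemma hypersurface_pseudo_closed (K : lfield S) :
  models_TI LI TI K -> hypersurface_closed K -> pseudo_closed L T LI TI K.
Proof.
move=> KI clK; split=> // F e embe FI rege tote; apply: ec_normal_closed.
have [e' e'E] := embedding_rmorphism embe; rewrite -e'E in embe rege tote *.
move: e' {e e'E} embe rege tote => e embe rege tote psi psi_in qpsi v u upsi.
have [B psiB] := free_var_bound psi.
have [rho [lam [I0 [[rhoin qrho wrho rhopsi] lamP psiE]]]] :=
  exists_split_diagram LI_relational psi_in qpsi upsi.
have [d [z [f [indep minf df xz]]]] := hypersurface_model (fun i : 'I_B => u i) rege.
have /choice[PQ PQP] : forall l, exists PQ : {mpoly K[d.+1]} * {mpoly K[d.+1]},
    (l < B)%N -> mmap e z PQ.2 <> 0 /\ u l = mmap e z PQ.1 / mmap e z PQ.2.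
  move=> l; have [lB|_] := ltnP l B; last by exists (0, 0).
  by have [P [Q H]] := xz (Ordinal lB); exists (P, Q).
(* The values of [v] come first and keep their numbers; the coefficients of the hypersurface and of
   the fractions follow. *)
pose pl := [seq v k | k <- iota 0 B] ++ (coefficients f ++
  flatten [seq coefficients (PQ l).1 ++ coefficients (PQ l).2 | l <- iota 0 B]).
have fpl : {subset coefficients f <= pl} by move=> a af; rewrite !mem_cat af orbT.
have PQpl l : (l < B)%N ->
    {subset coefficients (PQ l).1 <= pl} /\ {subset coefficients (PQ l).2 <= pl}.
  move=> lB; have lin : l \in iota 0 B by rewrite mem_iota.
  split=> a al; rewrite !mem_cat; apply/orP; right; apply/orP; right; apply/flattenP;
    exists (coefficients (PQ l).1 ++ coefficients (PQ l).2); by [apply/mapP; exists l|rewrite mem_cat al ?orbT].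
have Bpl : (B <= size pl)%N by rewrite size_cat size_map size_iota leq_addr.
pose v' := nth 0 pl.
have v'E k : (k < B)%N -> v' k = v k.
  by move=> kB; rewrite /v' nth_cat size_map size_iota kB (nth_map 0%N) ?size_iota // nth_iota.
pose D := @HData (size pl) d B (code pl f)
  (fun l => if (l < B)%N then code pl (PQ l).1 else [::])
  (fun l => if (l < B)%N then code pl (PQ l).2 else [::]).
have wfD : hwf D.
  split=> [|l] /=; first exact: code_below.
  by case: ltnP => // /PQpl[H1 H2]; split; exact: code_below.
have fE : poly_of (hf D) v' = f by exact: poly_of_code.
have PE l : (l < B)%N -> poly_of (hP D l) v' = (PQ l).1.
  by move=> lB /=; rewrite lB; apply: poly_of_code; case: (PQpl l lB).
have QE l : (l < B)%N -> poly_of (hQ D l) v' = (PQ l).2.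
  by move=> lB /=; rewrite lB; apply: poly_of_code; case: (PQpl l lB).
have [f0 fz fmin] := minf.
have airf := regular_minimal_abs_irreducible rege minf.
(* Parameters of [psi], at even places, go to the head of [pl]; witnesses, at odd places, go to the
   variables of the fractions. *)
pose r k := if odd k then (size pl + d.+1 + k./2)%N else k./2.
have rq k : (k < B)%N -> (r k < hq D)%N.
  by move=> kB; rewrite /r /hq /=; case: ifP => _; lia.
have ren_var phi k : quantifier_free phi -> (forall k, free_var k phi -> free_var k psi) ->
    free_var k (formula_ren r phi) -> (k < hq D)%N.
  by move=> qphi phipsi /(free_var_ren qphi)[l [/phipsi/psiB lB ->]]; exact: rq.
have genz : generic_point e (poly_of (hf D) v') z by rewrite fE.
have canonE k : (k < B)%N -> canon (D := D) e z v' (r k) = mix (fun k => e (v k)) u k.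
  move=> kB; rewrite /r /mix; case: ifP => _.
    rewrite canon_frac PE ?QE; try lia.
    by have [|_ ->//] := PQP k./2; lia.
  have kB2 : (k./2 < B)%N by lia.
  by rewrite canon_param ?v'E //; exact: leq_trans kB2 Bpl.
have sol phi : formula_in (lang_bigunion LI) phi -> quantifier_free phi ->
    (forall k, free_var k phi -> free_var k psi) ->
    sat F (mix (fun k => e (v k)) u) phi ->
    gen_solution D e v' (formula_ren r phi) (canon (D := D) e z v').
  move=> phi_in qphi phipsi wphi; apply: gen_solution_canon => //.
    by move=> l lB; rewrite QE //; apply/eqP; case: (PQP l lB).
  apply/(sat_ren (M := F) _ _ qphi); apply: (proj1 (sat_ext _)) wphi => k /phipsi/psiB kB.
  by rewrite /= canonE.
(* The generic point in [F] is smooth and maps into an elementary extension of [M]; that some smooth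
   point exists over parameters from [M] is a formula, so it descends to [M]. *)
have tot : totally_smooth D v'.
  move=> M a MT emba; have [M' [h [g [elh embg ge]]]] := tote M a MT emba.
  have wp k : (k < hp D)%N -> canon (D := D) e z v' k = e (v' k) by apply: canon_param.
  have smF : sat F (canon (D := D) e z v') (hsmooth S D).
    apply/(hsmooth_sat wfD wp); rewrite canon_var fE; split=> //.
    apply/eqP => f'z; have := msize_mderiv_lt ord_max f0.
    by rewrite ltnNge fmin.
  have smM' : sat M' (fun k => g (canon (D := D) e z v' k)) (hsmooth S D).
    by apply: (proj2 (sat_embedding (M := F) _ embg (hsmooth_in _ _) _)) smF.
  have : sat M' (fun k => h (a (v' k))) (exs (iota (size pl) d.+1) (hsmooth S D)).
    apply/sat_exs; exists (fun k => g (canon (D := D) e z v' k)).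
    apply: (proj1 (sat_ext _)) smM' => k /(hsmooth_var wfD) kp.
    rewrite mem_iota (kp : (k < size pl + d.+1)%N) andbT.
    by case: leqP => // kpl; rewrite -ge canon_param.
  have exin : formula_in L (exs (iota (size pl) d.+1) (hsmooth S D)).
    by apply/formula_in_exs; exact: hsmooth_in.
  move/(elh _ exin (fun k => a (v' k))) => /sat_exs[x xsat].
  exists (fun k => if k \in iota (size pl) d.+1 then x k else a (v' k)); split=> // k kp.
  by rewrite mem_iota leqNgt (kp : (k < size pl)%N).
have solI i : exists (M : lfield S) (a : K -> M) w, [/\ models M (TI i), embedding (LI i) K M a &
    gen_solution D a v' (formula_ren r (lam i)) w].
  have [N [a [_ _ NT _ emba]]] := model_of_TI i FI.
  have [lamin qlam wlam lampsi] := lamP i.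
  exists N, (fun x => a (e x)), (fun k => a (canon (D := D) e z v' k)); split=> //.
    apply: embedding_comp emba.
    by apply: embedding_mono embe => s si; exists i.
  apply: (gen_solution_embedding emba); [exact: formula_in_ren|exact: qf_ren|].
  by apply: sol => //; apply: formula_in_mono lamin => s si; exists i.
have rhoP : [/\ formula_in (ring_language S) (formula_ren r rho), quantifier_free (formula_ren r rho) &
    forall k, free_var k (formula_ren r rho) -> (k < hq D)%N].
  by split=> [||k]; [exact: formula_in_ren|exact: qf_ren|exact: ren_var].
have lamP' i : [/\ formula_in (LI i) (formula_ren r (lam i)), quantifier_free (formula_ren r (lam i)) &
    forall k, free_var k (formula_ren r (lam i)) -> (k < hq D)%N].
  have [lamin qlam wlam lampsi] := lamP i.
  by split=> [||k]; [exact: formula_in_ren|exact: qf_ren|exact: ren_var].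
have [|||w [wp wrho' wlam]] := clK D I0 _ _ wfD rhoP lamP' v' _ _ tot _ (fun i _ => solI i).
- by rewrite fE.
- by rewrite fE.
- exists F, e, (canon (D := D) e z v'); apply: sol => //; exact: formula_in_ring.
exists (fun l => w (size pl + d.+1 + l)%N).
have wE k : (k < B)%N -> mix v (fun l => w (size pl + d.+1 + l)%N) k = w (r k).
  move=> kB; rewrite /mix /r; case: ifP => // _.
  have kB2 : (k./2 < B)%N by lia.
  by rewrite wp ?v'E //; exact: leq_trans kB2 Bpl.
have wren phi : quantifier_free phi -> (forall k, free_var k phi -> free_var k psi) ->
    sat K w (formula_ren r phi) -> sat K (mix v (fun l => w (size pl + d.+1 + l)%N)) phi.
  move=> qphi phipsi /(sat_ren (M := K) _ _ qphi); apply: (proj1 (sat_ext _)) => k /phipsi/psiB kB.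
  by rewrite /= wE.
apply: psiE; first exact: wren wrho'.
by move=> i /wlam; have [_ qlam _ lampsi] := lamP i; apply: wren.
Qed.

Lemma generic_formula D (i : I) lam : hwf D ->
    [/\ formula_in (LI i) lam, quantifier_free lam &
      forall k, free_var k lam -> (k < hq D)%N] ->
  exists theta, [/\ formula_in (LI i) theta, quantifier_free theta &
    forall K : lfield S, models_TI LI TI K -> forall v : nat -> K,
      sat K v theta <-> exists (M : lfield S) (a : K -> M) w,
        [/\ models M (TI i), embedding (LI i) K M a & gen_solution D a v lam w]].
Proof.
move=> wfD [lamin qlam lamq].
(* Besides the parameters only the [hd D] independent coordinates stay free; the dependent
   coordinate and the values of the fractions, [(hm D).+1] variables, are quantified. *)
pose ks := iota (hp D + hd D) (hm D).+1.
pose body := FAnd (hzero S D) (FAnd (hfrac S D) lam).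
have bodyin : formula_in (LI i) (exs ks body).
  by apply/formula_in_exs; split; [exact: hzero_in|split=> //; exact: hfrac_in].
have bodyq k : free_var k body -> (k < hq D)%N.
  have fr l : (l < hp D + (hd D).+1)%N -> (l < hq D)%N by rewrite /hq; lia.
  case=> [|[|/lamq//]]; first by move=> H; apply/fr/(hsmooth_var (S := S) wfD); left.
  move=> /free_var_conj_map[l lm] /= [[[|]|]|[|]//].
  - by move/(term_of_var (proj2 (proj2 wfD l)) (leqnn _)); apply: fr.
  - by move=> ->; rewrite /hq ltn_add2l.
  - by move/(term_of_var (proj1 (proj2 wfD l)) (leqnn _)); apply: fr.
  - by move/(term_of_var (proj2 (proj2 wfD l)) (leqnn _)); apply: fr.
have bodyp k : free_var k (exs ks body) -> (k < hp D + hd D)%N.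
  by move=> /free_var_exs[]; rewrite mem_iota => kp /bodyq; rewrite /hq; lia.
have [theta [thetain qtheta _ thetaE]] := definable_generic_sat bodyin bodyp.
exists theta; split=> // K' KI v; rewrite thetaE //; split=> -[M [a [w]]].
  move=> [MT emba wp indep /sat_exs[x xsat]].
  exists M, a, (fun k => if k \in ks then x k else w k); split=> //; split=> //.
    by move=> k kp; rewrite mem_iota ifF ?wp //; lia.
  move=> q q0; apply: indep; rewrite -[RHS]q0; apply: mmap_ext => // l.
  by rewrite /hvar /= mem_iota ifF //; have := ltn_ord l; lia.
move=> [MT emba [wp indep wsat]]; exists M, a, w; split=> //.
by apply/sat_exs; exists w; apply: (proj1 (sat_ext _)) wsat => k _; case: ifP.
Qed.

(** * The criterion in ultraproducts *)

Section UltraproductClosed.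

Variables (J : Type) (j0 : J) (U : (J -> Prop) -> Prop).
Hypothesis UU : @filter.UltraFilter J U.
Variables (K : J -> lfield S) (N : lfield S).
Variable c : {rmorphism prod_ring (fun j => lf_field (K j)) j0 -> N}.
Hypotheses (csurj : forall x, exists y, c y = x)
  (cE : forall x, c x = 0 <-> U (fun j => x j = 0))
  (los : forall phi (v : nat -> forall j, K j),
    sat N (fun k => c (v k)) phi <-> U (fun j => sat (K j) (fun k => v k j) phi)).

Lemma ultraproduct_totally_smooth D (v : nat -> forall j, K j) :
    totally_smooth D (fun k => c (v k)) ->
  U (fun j => totally_smooth D (fun k => v k j)).
Proof.
move=> tot; apply: contrapT => /(ultraN UU) ntot.
have bad j : exists X : {M : structure S & K j -> M}, ~ totally_smooth D (fun k => v k j) ->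
    [/\ models (projT1 X) T, embedding L (K j) (projT1 X) (projT2 X) &
      forall w, (forall k, (k < hp D)%N -> w k = projT2 X (v k j)) ->
        ~ sat (projT1 X) w (hsmooth S D)].
  have [tj|ntj] := pselect (totally_smooth D (fun k => v k j)).
    by exists (existT (fun M : structure S => K j -> M) (K j) id).
  apply: contrapT => nX; case: ntj => M a MT emba; apply: contrapT => nw; case: nX.
  exists (existT (fun M : structure S => K j -> M) M a); split=> // w wp wsat.
  by case: nw; exists w.
pose M j := projT1 (projT1 (cid (bad j))).
pose a j : K j -> M j := projT2 (projT1 (cid (bad j))).
have MP j : ~ totally_smooth D (fun k => v k j) ->
    [/\ models (M j) T, embedding L (K j) (M j) (a j) &
      forall w, (forall k, (k < hp D)%N -> w k = a j (v k j)) -> ~ sat (M j) w (hsmooth S D)].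
  exact: (projT2 (cid (bad j))).
have [M' [cM [cMsurj losM]]] := ultraproduct UU M.
have M'T : models M' T.
  move=> phi Tphi u; have [u' u'E] := choice (fun k => cMsurj (u k)).
  rewrite (_ : u = fun k => cM (u' k)); last by apply: funext => k; rewrite u'E.
  by apply/losM; apply: ultraS ntot => j /MP[MT _ _]; apply: MT.
have [r rE] := choice csurj.
pose av k j := a j (v k j).
(* The embedding is computed on representatives; [aNE] shows that their choice does not matter. *)
pose aN y := cM (fun j => a j (r y j)).
have aNE y x : c x = y -> aN y = cM (fun j => a j (x j)).
  move=> xy; have Urx : U (fun j => r y j = x j).
    have : c (r y - x) = 0 by rewrite rmorphB rE xy subrr.
    by move/cE; apply: ultraS => j Ej; apply/eqP; rewrite -subr_eq0; apply/eqP; exact: Ej.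
  pose w k : forall j, M j := if k is 0%N then (fun j => a j (r y j)) else (fun j => a j (x j)).
  have : sat M' (fun k => cM (w k)) (FEq (TVar S 0) (TVar S 1)).
    by apply/losM; apply: ultraS Urx => j /= ->.
  by [].
have embN : embedding L N M' aN.
  apply: embedding_of_sat => phi Lphi qphi u usat.
  apply/losM; have : sat N (fun k => c (r (u k))) phi.
    by apply: (proj1 (sat_ext _)) usat => k _; rewrite rE.
  move/los => Uphi; apply: ultraS (ultraI UU Uphi ntot) => j [phij /MP[_ embj _]].
  exact: (proj2 (sat_embedding (M := K j) _ embj Lphi qphi)).
have [w [wp wsat]] := tot M' aN M'T embN.
have [w' w'E] := choice (fun k => cMsurj (w k)).
pose w2 k := if (k < hp D)%N then av k else w' k.
have : sat M' (fun k => cM (w2 k)) (hsmooth S D).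
  apply: (proj1 (sat_ext _)) wsat => k _; rewrite /w2; case: ifP => [kp|_]; last by rewrite w'E.
  by rewrite wp // (aNE _ (v k)).
move/losM => Uw; have [j [wj /MP[_ _ H]]] := ultra_ex UU (ultraI UU Uw ntot).
by apply: H wj => k kp; rewrite /w2 kp.
Qed.

Lemma ultraproduct_models_TI : (forall j, models_TI LI TI (K j)) -> models_TI LI TI N.
Proof.
move=> KI i phi phiP u; have [u' u'E] := choice (fun k => csurj (u k)).
rewrite (_ : u = fun k => c (u' k)); last by apply: funext => k; rewrite u'E.
by apply/los; apply: ultraS (ultraT UU) => j _; apply: KI phiP _.
Qed.

Lemma ultraproduct_hypersurface_closed :
    (forall j, models_TI LI TI (K j)) -> (forall j, hypersurface_closed (K j)) ->
  hypersurface_closed N.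
Proof.
move=> KI clK D I0 rho lam wfD rhoP lamP v0 airf df tot [E [eE [wE solE]]] solI.
have NI := ultraproduct_models_TI KI.
have [v vE] := choice (fun k => csurj (v0 k)).
have {vE} v0E : v0 = fun k => c (v k) by apply: funext => k; rewrite vE.
move: v0E airf df tot solE solI => -> airf df tot solE solI.
have Qc s : poly_of s (fun k => c (v k)) = map_mpoly c (poly_of s v) by exact: poly_of_rmorph.
have Qj n (s : pdata n) j : poly_of s (fun k => v k j) =
    map_mpoly (@prod_proj J j0 (fun j => lf_field (K j)) j) (poly_of s v).
  exact: (poly_of_rmorph (@prod_proj J j0 (fun j => lf_field (K j)) j)).
have Uair : U (fun j => abs_irreducible (poly_of (hf D) (fun k => v k j))).
  rewrite Qc in airf; apply: ultraS (ultra_abs_irreducible UU csurj cE airf) => j.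
  by rewrite Qj.
have Udf : U (fun j => (poly_of (hf D) (fun k => v k j))^`M(ord_max) != 0).
  apply: contrapT => /(ultraN UU) H; move/eqP: df; apply.
  rewrite -poly_of_deriv (poly_of_rmorph c); apply/(map_mpoly_ultra UU cE).
  apply: ultraS H => j /negP; rewrite negbK => /eqP H.
  by rewrite -Qj poly_of_deriv.
have Utot := ultraproduct_totally_smooth tot.
(* The given extension of [N] says nothing about the factors; the ring part is moved to the generic
   point assembled from their function fields. *)
have UR : U (fun j => exists (E : lfield S) (e : {rmorphism K j -> E}) w,
    gen_solution D e (fun k => v k j) rho w).
  have [||G [e [z [F [cF [eN [losF cFsurj eNE genz Ugen]]]]]]] :=
    @ultraproduct_generic_point S J j0 U (fun j => lf_field (K j)) N c _ (poly_of (hf D) v) UU csurj cE.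
  - by apply: ultraS Uair => j; rewrite Qj.
  - by apply: ultraS Udf => j; rewrite Qj.
  rewrite -Qc in genz; have [rhoin qrho rhoq] := rhoP.
  have [_ _ wsat] := gen_solution_transfer wfD rhoin qrho rhoq airf df solE genz.
  set w := canon _ _ _ in wsat.
  have [r rE] := choice cFsurj.
  pose w' k j := if (k < hp D)%N then e j (v k j)
    else if (k < hp D + (hd D).+1)%N then z (inord (k - hp D)) j else r (w k) j.
  have wE' k : cF (w' k) = w k.
    rewrite /w' /w /canon; case: ifP => [kp|_]; first by rewrite eNE.
    by case: ifP.
  have : sat F (fun k => cF (w' k)) (FAnd (hzero S D) (FAnd (hfrac S D) rho)).
    by apply: (proj1 (sat_ext _)) wsat => k _; rewrite wE'.
  move/losF => Uw; apply: ultraS (ultraI UU Uw Ugen) => j [wj [indep _]].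
  exists (G j), (e j), (fun k => w' k j); split=> // [k kp|]; first by rewrite /w' kp.
  move=> q q0; apply: indep; rewrite -[RHS]q0; apply: mmap_ext => // l.
  rewrite /= /hvar /w' ltnNge leq_addr /= ltn_add2l ltnS ltnW //.
  by congr (z _ j); apply: val_inj; rewrite /= inordK addKn // ltnW // ltnS.
(* Definability enters here: [theta] holds in [N], hence in almost every factor. *)
have UH : U (fun j => forall i, List.In i I0 -> exists (M : lfield S) (a : K j -> M) w,
    [/\ models M (TI i), embedding (LI i) (K j) M a &
        gen_solution D a (fun k => v k j) (lam i) w]).
  apply: (ultra_seq UU) => i iI.
  have [theta [_ _ thetaE]] := generic_formula wfD (lamP i).
  have /(thetaE N NI) /los := solI i iI.
  by apply: ultraS => j; apply: (proj1 (thetaE (K j) (KI j) _)).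
have Uw := ultraI UU (ultraI UU Uair Udf) (ultraI UU Utot (ultraI UU UR UH)).
(* The parameters are imposed even at indices where the hypotheses fail, so that their equality in
   [N] holds index by index. *)
have pick j : exists w : nat -> K j, (forall k, (k < hp D)%N -> w k = v k j) /\
    (abs_irreducible (poly_of (hf D) (fun k => v k j)) /\
       (poly_of (hf D) (fun k => v k j))^`M(ord_max) != 0 ->
     totally_smooth D (fun k => v k j) ->
     (exists (E : lfield S) (e : {rmorphism K j -> E}) w, gen_solution D e (fun k => v k j) rho w) ->
     (forall i, List.In i I0 -> exists (M : lfield S) (a : K j -> M) w,
       [/\ models M (TI i), embedding (LI i) (K j) M a &
           gen_solution D a (fun k => v k j) (lam i) w]) ->
     sat (K j) w rho /\ forall i, List.In i I0 -> sat (K j) w (lam i)).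
  have [[w [wp w1 w2]]|nw] := pselect (exists w : nat -> K j,
      [/\ forall k, (k < hp D)%N -> w k = v k j, sat (K j) w rho &
        forall i, List.In i I0 -> sat (K j) w (lam i)]); first by exists w.
  exists (fun k => v k j); split=> // -[aj dj] tj Rj Hj; case: nw.
  exact: (clK j D I0 rho lam wfD rhoP lamP _ aj dj tj Rj Hj).
pose w k j := projT1 (cid (pick j)) k.
have wP j := projT2 (cid (pick j)).
have {}Uw : U (fun j => sat (K j) (fun k => w k j) rho /\
    forall i, List.In i I0 -> sat (K j) (fun k => w k j) (lam i)).
  by apply: ultraS Uw => j [aj [tj [Rj Hj]]]; have [_] := wP j; apply.
exists (fun k => c (w k)); split.
- move=> k kp; congr (c _); apply: functional_extensionality_dep => j.
  by have [wp _] := wP j; apply: wp.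
- by apply/los; apply: ultraS Uw => j [].
- by move=> i iI; apply/los; apply: ultraS Uw => j [_]; apply.
Qed.

End UltraproductClosed.

(** * Existentially closed substructures and the conclusion *)

Local Notation A := (lang_union L (lang_bigunion LI)).

Lemma ec_normal_models_TI (K N : lfield S) (g : K -> N) :
  embedding A K N g -> models_TI LI TI N -> models_TI LI TI K.
Proof.
move=> embg NI i; apply: models_universal_substructure (NI i).
by apply: embedding_mono embg => s si; right; exists i.
Qed.

(** The hypotheses go up to [N], the solution comes down by existential closedness. Going up, the
    [LI i] parts rely on [theta] being quantifier-free, and the ring part on a point generic over
    [N] being generic over [K]. *)
Lemma ec_normal_hypersurface_closed (K N : lfield S) (g : K -> N) :
  ec_normal (M := K) (N := N) A g -> models_TI LI TI N -> hypersurface_closed N -> hypersurface_closed K.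
Proof.
move=> ecg NI clN D I0 rho lam wfD rhoP lamP v airf df tot [E [eE [wE solE]]] solI.
have embg := ec_normal_embedding ecg.
have KI := ec_normal_models_TI embg NI.
have [g' g'E] := embedding_rmorphism embg; rewrite -g'E in ecg embg.
move: g' ecg embg {g'E} => {}g ecg embg.
have fE : poly_of (hf D) (fun k => g (v k)) = map_mpoly g (poly_of (hf D) v).
  exact: poly_of_rmorph.
have airN : abs_irreducible (poly_of (hf D) (fun k => g (v k))).
  by rewrite fE; apply: abs_irreducible_map.
have dfN : (poly_of (hf D) (fun k => g (v k)))^`M(ord_max) != 0.
  by rewrite fE map_mpoly_mderiv map_mpoly_eq0.
have totN : totally_smooth D (fun k => g (v k)).
  move=> M a MT emba; apply: (tot M (fun x => a (g x)) MT).
  by apply: embedding_comp emba; apply: embedding_mono embg => s; left.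
have RN : exists (E : lfield S) (e : {rmorphism N -> E}) w,
    gen_solution D e (fun k => g (v k)) rho w.
  have [F0 [e0 [z0 [genz gen_]]]] :=
    generic_field (abs_irreducible_elt airN) (mderiv_size_muni dfN).
  pose F := pure_lfield S F0; pose e : {rmorphism N -> F} := e0.
  have [rhoin qrho rhoq] := rhoP.
  have genK : generic_point (e \o g) (poly_of (hf D) v) z0.
    have [indep fz] := genz; rewrite fE mmap_map_mpoly in fz; split=> // q q0.
    apply/eqP; rewrite -(map_mpoly_eq0 g); apply/eqP; apply: indep.
    by rewrite mmap_map_mpoly.
  have [wp _ wsat] := gen_solution_transfer (e' := e \o g) wfD rhoin qrho rhoq airf df solE genK.
  exists F, e, (canon (D := D) (e \o g) z0 v); split=> //.
  by rewrite canon_var; have [] := genz.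
have HN i : List.In i I0 -> exists (M : lfield S) (a : N -> M) w,
    [/\ models M (TI i), embedding (LI i) N M a &
        gen_solution D a (fun k => g (v k)) (lam i) w].
  have [theta [thetain qtheta thetaE]] := generic_formula wfD (lamP i).
  move=> /solI /(thetaE K KI) Ktheta; apply/(thetaE N NI).
  apply: (proj2 (sat_embedding (M := K) _ embg _ qtheta)) Ktheta.
  by apply: formula_in_mono thetain => s si; right; exists i.
have [w [wp wrho wlam]] := clN D I0 rho lam wfD rhoP lamP _ airN dfN totN RN HN.
have [rhoin qrho _] := rhoP.
pose psi := FAnd rho (conj_list [seq lam i | i <- I0]).
have psi_in : formula_in A psi.
  split; first exact: formula_in_ring.
  apply: formula_in_conj_list => phi /List.in_map_iff[i [<- _]].
  by have [H _ _] := lamP i; apply: formula_in_mono H => s; right; exists i.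
have qpsi : quantifier_free psi.
  split=> //; apply: qf_conj_list => phi /List.in_map_iff[i [<- _]].
  by have [] := lamP i.
have wpsi : sat N w psi.
  by split=> //; apply/sat_conj_list => phi /List.in_map_iff[i [<- iI]]; apply: wlam.
have [w' [w'p [w'rho /sat_conj_list w'lam]]] := ec_normal_pullback ecg psi_in qpsi wp wpsi.
exists w'; split=> // i iI; apply: w'lam; exact: List.in_map.
Qed.

(** Inverses are the only field axiom not inherited by substructures; they come from existential
    closedness in [N]. *)
Lemma embedding_structure_lfield (M : structure S) (N : lfield S) (g : M -> N) :
  ec_normal (N := N) A g -> exists K : lfield S, lf_structure K = M.
Proof.
move=> ecg; have [ginj [g0 g1] [gD gN gM] _ _] := ec_normal_embedding ecg.
apply: structure_lfield.
- by move=> x y z; apply: ginj; rewrite !gD; apply: addrA.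
- by move=> x y; apply: ginj; rewrite !gD; apply: addrC.
- by move=> x; apply: ginj; rewrite gD g0; apply: add0r.
- by move=> x; apply: ginj; rewrite gD gN g0; apply: addNr.
- by move=> x y z; apply: ginj; rewrite !gM; apply: mulrA.
- by move=> x y; apply: ginj; rewrite !gM; apply: mulrC.
- by move=> x; apply: ginj; rewrite gM g1; apply: mul1r.
- by move=> x y z; apply: ginj; rewrite !(gD, gM); apply: mulrDl.
- move=> E; have /eqP := congr1 g E; rewrite g0 g1; apply/negP; exact: oner_neq0.
move=> x x0.
pose psi := FEq (TMul (TVar S 1) (TVar S 0)) (TOne S).
have psi_in : formula_in A psi by [].
have [|u ux] := ecg psi psi_in Logic.I (fun=> x) (fun=> (g x : N)^-1).
  rewrite /= /mix /=; apply: mulVf; apply/eqP => gx; apply: x0; apply: ginj.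
  by rewrite gx g0.
by exists (u 0%N).
Qed.

Theorem pseudo_closed_AE (M : structure S) :
  models M (AE_theory A (pseudo_closed_class L T LI TI)) -> pseudo_closed_class L T LI TI M.
Proof.
move=> /AE_theory_realization[J [U [P [g [UU PC real]]]]].
have [j0 _] := ultra_ex UU (ultraT UU).
have fields j : exists X : {K : lfield S & ((K -> P j) * (P j -> K))%type},
    [/\ isomorphism A (projT1 X) (P j) (projT2 X).1, cancel (projT2 X).2 (projT2 X).1,
        isomorphism A (P j) (projT1 X) (projT2 X).2 &
        pseudo_closed L T LI TI (projT1 X)].
  have [K [h [hP pcK]]] := PC j; have [h' [h'P hK h'K]] := isomorphism_sym hP.
  by exists (existT (fun K : lfield S => ((K -> P j) * (P j -> K))%type) K (h, h')).
pose K j : lfield S := projT1 (projT1 (cid (fields j))).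
pose h j : K j -> P j := (projT2 (projT1 (cid (fields j)))).1.
pose h' j : P j -> K j := (projT2 (projT1 (cid (fields j)))).2.
have hP j : [/\ isomorphism A (K j) (P j) (h j), cancel (h' j) (h j),
    isomorphism A (P j) (K j) (h' j) & pseudo_closed L T LI TI (K j)].
  exact: (projT2 (cid (fields j))).
have [N [c0 [c0surj los]]] := ultraproduct_lfield K UU.
have [c [c0E cE]] := los_rmorphism j0 UU los.
have csurj y : exists x, c y = x by exists (c y).
pose gN (x : M) : N := c0 (fun j => h' j (g j x)).
(* If [psi] had no witness over [M], its negation would hold universally at parameters from [M],
   hence in almost every factor; this contradicts the witness in [N]. *)
have ecg : ec_normal (N := N) A gN.
  move=> psi psi_in qpsi v u usat; apply: contrapT => nu.
  have [u0 u0E] := choice (fun k => c0surj (u k)).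
  have Uno := real (FNot psi) v psi_in qpsi (fun u' H => nu (ex_intro _ u' H)).
  pose w k : forall j, K j := mix (fun k j => h' j (g j (v k))) u0 k.
  have : sat N (fun k => c0 (w k)) psi.
    by apply: (proj1 (sat_ext _)) usat => k _; rewrite /w /mix; case: ifP => _; rewrite ?u0E.
  move/los => Uyes; have [j [no yes]] := ultra_ex UU (ultraI UU Uno Uyes).
  apply: (no (fun k => h j (u0 k j))); have [hj hK _ _] := hP j.
  move/(sat_isomorphism _ hj psi_in): yes; apply: (proj1 (sat_ext _)) => k _.
  by rewrite /w /mix; case: ifP => _; rewrite ?hK.
have [K0 K0M] := embedding_structure_lfield ecg; subst M.
have csurj' x : exists y, c y = x by have [y <-] := c0surj x; exists y; rewrite c0E.
have los' phi (v : nat -> forall j, K j) :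
    sat N (fun k => c (v k)) phi <-> U (fun j => sat (K j) (fun k => v k j) phi).
  rewrite -los; apply: sat_ext => k _; exact: c0E.
have KI j : models_TI LI TI (K j) by have [_ _ _ []] := hP j.
have NI : models_TI LI TI N by apply: (ultraproduct_models_TI UU csurj' los').
have clN : hypersurface_closed N.
  apply: (ultraproduct_hypersurface_closed UU csurj' cE los') => // j.
  by have [_ _ _] := hP j; apply: pseudo_closed_hypersurface.
exists K0, id; split; first exact: isomorphism_refl.
apply: hypersurface_pseudo_closed => //.
  exact: ec_normal_models_TI (ec_normal_embedding ecg) NI.
exact: ec_normal_hypersurface_closed ecg NI clN.
Qed.

End Main.

Theorem proposition4p9 (S : symbols) (L : language S) (T : theory S)
    (I : Type) (LI : I -> language S) (TI : I -> theory S)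
    (T_in : theory_in L T)
    (T_large : theory_of_large_fields T)
    (T_acf : algebraically_closed_expandable T)
    (TI_in : forall i, theory_in (LI i) (TI i))
    (LI_relational : forall i, relational (LI i))
    (LI_disjoint : pairwise_disjoint LI)
    (TI_qe : forall i, eliminates_quantifiers (LI i) (TI i))
    (TI_expand : forall i, expansion_property L T LI TI i)
    (TI_A : forall i, condition_A (LI i) (TI i))
    (TI_Z : forall i, condition_Z (LI i) (TI i)) :
  inductive_class (lang_union L (lang_bigunion LI))
    (pseudo_closed_class L T LI TI).
Proof.
have elem M : models M (AE_theory (lang_union L (lang_bigunion LI))
    (pseudo_closed_class L T LI TI)) -> pseudo_closed_class L T LI TI M.
  exact: pseudo_closed_AE.
split.
  exists (AE_theory (lang_union L (lang_bigunion LI)) (pseudo_closed_class L T LI TI)).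
  split=> [|M]; first exact: AE_theory_in.
  by split=> [/AE_theory_models|/elem].
move=> J U M e embe chain cover MC; apply: elem.
by apply: AE_theory_chain embe chain cover _ => j; apply: AE_theory_models.
Qed.
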